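(* Let $n\ge 1$, let $\Omega\subset\mathbb{R}^n$ be a bounded domain, let $1<p<\infty$, and let $s\in\mathbb{R}$. For $b>\max\{\lambda_1-s,\lambda_1\}$, the set $$\mathcal{O}_b=\{u\in S:\widetilde J_s(u)<b\}$$ is path-connected if and only if the point $(s+b,b)$ lies above $C_2$.
   Context: $X=W^{1,p}_0(\Omega)$ with norm $\|u\|=(\int_\Omega|\nabla u|^p)^{1/p}$, $u^\pm=\max\{\pm u,0\}$, $S=\{u\in X:\int_\Omega|u|^p=1\}$ (with the topology of $X$), and $\widetilde J_s(u)=\int_\Omega|\nabla u|^p-s\,(u^+)^p$ for $u\in S$. $\lambda_1>0$ is the first (simple) eigenvalue of $-\Delta_p$ on $W^{1,p}_0(\Omega)$, where $\Delta_p u=\operatorname{div}(|\nabla u|^{p-2}\nabla u)$, with positive eigenfunction $\varphi_1$ normalized by $\int_\Omega\varphi_1^p=1$. For $s\ge0$ let $c(s)=\inf_{\gamma\in\Gamma}\max_{u\in\gamma([0,1])}\widetilde J_s(u)$, where $\Gamma$ is the set of continuous paths in $S$ joining $\varphi_1$ and $-\varphi_1$. The first nontrivial curve in the Fučík spectrum of the $p$-Laplacian is $C_2=\{(s+c(s),c(s)):s\ge0\}\cup\{(c(s),s+c(s)):s\ge0\}$. A point $(a,b)$ lies above $C_2$ if $\min\{a,b\}>c(|a-b|)$. *)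

(* Defs.v *)
From HB Require Import structures.
From mathcomp Require Import all_boot all_order all_algebra.
From mathcomp Require Import all_classical all_reals all_analysis.

Set Implicit Arguments.
Unset Strict Implicit.
Unset Printing Implicit Defensive.
Import Order.TTheory GRing.Theory Num.Theory.
Import numFieldNormedType.Exports.
Local Open Scope classical_set_scope.
Local Open Scope ring_scope.

(** * Lebesgue measure on [R^n] *)

Definition measure_rV_display : measure_display -> measure_display.
Proof. exact. Qed.

(** Row vectors carry the product sigma-algebra, generated by the coordinates;
    for [T := R] this is the Borel sigma-algebra of [R^n]. *)
Section measurable_rV.
Context {d} {T : measurableType d}.
Variable n : nat.

Let coors : 'I_n -> 'rV[T]_n -> T := fun i x => x ord0 i.

Let rV_set0 : g_sigma_preimage coors set0.
Proof. exact: sigma_algebra0. Qed.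

Let rV_setC A : g_sigma_preimage coors A -> g_sigma_preimage coors (~` A).
Proof. exact: sigma_algebraC. Qed.

Let rV_bigcup (F : _^nat) : (forall i, g_sigma_preimage coors (F i)) ->
  g_sigma_preimage coors (\bigcup_i (F i)).
Proof. exact: sigma_algebra_bigcup. Qed.

HB.instance Definition _ := @isMeasurable.Build (measure_rV_display d)
  'rV[T]_n (g_sigma_preimage coors) rV_set0 rV_setC rV_bigcup.

End measurable_rV.

Lemma measurable_fun_rV d1 d2 (T1 : measurableType d1) (T2 : measurableType d2)
    n (f : T1 -> 'rV[T2]_n) :
  (forall i, measurable_fun [set: T1] (fun x => f x ord0 i)) ->
  measurable_fun [set: T1] f.
Proof.
move=> mf _ A mA; rewrite setTI.
suff : g_sigma_preimage (fun i => (fun v : 'rV[T2]_n => v ord0 i) \o f)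
    `<=` measurable.
  by apply; rewrite g_sigma_preimage_comp; exists A => //; rewrite setTI.
apply: smallest_sub; first exact: sigma_algebra_measurable.
case: n => [|n] in f mf A mA *; first by rewrite big_ord0.
rewrite -bigcup_mkord_ord; apply: bigcup_sub => i Ii.
by move=> B [C mC <-]; exact: mf.
Qed.

Lemma measurable_coord_rV d (T : measurableType d) n (i : 'I_n) :
  measurable_fun [set: 'rV[T]_n] (fun v => v ord0 i).
Proof.
move=> _ Y mY; rewrite setTI; apply: sub_sigma_algebra => /=.
rewrite -bigcup_seq/=; exists i => /=; first by rewrite mem_index_enum.
by exists Y => //; rewrite setTI.
Qed.

Section lebesgue_rV.
Variable R : realType.

(** The measure on [R^n.+1] is the product of the Lebesgue measure of [R] with
    the measure on [R^n], transported along [cons_rV]. *)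
Definition cons_rV n (xv : measurableTypeR R * 'rV[R]_n) : 'rV[R]_n.+1 :=
  row_mx (const_mx xv.1 : 'rV[R]_1) xv.2.

Lemma measurable_cons_rV n : measurable_fun setT (@cons_rV n).
Proof.
apply: measurable_fun_rV => i.
have [j ->|j ->] := split_ordP (i : 'I_(1 + n)).
  rewrite (_ : (fun _ => _) = fst) //.
  by apply/funext => -[x v]; rewrite [LHS]row_mxEl mxE.
rewrite (_ : (fun _ => _) = (fun v : 'rV[R]_n => v ord0 j) \o snd).
  by apply: measurableT_comp => //; exact: measurable_coord_rV.
by apply/funext => -[x v]; rewrite [LHS]row_mxEr.
Qed.

Definition uncons_rV n (v : 'rV[R]_n.+1) : measurableTypeR R * 'rV[R]_n :=
  (v ord0 ord0, rsubmx (v : 'rV[R]_(1 + n))).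

Lemma cons_rVK n : cancel (@cons_rV n) (@uncons_rV n).
Proof.
move=> [x v]; rewrite /uncons_rV /cons_rV /= row_mxKr; congr pair.
transitivity (row_mx (const_mx x : 'rV[R]_1) v ord0 (lshift n ord0)).
  by congr (row_mx _ _ _ _); exact/val_inj.
by rewrite row_mxEl mxE.
Qed.

Lemma measurable_uncons_rV n : measurable_fun setT (@uncons_rV n).
Proof.
apply/measurable_fun_pair; first exact: measurable_coord_rV.
apply: measurable_fun_rV => i.
rewrite (_ : (fun _ => _) =
    (fun v : 'rV[R]_n.+1 => v ord0 (rshift 1 i : 'I_(1 + n)))).
  exact: measurable_coord_rV.
by apply/funext => v; rewrite [LHS]mxE.
Qed.

Section lebesgue_rVS.
Variables (n : nat) (mu : {sigma_finite_measure set 'rV[R]_n -> \bar R}).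

Definition lebesgue_rVS : set 'rV[R]_n.+1 -> \bar R :=
  pushforward (@lebesgue_measure R \x mu)%E (@cons_rV n).

Let lebesgue_rVS0 : lebesgue_rVS set0 = 0%E.
Proof. by apply: measure0; exact: measurable_cons_rV. Qed.

Let lebesgue_rVS_ge0 A : (0 <= lebesgue_rVS A)%E.
Proof. by apply: measure_ge0; exact: measurable_cons_rV. Qed.

Let lebesgue_rVS_sigma_additive : semi_sigma_additive lebesgue_rVS.
Proof.
by apply: measure_semi_sigma_additive; exact: measurable_cons_rV.
Qed.

HB.instance Definition _ := isMeasure.Build _ _ _ lebesgue_rVS
  lebesgue_rVS0 lebesgue_rVS_ge0 lebesgue_rVS_sigma_additive.

Let sigma_finite_lebesgue_rVS : sigma_finite setT lebesgue_rVS.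
Proof.
have /sigma_finiteP[F [FT ndF Ffin]] := sigma_finiteT (@lebesgue_measure R).
have /sigma_finiteP[G [GT ndG Gfin]] := sigma_finiteT mu.
exists (fun k => @uncons_rV n @^-1` (F k `*` G k)).
  rewrite -preimage_bigcup (_ : \bigcup_i _ = setT) ?preimage_setT//.
  apply/seteqP; split => // -[x v] _.
  have [k _ Fkx] : (\bigcup_i F i) x by rewrite -FT.
  have [l _ Glv] : (\bigcup_i G i) v by rewrite -GT.
  exists (maxn k l) => //; split => /=.
    by move: x Fkx; exact/subsetPset/ndF/leq_maxl.
  by move: v Glv; exact/subsetPset/ndG/leq_maxr.
move=> k; have [mF Fk] := Ffin k; have [mG Gk] := Gfin k; split.
  rewrite -[X in measurable X]setTI.
  by apply: measurable_uncons_rV => //; exact: measurableX.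
rewrite /lebesgue_rVS /pushforward -comp_preimage.
rewrite (_ : uncons_rV (n := n) \o _ = id); last first.
  by apply/funext => x /=; rewrite cons_rVK.
rewrite preimage_id product_measure1E//.
by rewrite lte_mul_pinfty// ge0_fin_numE.
Qed.

HB.instance Definition _ := @Measure_isSigmaFinite.Build _ _ _
  lebesgue_rVS sigma_finite_lebesgue_rVS.

End lebesgue_rVS.

Fixpoint lebesgue_rV n : {sigma_finite_measure set 'rV[R]_n -> \bar R} :=
  if n is m.+1 then lebesgue_rVS (lebesgue_rV m) else \d_(0 : 'rV[R]_0).

End lebesgue_rV.

(** * Test functions *)

Section test_functions.
Variables (R : realType) (n : nat).
Implicit Types (Omega : set 'rV[R]_n) (f : 'rV[R]_n -> R).

(** The Euclidean norm; the library's norm on ['rV[R]_n] is the sup norm. *)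
Definition dotr (v w : 'rV[R]_n) : R := \sum_i v ord0 i * w ord0 i.
Definition enorm (v : 'rV[R]_n) : R := Num.sqrt (dotr v v).

Definition partial (i : 'I_n) f : 'rV[R]_n -> R :=
  fun x => 'D_(delta_mx ord0 i) f x.

Definition gradient f : 'rV[R]_n -> 'rV[R]_n := fun x => \row_i partial i f x.

Definition smooth f : Prop := forall l : seq 'I_n,
  continuous (foldr partial f l) /\
  forall i x, derivable (foldr partial f l) x (delta_mx ord0 i).

Definition test_function Omega f : Prop :=
  [/\ smooth f, compact (closure [set x | f x != 0]) &
      closure [set x | f x != 0] `<=` Omega].

Definition bounded_domain Omega : Prop :=
  [/\ open Omega, connected Omega, Omega !=set0 & bounded_set Omega].

End test_functions.

(** * The space [W^{1,p}_0(Omega)] *)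

(** A Sobolev function is represented by a pair [u]: the function [u.1] and a
    weak gradient [u.2] of it.  Since [u.1] determines [u.2] almost everywhere
    on [Omega], this is the usual space up to the choice of representatives;
    all the notions below only depend on the almost everywhere classes. *)
Notation sobolev_pair R n :=
  (('rV[R]_n -> R) * ('rV[R]_n -> 'rV[R]_n))%type.

Section sobolev.
Variables (R : realType) (n : nat) (Omega : set 'rV[R]_n) (p : R).
Local Notation mu := (lebesgue_rV R n).
Implicit Types (u v : sobolev_pair R n) (s t b lam : R).

Definition weak_gradient (f : 'rV[R]_n -> R) (g : 'rV[R]_n -> 'rV[R]_n) :=
  forall phi, test_function Omega phi -> forall i : 'I_n,
    \int[mu]_(x in Omega) (f x * partial i phi x) =
    - \int[mu]_(x in Omega) (g x ord0 i * phi x).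

(** The [p]-th power of the [W^{1,p}(Omega)] norm. *)
Definition W1p_energy u : \bar R :=
  (\int[mu]_(x in Omega) (`|u.1 x| `^ p + enorm (u.2 x) `^ p)%:E)%E.

Definition W1p : set (sobolev_pair R n) := [set u : sobolev_pair R n |
  [/\ measurable_fun Omega u.1,
      forall i, measurable_fun Omega (fun x => u.2 x ord0 i),
      (W1p_energy u < +oo)%E & weak_gradient u.1 u.2]].

(** [W^{1,p}_0(Omega)]: the closure of the test functions in
    [W^{1,p}(Omega)]. *)
Definition W1p0 : set (sobolev_pair R n) := [set u : sobolev_pair R n |
  W1p u /\
  exists2 phi : nat -> 'rV[R]_n -> R, forall k, test_function Omega (phi k) &
    W1p_energy (u - (phi k, gradient (phi k))) @[k --> \oo] --> 0%E].

Definition normX u : R := (\int[mu]_(x in Omega) (enorm (u.2 x) `^ p)) `^ p^-1.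

(** [gamma], restricted to [[0, 1]], is a path from [u] to [v] in [A],
    continuous for the norm of [W^{1,p}_0(Omega)]. *)
Definition path_in (A : set (sobolev_pair R n)) u v
    (gamma : R -> sobolev_pair R n) : Prop :=
  [/\ gamma 0 = u, gamma 1 = v,
      forall t, t \in `[0, 1] -> A (gamma t) &
      forall t, t \in `[0, 1] ->
        normX (gamma r - gamma t) @[r --> within `[0, 1] (nbhs t)] --> (0 : R)].

Definition path_connected (A : set (sobolev_pair R n)) : Prop :=
  forall u v, A u -> A v -> exists gamma, path_in A u v gamma.

(** * The first eigenvalue of the [p]-Laplacian *)

(** Weak solutions of [- Delta_p u = lam |u|^{p-2} u].  Whatever the value of
    [0 `^ (p - 2)], the integrands vanish where [u.2], respectively [u.1],
    does. *)
Definition eigenfunction lam u : Prop :=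
  [/\ W1p0 u, 0 < \int[mu]_(x in Omega) (`|u.1 x| `^ p) &
    forall v, W1p0 v ->
      \int[mu]_(x in Omega) (enorm (u.2 x) `^ (p - 2) * dotr (u.2 x) (v.2 x)) =
      lam * \int[mu]_(x in Omega) (`|u.1 x| `^ (p - 2) * u.1 x * v.1 x)].

Definition first_eigenvalue lam : Prop :=
  (exists u, eigenfunction lam u) /\
  forall lam' u, eigenfunction lam' u -> lam <= lam'.

(** * The functional and the first nontrivial curve *)

Definition sphere : set (sobolev_pair R n) :=
  [set u : sobolev_pair R n |
    W1p0 u /\ \int[mu]_(x in Omega) (`|u.1 x| `^ p) = 1].

Definition J s u : R :=
  \int[mu]_(x in Omega) (enorm (u.2 x) `^ p - s * Num.max (u.1 x) 0 `^ p).

Definition sublevel s b : set (sobolev_pair R n) :=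
  [set u : sobolev_pair R n | sphere u /\ J s u < b].

(** The minimax value [c(s)].  It is an infimum in the extended reals, so that
    an empty set of paths would give [+oo]; the supremum over a path is a
    maximum, since [J s] is continuous along it. *)
Definition minimax (phi1 : sobolev_pair R n) s : \bar R :=
  ereal_inf [set ereal_sup [set (J s (gamma t))%:E | t in `[0, 1]] |
             gamma in path_in sphere phi1 (- phi1)].

(** [(a, b)] lies above the curve
    [{(s + c(s), c(s)) | s >= 0} `|` {(c(s), s + c(s)) | s >= 0}]. *)
Definition above_curve (phi1 : sobolev_pair R n) (a b : R) : Prop :=
  (minimax phi1 `|a - b|%R < (Num.min a b)%:E)%E.

End sobolev.

(* Main.v *)
Require Import Defs.
From HB Require Import structures.
From mathcomp Require Import all_boot all_order all_algebra.
From mathcomp Require Import all_classical all_reals all_analysis.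
From mathcomp Require Import measurable_realfun ring lra.

Set Implicit Arguments.
Unset Strict Implicit.
Unset Printing Implicit Defensive.
Import Order.TTheory GRing.Theory Num.Theory.
Import numFieldNormedType.Exports.
Local Open Scope classical_set_scope.
Local Open Scope ring_scope.


(** The point [(s + b, b)] lies above the curve exactly when [phi1] and [- phi1]
    can be joined inside the sublevel set: an infimum below [b] yields a path
    below [b], and conversely [J s] attains its maximum along a path, being
    continuous by the Poincare inequality ([minimax_lt]). For negative [s] the
    symmetry [w |-> - w], which exchanges the two parts of [w], reduces the claim
    to [- s] ([above_curveP]). As [lam1 < b] and [lam1 < s + b], both [phi1] and
    [- phi1] belong to the sublevel set, so path-connectedness implies that the
    point lies above the curve.

    For the converse every [u] in the sublevel set has to be joined to [phi1] or
    to [- phi1] inside it. Explicit paths are used, not a deformation along a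
    gradient flow.

    - Write [u = pos u - neg u]. The masses and the energies of the two parts add
      up, so [J s u < b] forces [dir (pos u) < (s + b) mass (pos u)] or
      [dir (neg u) < b mass (neg u)]. The normalized segment from [u] to the good
      part stays in the sublevel set ([joined_part]).

    - It remains to join a nonnegative [u] of mass [1] and energy below [B] to
      [phi1] among such functions, whenever [lam1 < B] ([joined_phi]). Replace [u]
      by the maximum of [u] and [c phi1]. Convexity of [|v|^p] bounds the change
      of energy by the weak equation of [phi1] tested with the positive part of
      [c phi1 - u] ([dir_raise]): the cost is of order [c^p] for small [c], and
      once [s phi1 <= u] raising to [q s phi1] costs at most [q^(p-1) lam1] times
      the gain of mass. Hence [c] may grow geometrically while the quotient of
      energy and mass stays below [B], on the segments between consecutive
      functions as well. For a large multiple [T] the function [T phi1] accounts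
      for nearly all of the mass, and a last segment leads to it.

    These paths live in [W^{1,p}_0], whose elementary theory comes first:
    integration by parts on [R^n] ([integral_partial_eq0]), the description of
    [W^{1,p}_0] as the closure of the test functions, where the weak gradient
    condition passes to the limit ([W0_approximable]), its stability under
    positive parts ([pos_W0]), and the Poincare inequality ([poincare]). *)

(** * Borel structure and Lebesgue measure of [R^n] *)

Section borel_rV.
Variables (R : realType).
Implicit Types (n : nat).

Lemma ler_coord_norm n (x : 'rV[R]_n) i : `|x ord0 i| <= `|x|.
Proof.
by rewrite [leRHS]/Num.norm /= mx_normrE; apply/bigmax_geP; right => /=; exists (ord0, i).
Qed.

Lemma measurable_ball_rV n (x : 'rV[R]_n) (e : R) : measurable (ball x e).
Proof.
have [e0|e0] := leP e 0.
  rewrite (_ : ball x e = set0)//; apply/seteqP; split => // y [].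
  by rewrite ltNge e0.
rewrite (_ : ball x e =
    \bigcap_(i in [set: 'I_n]) [set y | ball (x ord0 i) e (y ord0 i)]).
  apply: fin_bigcap_measurable => [|i _]; first exact: finite_finset.
  rewrite -[X in measurable X]setTI.
  by apply: measurable_coord_rV => //; exact: measurable_ball.
apply/seteqP; split => [y [_ xy] i _|y xy]; first exact: xy.
by split => // i j; rewrite ord1; exact: xy.
Qed.

(** An open set is the union of the balls of rational centre and radius
    [1 / (k + 1)] that it contains. *)
Lemma open_measurable_rV n (U : set 'rV[R]_n) : open U -> measurable U.
Proof.
move=> oU.
pose c (a : 'rV[rat]_n * nat) : 'rV[R]_n := map_mx ratr a.1.
pose F (a : 'rV[rat]_n * nat) : set 'rV[R]_n :=
  if `[< ball (c a) a.2.+1%:R^-1 `<=` U >] then ball (c a) a.2.+1%:R^-1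
  else set0.
rewrite (_ : U = \bigcup_a F a).
  apply: countable_bigcupT_measurable => [|a]; first exact: countableP.
  by rewrite /F; case: ifPn => // _; exact: measurable_ball_rV.
apply/seteqP; split => [x Ux|x [a _]]; last first.
  by rewrite /F; case: ifPn => // /asboolP; exact.
have /nbhs_ballP[e /= e0 xeU] : nbhs x U by exact: open_nbhs_nbhs.
have [k ke] : exists k : nat, k.+1%:R^-1 < e / 2.
  have e20 : 0 < (e / 2)^-1 by rewrite invr_gt0 divr_gt0.
  exists (Num.truncn (e / 2)^-1); rewrite invf_plt ?posrE ?divr_gt0//.
  by have /andP[] := truncn_itv (ltW e20).
have k0 : (0 : R) < k.+1%:R^-1 by rewrite invr_gt0.
have /choice[q Hq] (i : 'I_n) : exists q : rat, ball (ratr q : R) k.+1%:R^-1 (x ord0 i).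
  have [|q] := @rat_in_itvoo R (x ord0 i - k.+1%:R^-1) (x ord0 i + k.+1%:R^-1).
    by rewrite ltrBlDr -addrA ltrDl addr_gt0.
  rewrite in_itv/= => /andP[q1 q2]; exists q.
  by rewrite /ball/= ltr_distl q1 q2.
have cx : ball (c (\row_i q i, k)) k.+1%:R^-1 x.
  by split => // i j; rewrite ord1 !mxE; exact: Hq.
exists (\row_i q i, k) => //; rewrite /F/=; case: ifPn => // /asboolP; case.
move=> y cy; apply: xeU; apply: (@le_ball _ _ _ (k.+1%:R^-1 + k.+1%:R^-1)).
  by rewrite [e]splitr; apply: lerD; exact: ltW.
by apply: ball_triangle cy; exact: ball_sym.
Qed.

Lemma continuous_measurable_rV n (f : 'rV[R]_n -> R) :
  continuous f -> measurable_fun setT f.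
Proof.
move=> cf; apply: (measurability _ (RGenOpens.measurableE R)).
move=> _ [_ [a [b ->]] <-]; rewrite setTI.
by apply: open_measurable_rV; apply: open_comp => // x _; exact: cf.
Qed.

Lemma norm_cons_rV n (x : R) (v : 'rV[R]_n) :
  `|x| <= `|cons_rV (x, v)| /\ `|v| <= `|cons_rV (x, v)|.
Proof.
split.
  have := ler_coord_norm (cons_rV (x, v)) (lshift n ord0 : 'I_(1 + n)).
  by rewrite [X in `|X|]row_mxEl mxE.
rewrite [leLHS]/Num.norm/= mx_normrE; apply/bigmax_leP; split => // -[i j] _ /=.
have := ler_coord_norm (cons_rV (x, v)) (rshift 1 j : 'I_(1 + n)).
by rewrite [X in `|X| <= _]row_mxEr (ord1 i).
Qed.

Lemma ball_lty n (M : R) : (lebesgue_rV R n [set v | (`|v| <= M)%R] < +oo)%E.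
Proof.
have mball m : measurable [set v : 'rV[R]_m | `|v| <= M].
  rewrite -[X in measurable X]setTI.
  rewrite (_ : [set v | _] = Num.norm @^-1` `]-oo, M]); last first.
    by apply/seteqP; split => v /=; rewrite in_itv.
  by apply: (continuous_measurable_rV (@norm_continuous _ _)).
elim: n => [|n ih].
  by rewrite /= diracE; case: (_ \in _); rewrite ltry.
rewrite [X in (X _ < _)%E](_ : _ = (@lebesgue_measure R \x lebesgue_rV R n)%E \o
   (fun A => cons_rV (n := n) @^-1` A))//=.
apply: (@le_lt_trans _ _
  ((@lebesgue_measure R \x lebesgue_rV R n)%E (`[- M, M] `*` [set v | `|v| <= M]))).
  apply: le_measure; rewrite ?inE//.
  - by rewrite -[X in measurable X]setTI; apply: measurable_cons_rV => //; exact: mball.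
  - by apply: measurableX; [exact: measurable_itv|exact: mball].
  - move=> -[x v] /= H; have [h1 h2] := norm_cons_rV x v.
    split => /=; last exact: le_trans H.
    by rewrite in_itv/= -ler_norml; exact: le_trans H.
rewrite product_measure1E; [|exact: measurable_itv|exact: mball].
apply: lte_mul_pinfty; [exact: measure_ge0| |exact: ih].
by rewrite [X in X \is a _]lebesgue_measure_itv/=; case: ifP.
Qed.

End borel_rV.

(** * Integration by parts on [R^n] *)

Section ibp.
Variable R : realType.
Implicit Types n : nat.

Lemma is_derive_line n (f : 'rV[R]_n -> R) (x v : 'rV[R]_n) (l : R) :
  is_derive x v f l <-> is_derive (0 : R) 1 (fun h : R => f (h *: v + x)) l.
Proof.
have E : (fun h : R => h^-1 *: ((f \o shift x) (h *: v) - f x)) =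
  (fun h : R => h^-1 *: (((fun h : R => f (h *: v + x)) \o shift 0) (h *: 1) -
    (fun h : R => f (h *: v + x)) 0)).
  by apply/funext => h /=; rewrite addr0 scale0r add0r [h%:A]mulr1.
by split=> -[d e]; split; move: d e; rewrite /derivable /derive E.
Qed.

(** The chain rule along a line. *)
Lemma is_derive_comp_dir n (g : R -> R) (f : 'rV[R]_n -> R) x v (a b : R) :
  is_derive (f x) 1 g a -> is_derive x v f b ->
  is_derive x v (g \o f) (a * b).
Proof.
move=> ga /is_derive_line fb; apply/is_derive_line.
apply: (@is_derive1_comp _ g (fun h : R => f (h *: v + x))) => //.
by rewrite scale0r add0r.
Qed.

(** Functions of bounded support that are of class [C^1] along the direction [i]. *)
Definition C1c n i (F : 'rV[R]_n -> R) :=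
  [/\ continuous F, forall x, derivable F x (delta_mx ord0 i),
      continuous (partial i F) & exists M, forall x, M < `|x| -> F x = 0].

Lemma partial_out n i (F : 'rV[R]_n -> R) M :
  (forall x, M < `|x| -> F x = 0) -> forall x, M < `|x| -> partial i F x = 0.
Proof.
move=> F0 x Mx; rewrite /partial -(derive_cst (0 : R) x (delta_mx ord0 i)).
apply: near_eq_derive; near=> y; rewrite F0//; near: y.
exact: (cvgr_gt _ (@norm_continuous _ _ x)).
Unshelve. all: by end_near. Qed.

Lemma integrable_bounded_support n (f : 'rV[R]_n -> R) M : continuous f ->
  (forall x, M < `|x| -> f x = 0) ->
  (lebesgue_rV R n).-integrable setT (EFin \o f).
Proof.
move=> cf f0; pose B := [set x : 'rV[R]_n | `|x| <= M].
have cB : closed B.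
  rewrite (_ : B = Num.norm @^-1` [set x | x <= M])//.
  by apply: preimage_closed => [x _|]; [exact: norm_continuous|exact: closed_le].
have mB : measurable B.
  by have /open_measurable_rV/measurableC := closed_openC cB; rewrite setCK.
have -> : EFin \o f = (EFin \o f) \_ B.
  apply/funext => x; rewrite patchE; case: ifPn => // /negP xB /=.
  by rewrite f0// ltNge; apply/negP => h; apply: xB; rewrite inE.
apply/(integrable_mkcond _ mB).
apply: measurable_bounded_integrable => //.
- exact: ball_lty.
- by apply: measurable_funTS; exact: continuous_measurable_rV.
- have bB : bounded_set B.
    by exists M; split => [|y My x /le_trans]; [exact: num_real|apply; exact: ltW].
  have /compact_bounded[N [Nr HN]] : compact (f @` B).
    apply: continuous_compact; first exact: continuous_subspaceT.
    exact: bounded_closed_compact.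
  exists N; split => // y Ny x Bx; apply: (HN _ Ny).
  by exists x.
Qed.

Lemma integral_cons n (h : 'rV[R]_n.+1 -> R) M : continuous h ->
  (forall x, M < `|x| -> h x = 0) ->
  (\int[lebesgue_rV R n.+1]_x (h x)%:E =
     \int[lebesgue_rV R n]_v \int[@lebesgue_measure R]_x (h (cons_rV (x, v)))%:E /\
   \int[lebesgue_rV R n.+1]_x (h x)%:E =
     \int[@lebesgue_measure R]_x \int[lebesgue_rV R n]_v (h (cons_rV (x, v)))%:E)%E.
Proof.
move=> ch h0; have ih := integrable_bounded_support ch h0.
have mh : measurable_fun setT (EFin \o h).
  by move/continuous_measurable_rV : ch => /measurable_EFinP.
have mhc : measurable_fun setT ((EFin \o h) \o cons_rV (n := n)).
  by apply: measurableT_comp => //; exact: measurable_cons_rV.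
have ihc : (@lebesgue_measure R \x lebesgue_rV R n)%E.-integrable setT
    ((EFin \o h) \o cons_rV (n := n)).
  apply/integrableP; split => //.
  case/integrableP : ih => _; apply: le_lt_trans.
  rewrite [leRHS](ge0_integral_pushforward (measurable_cons_rV (n := n)))//.
  exact: measurableT_comp.
have E : (\int[lebesgue_rV R n.+1]_x (h x)%:E =
    \int[@lebesgue_measure R \x lebesgue_rV R n]_z ((EFin \o h) \o cons_rV (n := n)) z)%E.
  by rewrite [LHS](integral_pushforward (measurable_cons_rV (n := n)))//.
split; rewrite E.
  by rewrite -integral21_prod_meas1.
by rewrite -integral12_prod_meas1.
Qed.

Lemma cons_rVE0 n xv (k : 'I_1) :
  cons_rV (n := n) xv ord0 (lshift n k : 'I_(1 + n)) = xv.1 :> R.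
Proof. by rewrite [LHS]row_mxEl mxE. Qed.

Lemma cons_rVES n xv (k : 'I_n) :
  cons_rV xv ord0 (rshift 1 k : 'I_(1 + n)) = xv.2 ord0 k :> R.
Proof. by rewrite [LHS]row_mxEr. Qed.

Lemma cons_rV_lineS n x (v : 'rV[R]_n) j (h : R) :
  cons_rV (x, h *: delta_mx ord0 j + v) =
  h *: (delta_mx ord0 (rshift 1 j : 'I_(1 + n)) : 'rV[R]_n.+1) + cons_rV (x, v).
Proof.
apply/rowP => i; rewrite [RHS]mxE [X in _ = X + _]mxE.
have [k ->|k ->] := split_ordP (i : 'I_(1 + n)).
  by rewrite !cons_rVE0 mxE eq_lrshift andbF mulr0 add0r.
by rewrite !cons_rVES !mxE eq_rshift.
Qed.

Lemma cons_rV_line0 n x (v : 'rV[R]_n) (h : R) :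
  cons_rV (h + x, v) =
  h *: (delta_mx ord0 ord0 : 'rV[R]_n.+1) + cons_rV (x, v).
Proof.
apply/rowP => i; rewrite [RHS]mxE [X in _ = X + _]mxE.
have [k ->|k ->] := split_ordP (i : 'I_(1 + n)).
  by rewrite !cons_rVE0 mxE (ord1 k) mulr1.
by rewrite !cons_rVES !mxE andbF mulr0 add0r.
Qed.

Lemma dist_cons_rV n x y (v w : 'rV[R]_n) :
  `|cons_rV (x, v) - cons_rV (y, w)| <= `|x - y| + `|v - w|.
Proof.
rewrite [leLHS]/Num.norm/= mx_normrE; apply/bigmax_leP; split.
  exact: addr_ge0.
move=> [i j] _ /=; rewrite (ord1 i) mxE [X in _ + X]mxE.
have [k ->|k ->] := split_ordP (j : 'I_(1 + n)).
  by rewrite !cons_rVE0 ler_wpDr.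
rewrite !cons_rVES ler_wpDl//.
by have := ler_coord_norm (v - w) k; rewrite mxE [X in _ + X]mxE.
Qed.

Lemma continuous_cons_rV2 n x : continuous (fun v : 'rV[R]_n => cons_rV (x, v)).
Proof.
move=> v A /nbhs_ballP[e /= e0 eA]; apply/nbhs_ballP; exists e => //= w.
rewrite -ball_normE/= => vw; apply: eA; rewrite -ball_normE/=.
by rewrite (le_lt_trans (dist_cons_rV _ _ _ _))// subrr normr0 add0r.
Qed.

Lemma continuous_cons_rV1 n (v : 'rV[R]_n) : continuous (fun x : R => cons_rV (x, v)).
Proof.
move=> x; apply/cvgrPdist_lt => e e0; apply/nbhs_normP; exists e => //= y xy.
by rewrite (le_lt_trans (dist_cons_rV _ _ _ _))// subrr normr0 addr0.
Qed.

Lemma derive_consS n j (F : 'rV[R]_n.+1 -> R) x v :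
  (derivable (fun v => F (cons_rV (x, v))) v (delta_mx ord0 j) <->
   derivable F (cons_rV (x, v)) (delta_mx ord0 (rshift 1 j : 'I_(1 + n)))) /\
  partial j (fun v => F (cons_rV (x, v))) v =
  partial (rshift 1 j : 'I_(1 + n)) F (cons_rV (x, v)).
Proof.
rewrite /partial /derivable /derive.
rewrite (_ : (fun h : R => h^-1 *: (((fun v => F (cons_rV (x, v))) \o shift v)
      (h *: delta_mx ord0 j) - F (cons_rV (x, v)))) =
   (fun h : R => h^-1 *: ((F \o shift (cons_rV (x, v)))
      (h *: delta_mx ord0 (rshift 1 j : 'I_(1 + n))) - F (cons_rV (x, v)))))//.
by apply/funext => h /=; rewrite cons_rV_lineS.
Qed.

Lemma derive_cons0 n (F : 'rV[R]_n.+1 -> R) x v :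
  (derivable (fun x => F (cons_rV (x, v))) x 1 <->
   derivable F (cons_rV (x, v)) (delta_mx ord0 ord0)) /\
  'D_1 (fun x => F (cons_rV (x, v))) x = partial ord0 F (cons_rV (x, v)).
Proof.
rewrite /partial /derivable /derive.
rewrite (_ : (fun h : R => h^-1 *: (((fun x => F (cons_rV (x, v))) \o shift x)
      (h *: 1) - F (cons_rV (x, v)))) =
   (fun h : R => h^-1 *: ((F \o shift (cons_rV (x, v)))
      (h *: delta_mx ord0 ord0) - F (cons_rV (x, v)))))//.
by apply/funext => h /=; rewrite -cons_rV_line0 /GRing.scale/= mulr1.
Qed.

(** Induction on the dimension. When [i] is the first coordinate, Fubini makes
    the integration along it the inner one, and the fundamental theorem of
    calculus gives zero; otherwise the first coordinate is integrated last and
    the slices have one dimension less. *)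
Theorem integral_partial_eq0 n (i : 'I_n) (F : 'rV[R]_n -> R) : C1c i F ->
  (\int[lebesgue_rV R n]_x (partial i F x)%:E = 0)%E.
Proof.
elim: n i F => [[]//|n ih i F [cF dF cdF [M F0]]].
have dF0 := partial_out i F0.
have [E1 E2] := integral_cons cdF dF0.
have [j ij|j ij] := split_ordP (i : 'I_(1 + n)).
- rewrite E1 integral0_eq// => v _.
  have {j ij} i0 : i = ord0 by apply/val_inj; rewrite ij/= (ord1 j).
  rewrite {}i0 in dF cdF dF0 *.
  pose G x := F (cons_rV (x, v)); pose g x := partial ord0 F (cons_rV (x, v)).
  pose N : R := `|M| + 1.
  have MN : M < N by rewrite (le_lt_trans (ler_norm _))// ltrDl.
  have N0 : 0 < N by rewrite ltr_wpDl.
  have out x : N <= `|x| -> M < `|cons_rV (x, v)|.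
    by move=> Nx; rewrite (lt_le_trans MN)// (le_trans Nx)//; have [] := norm_cons_rV x v.
  have cG : continuous G.
    by move=> x; apply: continuous_comp; [exact: continuous_cons_rV1|exact: cF].
  have cg : continuous g.
    by move=> x; apply: continuous_comp; [exact: continuous_cons_rV1|exact: cdF].
  pose I : set (measurableTypeR R) := `[(- N : R), N]%classic.
  transitivity (\int[lebesgue_measure]_(x in I) (g x)%:E)%E.
    rewrite [RHS]integral_mkcond; apply: eq_integral => x _.
    rewrite patchE; case: ifPn => // /negP xN; rewrite /g dF0// out// leNgt.
    apply/negP => xN'; apply: xN; apply/mem_set; rewrite /I/= in_itv/= -ler_norml; exact: ltW.
  rewrite /I (@continuous_FTC2 _ g G).
  + by rewrite /G !F0 ?subee// out// ?normrN gtr0_norm.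
  + by rewrite -subr_gt0 opprK addr_gt0.
  + exact: continuous_subspaceT.
  + split; [move=> x _; apply/(derive_cons0 F x v).1; exact: dF|..].
      exact/cvg_at_right_filter/cG.
    exact/cvg_at_left_filter/cG.
  + by move=> x _; rewrite derive1E (derive_cons0 F x v).2.
- rewrite E2 integral0_eq// => x _.
  rewrite ij in dF cdF dF0 *.
  rewrite (_ : (fun v => (partial _ F (cons_rV (x, v)))%:E) =
      (fun v => (partial j (fun v => F (cons_rV (x, v))) v)%:E)); last first.
    by apply/funext => v; rewrite (derive_consS j F x v).2.
  apply: ih; split.
  + by move=> v; apply: continuous_comp; [exact: continuous_cons_rV2|exact: cF].
  + by move=> v; apply/(derive_consS j F x v).1; exact: dF.
  + rewrite (_ : partial j _ =
      partial (rshift 1 j : 'I_(1 + n)) F \o (fun v => cons_rV (x, v))); last first.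
      by apply/funext => v; rewrite (derive_consS j F x v).2.
    by move=> v; apply: continuous_comp; [exact: continuous_cons_rV2|exact: cdF].
  + by exists M => v Mv; apply: F0; rewrite (lt_le_trans Mv)//; have [] := norm_cons_rV x v.
Qed.

End ibp.

(** * Inequalities for powers and for the Euclidean norm *)

Section powers.
Variables (R : realType) (p : R).
Hypothesis p1 : 1 < p.
Let p0 : 0 < p. Proof. exact: lt_trans p1. Qed.
Let pn0 : p != 0. Proof. by rewrite gt_eqF. Qed.
Implicit Types a b t : R.

Lemma powR_mono a b : 0 <= a -> a <= b -> a `^ p <= b `^ p.
Proof.
move=> a0 ab; apply: ge0_ler_powR => //; rewrite ?nnegrE//; first exact: ltW.
exact: le_trans ab.
Qed.

Lemma powRp1 a : 0 <= a -> a * a `^ (p - 1) = a `^ p.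
Proof. by move=> a0; rewrite mulr_powRB1. Qed.

Lemma powR_conv t a b : 0 <= t <= 1 -> 0 <= a -> 0 <= b ->
  (t * a + (1 - t) * b) `^ p <= t * a `^ p + (1 - t) * b `^ p.
Proof.
move=> /andP[t0 t1] a0 b0.
by apply: (convex_powR (ltW p1) (Itv01 t0 t1)); rewrite inE/= in_itv/= ?a0 ?b0.
Qed.

(** The crude constant [2 `^ p] is enough for approximation arguments. *)
Lemma powRD_le a b : 0 <= a -> 0 <= b ->
  (a + b) `^ p <= 2 `^ p * (a `^ p + b `^ p).
Proof.
move=> a0 b0; wlog ab : a b a0 b0 / a <= b.
  by move=> H; have [/H|/ltW/H] := leP a b; last (rewrite addrC [X in _ * X]addrC); apply.
apply: (@le_trans _ _ ((2 * b) `^ p)).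
  by apply: powR_mono; rewrite ?addr_ge0// mulr_natl mulr2n lerD2r.
by rewrite powRM// ler_wpM2l ?powR_ge0// lerDr powR_ge0.
Qed.

Lemma young_tangent a b : 0 <= a -> 0 <= b ->
  p * (a `^ (p - 1) * b) <= b `^ p + (p - 1) * a `^ p.
Proof.
move=> a0 b0; have q0 : 0 < p - 1 by rewrite subr_gt0.
have := @conjugate_powR R b (a `^ (p - 1)) p (p / (p - 1)) b0 (powR_ge0 _ _) p0.
rewrite divr_gt0// => /(_ isT); rewrite invf_div -{1}[p^-1]mul1r -mulrDl.
rewrite [1 + _]addrC subrK divff// => /(_ erefl).
rewrite -powRrM [(p - 1) * _]mulrC divfK ?gt_eqF// => H.
have -> : b `^ p + (p - 1) * a `^ p = p * (b `^ p / p + a `^ p * ((p - 1) / p)).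
  by field.
by rewrite ler_pM2l// mulrC.
Qed.

Lemma powR_tangent a b : 0 <= a -> 0 <= b ->
  p * (a `^ (p - 1) * (b - a)) <= b `^ p - a `^ p.
Proof.
move=> a0 b0; have := young_tangent a0 b0; have := powRp1 a0.
rewrite [a * _]mulrC !mulrBr => ->; lra.
Qed.

(** Young's inequality with a weight: [b <= d a] bounds the product by the first
    term, [d a <= b] by the second one. *)
Lemma young_delta a b d : 0 <= a -> 0 <= b -> 0 < d ->
  a `^ (p - 1) * b <= d * a `^ p + d `^ (1 - p) * b `^ p.
Proof.
move=> a0 b0 d0; have [ba|ab] := leP b (d * a).
  apply: (@le_trans _ _ (d * a `^ p)).
    by rewrite -powRp1// mulrA [leRHS]mulrC ler_wpM2l ?powR_ge0.
  by rewrite lerDl mulr_ge0// powR_ge0.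
apply: (@le_trans _ _ (d `^ (1 - p) * b `^ p)); last first.
  by rewrite lerDr mulr_ge0 ?powR_ge0// ltW.
rewrite -[1 - p]opprB powRN ler_pdivlMl ?powR_gt0// mulrA -powRM ?(ltW d0)//.
rewrite -powRp1// mulrC ler_wpM2l//.
apply: ge0_ler_powR; rewrite ?nnegrE ?subr_ge0 ?(ltW p1) ?mulr_ge0 ?(ltW d0)//.
exact: ltW.
Qed.

Lemma powR_chebyshev a d : 0 <= a -> 0 < d -> a <= d + d `^ (1 - p) * a `^ p.
Proof.
move=> a0 d0; have := @young_delta 1 a d ler01 a0 d0.
by rewrite !powR1 mul1r mulr1.
Qed.

End powers.

Section euclidean_norm.
Variables (R : realType) (n : nat).
Implicit Types (v w : 'rV[R]_n) (c : R).

Lemma dotrC v w : dotr v w = dotr w v.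
Proof. by apply: eq_bigr => i _; rewrite mulrC. Qed.

Lemma dotrDr u v w : dotr u (v + w) = dotr u v + dotr u w.
Proof. by rewrite -big_split/=; apply: eq_bigr => i _; rewrite mxE mulrDr. Qed.

Lemma dotrZr c v w : dotr v (c *: w) = c * dotr v w.
Proof. by rewrite mulr_sumr; apply: eq_bigr => i _; rewrite mxE mulrCA. Qed.

Lemma dotrBr u v w : dotr u (v - w) = dotr u v - dotr u w.
Proof. by rewrite dotrDr -scaleN1r dotrZr mulN1r. Qed.

Lemma dotrDl u v w : dotr (v + w) u = dotr v u + dotr w u.
Proof. by rewrite dotrC dotrDr !(dotrC u). Qed.

Lemma dotrZl c v w : dotr (c *: v) w = c * dotr v w.
Proof. by rewrite dotrC dotrZr dotrC. Qed.

Lemma dotrNl v w : dotr (- v) w = - dotr v w.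
Proof. by rewrite -scaleN1r dotrZl mulN1r. Qed.

Lemma dotr0 v : dotr v 0 = 0.
Proof. by rewrite -(scale0r (0 : 'rV[R]_n)) dotrZr mul0r. Qed.

Lemma dotrr_ge0 v : 0 <= dotr v v.
Proof. by apply: sumr_ge0 => i _; rewrite -expr2 sqr_ge0. Qed.

Lemma enorm_ge0 v : 0 <= enorm v.
Proof. exact: sqrtr_ge0. Qed.

Lemma enorm_sqr v : enorm v ^+ 2 = dotr v v.
Proof. by rewrite sqr_sqrtr ?dotrr_ge0. Qed.

Lemma enormZ c v : enorm (c *: v) = `|c| * enorm v.
Proof.
by rewrite /enorm dotrZl dotrZr mulrA -expr2 sqrtrM ?sqr_ge0// sqrtr_sqr.
Qed.

Lemma enorm0 : enorm (0 : 'rV[R]_n) = 0.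
Proof. by rewrite /enorm dotr0 sqrtr0. Qed.

Lemma enormN v : enorm (- v) = enorm v.
Proof. by rewrite -scaleN1r enormZ normrN1 mul1r. Qed.

Lemma coord_le_enorm v i : `|v ord0 i| <= enorm v.
Proof.
rewrite -sqrtr_sqr ler_wsqrtr// /dotr (bigD1 i)//= -expr2 lerDl.
by apply: sumr_ge0 => j _; rewrite -expr2 sqr_ge0.
Qed.

(** The projection of [v] on the orthogonal of [w] has nonnegative square. *)
Lemma cauchy_schwarz v w : dotr v w <= enorm v * enorm w.
Proof.
have [w0|w0] := eqVneq (dotr w w) 0.
  suff -> : dotr v w = 0 by rewrite mulr_ge0 ?enorm_ge0.
  rewrite /dotr big1// => i _; have := coord_le_enorm w i.
  by rewrite /enorm w0 sqrtr0 normr_le0 => /eqP ->; rewrite mulr0.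
have wp : 0 < dotr w w by rewrite lt_def w0 dotrr_ge0.
have := dotrr_ge0 (v - (dotr v w / dotr w w) *: w).
rewrite dotrBr dotrZr !(dotrC (v - _)) !dotrBr !dotrZr (dotrC w v).
set s := dotr v w => H; apply: (le_trans (ler_norm _)).
rewrite -sqrtr_sqr /enorm -sqrtrM ?dotrr_ge0// ler_wsqrtr//.
move: H.
have -> : (dotr v v - s / dotr w w * s - s / dotr w w * (s - s / dotr w w * dotr w w)) =
   dotr v v - s ^+ 2 / dotr w w by field.
by rewrite subr_ge0 ler_pdivrMr.
Qed.

Lemma enormD v w : enorm (v + w) <= enorm v + enorm w.
Proof.
rewrite -[leRHS]ger0_norm ?addr_ge0 ?enorm_ge0// -sqrtr_sqr ler_wsqrtr//.
rewrite dotrDl !dotrDr (dotrC w v) sqrrD !enorm_sqr.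
have := cauchy_schwarz v w; lra.
Qed.

Variable p : R.
Hypothesis p1 : 1 < p.

Lemma enorm_conv t v w : 0 <= t <= 1 ->
  enorm (t *: v + (1 - t) *: w) `^ p <=
  t * enorm v `^ p + (1 - t) * enorm w `^ p.
Proof.
move=> /[dup] t01 /andP[t0 t1].
apply: le_trans (powR_conv p1 t01 (enorm_ge0 _) (enorm_ge0 _)).
apply: powR_mono => //; first exact: enorm_ge0.
rewrite (le_trans (enormD _ _))// !enormZ (ger0_norm t0) ger0_norm//.
by rewrite subr_ge0.
Qed.

Lemma norm_conv t (a b : R) : 0 <= t <= 1 ->
  `|t * a + (1 - t) * b| `^ p <= t * `|a| `^ p + (1 - t) * `|b| `^ p.
Proof.
move=> /[dup] t01 /andP[t0 t1].
apply: le_trans (powR_conv p1 t01 (normr_ge0 _) (normr_ge0 _)).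
apply: powR_mono => //.
rewrite (le_trans (ler_normD _ _))// !normrM (ger0_norm t0) [`|1 - t|]ger0_norm//.
by rewrite subr_ge0.
Qed.

Lemma powRp2 (a : R) : 0 <= a -> a `^ (p - 2) * a = a `^ (p - 1).
Proof.
move=> a0; have [->|an0] := eqVneq a 0.
  by rewrite mulr0 powR0// gt_eqF// subr_gt0.
rewrite -{2}(powRr1 a0) -powRD ?an0 ?implybT//; congr (_ `^ _); ring.
Qed.

(** The function [|v|^p] is convex with gradient [p |w|^{p-2} w] at [w]. *)
Lemma enorm_tangent v w :
  enorm w `^ p - enorm v `^ p <= p * (enorm w `^ (p - 2) * dotr w (w - v)).
Proof.
have w0 := enorm_ge0 w; have v0 := enorm_ge0 v.
have p0 : 0 < p by exact: lt_trans p1.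
apply: (@le_trans _ _ (p * (enorm w `^ (p - 1) * (enorm w - enorm v)))).
  by have := powR_tangent p1 w0 v0; rewrite !mulrBr; lra.
rewrite ler_pM2l// -powRp2// -mulrA ler_wpM2l ?powR_ge0//.
by rewrite dotrBr mulrBr -expr2 enorm_sqr lerB// cauchy_schwarz.
Qed.

End euclidean_norm.

(** * Integrals over a set and the p-energies *)

Section real_integrable.
Context d (T : measurableType d) (R : realType) (mu : {measure set T -> \bar R}).
Variables (D : set T) (mD : measurable D).
Implicit Types f g : T -> R.
Local Notation L1 f := (mu.-integrable D (EFin \o f)).

Lemma L1_measurable f : L1 f -> measurable_fun D f.
Proof. by move=> /measurable_int/measurable_EFinP. Qed.

Lemma L1_le f g : measurable_fun D f -> (forall x, D x -> `|f x| <= g x) ->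
  L1 g -> L1 f.
Proof.
move=> mf fg; apply: le_integrable => //; first exact/measurable_EFinP.
by move=> x Dx; rewrite !abse_EFin lee_fin (le_trans (fg _ Dx))// ler_norm.
Qed.

Lemma L1_eq f g : (forall x, D x -> f x = g x) -> L1 f -> L1 g.
Proof.
by move=> fg; apply: eq_integrable => // x /set_mem Dx; rewrite /= fg.
Qed.

Lemma L1D f g : L1 f -> L1 g -> L1 (fun x => f x + g x).
Proof.
move=> lf lg; have := integrableD mD lf lg.
by apply: eq_integrable.
Qed.

Lemma L1Z (c : R) f : L1 f -> L1 (fun x => c * f x).
Proof. by move=> lf; have := integrableZl mD c lf; exact: eq_integrable. Qed.

Lemma L1N f : L1 f -> L1 (fun x => - f x).
Proof. by move=> /(L1Z (-1)); apply: L1_eq => x _; rewrite mulN1r. Qed.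

Lemma L1B f g : L1 f -> L1 g -> L1 (fun x => f x - g x).
Proof. by move=> lf lg; apply: L1D => //; exact: L1N. Qed.

Lemma Rintegral_eq f g : (forall x, D x -> f x = g x) ->
  \int[mu]_(x in D) f x = \int[mu]_(x in D) g x.
Proof. by move=> fg; apply: eq_Rintegral => x /set_mem /fg. Qed.

Lemma ae_eq_Rintegral f g : measurable_fun D f -> measurable_fun D g ->
  {ae mu, forall x, D x -> f x = g x} ->
  \int[mu]_(x in D) f x = \int[mu]_(x in D) g x.
Proof.
move=> mf mg fg; rewrite /Rintegral; congr fine.
apply: ae_eq_integral => //; try exact/measurable_EFinP.
by apply: filterS fg => x /[apply] ->.
Qed.

(** [f] agrees almost everywhere with the minimum of [f] and [g]. *)
Lemma ae_le_Rintegral f g : L1 f -> L1 g ->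
  {ae mu, forall x, D x -> f x <= g x} ->
  \int[mu]_(x in D) f x <= \int[mu]_(x in D) g x.
Proof.
move=> lf lg fg.
have mm : measurable_fun D (fun x => Num.min (f x) (g x)).
  by apply: measurable_minr; exact: L1_measurable.
have lm : L1 (fun x => Num.min (f x) (g x)).
  have lfg := L1D (integrable_norm lf) (integrable_norm lg).
  apply: L1_le lfg => // x _ /=.
  by rewrite minElt; case: ifPn => _; rewrite ?lerDl ?lerDr.
rewrite (@ae_eq_Rintegral f (fun x => Num.min (f x) (g x)))//.
- by apply: le_Rintegral => // x _; rewrite ge_min lexx orbT.
- exact: L1_measurable.
- by apply: filterS fg => x /[apply] fgx; rewrite min_l.
Qed.

End real_integrable.

(** The bound is optimal for [l = a / (a + b)], where [a] and [b] are the roots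
    of [A] and [B]; adding [e / 2] to both keeps them positive. *)
Lemma split_minkowski (R : realType) (p A B C : R) : 1 < p ->
  0 <= A -> 0 <= B -> 0 <= C ->
  (forall l, 0 < l < 1 -> C <= l `^ (1 - p) * A + (1 - l) `^ (1 - p) * B) ->
  C `^ p^-1 <= A `^ p^-1 + B `^ p^-1.
Proof.
move=> p1 A0 B0 C0 H; have p0 : 0 < p by exact: lt_trans p1.
have rootK X : 0 <= X -> (X `^ p^-1) `^ p = X.
  by move=> X0; rewrite -powRrM mulVf ?gt_eqF// powRr1.
apply/ler_addgt0Pr => e e0.
pose a := A `^ p^-1 + e / 2; pose b := B `^ p^-1 + e / 2.
have a0 : 0 < a by rewrite ltr_wpDl ?powR_ge0// divr_gt0.
have b0 : 0 < b by rewrite ltr_wpDl ?powR_ge0// divr_gt0.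
have -> : A `^ p^-1 + B `^ p^-1 + e = a + b by rewrite /a /b; lra.
have s0 : 0 < a + b by exact: addr_gt0.
have up X : 0 <= X -> X <= (X `^ p^-1 + e / 2) `^ p.
  move=> X0; apply: (@le_trans _ _ ((X `^ p^-1) `^ p)); first by rewrite rootK.
  by apply: powR_mono => //; rewrite ?powR_ge0// lerDl divr_ge0// ltW.
have Aa : A <= a `^ p := up _ A0.
have Bb : B <= b `^ p := up _ B0.
clearbody a b.
suff Cab : C <= (a + b) `^ p.
  have sE : a + b = ((a + b) `^ p) `^ p^-1.
    by rewrite -powRrM mulfV ?gt_eqF// powRr1// ltW.
  by rewrite sE; apply: ge0_ler_powR; rewrite ?nnegrE ?invr_ge0 ?powR_ge0 ?(ltW p0).
have l01 : 0 < a / (a + b) < 1.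
  by rewrite divr_gt0//= ltr_pdivrMr// mul1r ltrDl.
have E x : 0 < x -> (x / (a + b)) `^ (1 - p) * x `^ p = x * (a + b) `^ (p - 1).
  move=> x0; rewrite powRM ?invr_ge0 ?(ltW x0) ?(ltW s0)// mulrAC.
  rewrite -powRD ?(gt_eqF x0) ?implybT// subrK powRr1 ?(ltW x0)//.
  by rewrite -powR_inv1 ?(ltW s0)// -powRrM mulN1r opprB.
apply: le_trans (H _ l01) _.
have -> : 1 - a / (a + b) = b / (a + b) by field; rewrite gt_eqF.
rewrite (@le_trans _ _ ((a / (a + b)) `^ (1 - p) * a `^ p + (b / (a + b)) `^ (1 - p) * b `^ p))//.
  by apply: lerD; rewrite ler_wpM2l ?powR_ge0.
by rewrite !E// -mulrDl powRp1// ltW.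
Qed.

Section energies.
Variables (R : realType) (n : nat) (Omega : set 'rV[R]_n) (p : R).
Hypotheses (mO : measurable Omega) (p1 : 1 < p).
Local Notation mu := (lebesgue_rV R n).
Local Notation L1 f := (mu.-integrable Omega (EFin \o f)).
Implicit Types (u v w : sobolev_pair R n) (c t : R).
Let p0 : 0 < p. Proof. exact: lt_trans p1. Qed.

Definition measurable_pair u := measurable_fun Omega u.1 /\
  forall i, measurable_fun Omega (fun x => u.2 x ord0 i).

Definition mass u := \int[mu]_(x in Omega) (`|u.1 x| `^ p).
Definition dir u := \int[mu]_(x in Omega) (enorm (u.2 x) `^ p).

(** Pairs of finite [p]-energy: the second component need not be a gradient of
    the first one. *)
Definition Lp_pair u := [/\ measurable_pair u,
  L1 (fun x => `|u.1 x| `^ p) & L1 (fun x => enorm (u.2 x) `^ p)].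

Lemma measurable_powp (f : 'rV[R]_n -> R) :
  measurable_fun Omega f -> measurable_fun Omega (fun x => f x `^ p).
Proof. by move=> mf; exact: (measurableT_comp (measurable_powR p) mf). Qed.

Lemma measurable_norm_powp (f : 'rV[R]_n -> R) :
  measurable_fun Omega f -> measurable_fun Omega (fun x => `|f x| `^ p).
Proof. by move=> mf; apply: measurable_powp; exact: measurableT_comp. Qed.

Lemma measurable_dotr (f g : 'rV[R]_n -> 'rV[R]_n) :
  (forall i, measurable_fun Omega (fun x => f x ord0 i)) ->
  (forall i, measurable_fun Omega (fun x => g x ord0 i)) ->
  measurable_fun Omega (fun x => dotr (f x) (g x)).
Proof. by move=> mf mg; apply: measurable_sum => i; exact: measurable_funM. Qed.

Lemma measurable_enorm (f : 'rV[R]_n -> 'rV[R]_n) :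
  (forall i, measurable_fun Omega (fun x => f x ord0 i)) ->
  measurable_fun Omega (fun x => enorm (f x)).
Proof.
move=> mf.
have -> : (fun x => enorm (f x)) = (fun x => dotr (f x) (f x) `^ 2^-1).
  by apply/funext => x; rewrite powR12_sqrt// dotrr_ge0.
exact: (measurableT_comp (measurable_powR _) (measurable_dotr mf mf)).
Qed.

Lemma mass_ge0 u : 0 <= mass u.
Proof. by apply: Rintegral_ge0 => x _; exact: powR_ge0. Qed.

Lemma dir_ge0 u : 0 <= dir u.
Proof. by apply: Rintegral_ge0 => x _; exact: powR_ge0. Qed.

Lemma measurable_pairD u v :
  measurable_pair u -> measurable_pair v -> measurable_pair (u + v).
Proof.
move=> [mu1 mu2] [mv1 mv2]; split; first exact: measurable_funD.
move=> i; rewrite (_ : (fun x => _) = (fun x => u.2 x ord0 i + v.2 x ord0 i)).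
  exact: measurable_funD.
by apply/funext => x; rewrite mxE.
Qed.

Lemma measurable_pairZ c u : measurable_pair u -> measurable_pair (c *: u).
Proof.
move=> [mu1 mu2]; split; first exact: measurable_funM.
move=> i; rewrite (_ : (fun x => _) = (fun x => c * u.2 x ord0 i)).
  exact: measurable_funM.
by apply/funext => x; rewrite mxE.
Qed.

Lemma Lp_pairD u v : Lp_pair u -> Lp_pair v -> Lp_pair (u + v).
Proof.
move=> [mu mu1 du] [mv mv1 dv]; have muv := measurable_pairD mu mv.
split; first exact: muv.
- have := L1Z mO (2 `^ p) (L1D mO mu1 mv1); apply: L1_le => //.
    by apply: measurable_norm_powp; case: muv.
  move=> x _; rewrite ger0_norm ?powR_ge0//.
  rewrite (le_trans _ (powRD_le p1 (normr_ge0 _) (normr_ge0 _)))//.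
  by apply: powR_mono => //; exact: ler_normD.
- have := L1Z mO (2 `^ p) (L1D mO du dv); apply: L1_le => //.
    by case: muv => _ muv2; exact: measurable_powp (measurable_enorm muv2).
  move=> x _; rewrite ger0_norm ?powR_ge0//.
  rewrite (le_trans _ (powRD_le p1 (enorm_ge0 _) (enorm_ge0 _)))//.
  by apply: powR_mono => //; [exact: enorm_ge0|exact: enormD].
Qed.

Lemma massE c u x : `|(c *: u).1 x| `^ p = `|c| `^ p * `|u.1 x| `^ p.
Proof. by rewrite -powRM// -normrM. Qed.

Lemma dirE c u x : enorm ((c *: u).2 x) `^ p = `|c| `^ p * enorm (u.2 x) `^ p.
Proof. by rewrite -powRM ?enorm_ge0// -enormZ. Qed.

Lemma Lp_pairZ c u : Lp_pair u -> Lp_pair (c *: u).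
Proof.
move=> [mu mu1 du]; split; first exact: measurable_pairZ.
  by apply: (L1_eq mO _ (L1Z mO (`|c| `^ p) mu1)) => x _; rewrite massE.
by apply: (L1_eq mO _ (L1Z mO (`|c| `^ p) du)) => x _; rewrite dirE.
Qed.

Lemma Lp_pairN u : Lp_pair u -> Lp_pair (- u).
Proof. by rewrite -scaleN1r; exact: Lp_pairZ. Qed.

Lemma Lp_pairB u v : Lp_pair u -> Lp_pair v -> Lp_pair (u - v).
Proof. by move=> ? ?; apply: Lp_pairD => //; exact: Lp_pairN. Qed.

Lemma massZ c u : Lp_pair u -> mass (c *: u) = `|c| `^ p * mass u.
Proof.
move=> [_ lu _]; rewrite -RintegralZl//.
by apply: Rintegral_eq => x _; rewrite massE.
Qed.

Lemma dirZ c u : Lp_pair u -> dir (c *: u) = `|c| `^ p * dir u.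
Proof.
move=> [_ _ lu]; rewrite -RintegralZl//.
by apply: Rintegral_eq => x _; rewrite dirE.
Qed.

Lemma massN u : mass (- u) = mass u.
Proof. by apply: Rintegral_eq => x _; rewrite normrN. Qed.

Lemma dirN u : dir (- u) = dir u.
Proof. by apply: Rintegral_eq => x _; rewrite enormN. Qed.

Lemma mass_conv t u v : Lp_pair u -> Lp_pair v -> 0 <= t <= 1 ->
  mass (t *: u + (1 - t) *: v) <= t * mass u + (1 - t) * mass v.
Proof.
move=> Lu Lv t01; have [_ lu _] := Lu; have [_ lv _] := Lv.
have [_ luv _] := Lp_pairD (Lp_pairZ t Lu) (Lp_pairZ (1 - t) Lv).
rewrite -!RintegralZl// -RintegralD//; try exact: L1Z.
apply: le_Rintegral => //; first by apply: L1D => //; exact: L1Z.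
by move=> x _; exact: norm_conv.
Qed.

Lemma dir_conv t u v : Lp_pair u -> Lp_pair v -> 0 <= t <= 1 ->
  dir (t *: u + (1 - t) *: v) <= t * dir u + (1 - t) * dir v.
Proof.
move=> Lu Lv t01; have [_ _ lu] := Lu; have [_ _ lv] := Lv.
have [_ _ luv] := Lp_pairD (Lp_pairZ t Lu) (Lp_pairZ (1 - t) Lv).
rewrite -!RintegralZl// -RintegralD//; try exact: L1Z.
apply: le_Rintegral => //; first by apply: L1D => //; exact: L1Z.
by move=> x _; exact: enorm_conv.
Qed.

Let splitE l u v : 0 < l < 1 ->
  u + v = l *: (l^-1 *: u) + (1 - l) *: ((1 - l)^-1 *: v).
Proof.
by move=> /andP[l0 l1]; rewrite !scalerA !mulfV ?scale1r// gt_eqF ?subr_gt0.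
Qed.

Let coefE (l X : R) : 0 < l -> l * (`|l^-1| `^ p * X) = l `^ (1 - p) * X.
Proof.
move=> l0; rewrite mulrA gtr0_norm ?invr_gt0//; congr (_ * _).
rewrite -powR_inv1 ?(ltW l0)// -powRrM mulN1r.
by rewrite -{1}(powRr1 (ltW l0)) -powRD// (gt_eqF l0) implybT.
Qed.

Lemma mass_minkowski u v : Lp_pair u -> Lp_pair v ->
  mass (u + v) `^ p^-1 <= mass u `^ p^-1 + mass v `^ p^-1.
Proof.
move=> Lu Lv; apply: split_minkowski; rewrite ?mass_ge0// => l /[dup] l01 /andP[l0 l1].
rewrite (splitE _ _ l01).
have l01' : 0 <= l <= 1 by rewrite (ltW l0) (ltW l1).
apply: le_trans (mass_conv (Lp_pairZ l^-1 Lu) (Lp_pairZ (1 - l)^-1 Lv) l01') _.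
by rewrite !massZ// !coefE ?subr_gt0.
Qed.

Lemma dir_minkowski u v : Lp_pair u -> Lp_pair v ->
  dir (u + v) `^ p^-1 <= dir u `^ p^-1 + dir v `^ p^-1.
Proof.
move=> Lu Lv; apply: split_minkowski; rewrite ?dir_ge0// => l /[dup] l01 /andP[l0 l1].
rewrite (splitE _ _ l01).
have l01' : 0 <= l <= 1 by rewrite (ltW l0) (ltW l1).
apply: le_trans (dir_conv (Lp_pairZ l^-1 Lu) (Lp_pairZ (1 - l)^-1 Lv) l01') _.
by rewrite !dirZ// !coefE ?subr_gt0.
Qed.

Let half01 : 0 <= (2^-1 : R) <= 1.
Proof. by rewrite invr_ge0 ler0n/= invf_le1// ler1n. Qed.

Let half_split u v : u + v = 2^-1 *: (2 *: u) + (1 - 2^-1) *: (2 *: v).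
Proof.
have h : (1 - 2^-1 : R) = 2^-1 by field.
by rewrite h !scalerA mulVf// !scale1r.
Qed.

Let half_coef (A B : R) : 0 <= A -> 0 <= B ->
  2^-1 * (`|2| `^ p * A) + (1 - 2^-1) * (`|2| `^ p * B) <= 2 `^ p * (A + B).
Proof.
move=> A0 B0; rewrite normr_nat.
have : 0 <= 2 `^ p * A by rewrite mulr_ge0 ?powR_ge0.
have : 0 <= 2 `^ p * B by rewrite mulr_ge0 ?powR_ge0.
rewrite mulrDr; lra.
Qed.

Lemma massD_le u v : Lp_pair u -> Lp_pair v ->
  mass (u + v) <= 2 `^ p * (mass u + mass v).
Proof.
move=> Lu Lv; rewrite half_split.
apply: le_trans (mass_conv (Lp_pairZ 2 Lu) (Lp_pairZ 2 Lv) half01) _.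
by rewrite !massZ// half_coef// mass_ge0.
Qed.

Lemma dirD_le u v : Lp_pair u -> Lp_pair v ->
  dir (u + v) <= 2 `^ p * (dir u + dir v).
Proof.
move=> Lu Lv; rewrite half_split.
apply: le_trans (dir_conv (Lp_pairZ 2 Lu) (Lp_pairZ 2 Lv) half01) _.
by rewrite !dirZ// half_coef// dir_ge0.
Qed.

Lemma energyE u : Lp_pair u -> W1p_energy Omega p u = (mass u + dir u)%:E.
Proof.
move=> [_ lu ldu]; rewrite /mass /dir -RintegralD//.
by rewrite /Rintegral fineK//; apply: integrable_fin_num => //; exact: L1D.
Qed.

Lemma energy_lty u : measurable_pair u -> (W1p_energy Omega p u < +oo)%E ->
  Lp_pair u.
Proof.
move=> [mu1 mu2] Eu.
have mm := measurable_norm_powp mu1.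
have md := measurable_powp (measurable_enorm mu2).
have ls : L1 (fun x => `|u.1 x| `^ p + enorm (u.2 x) `^ p).
  apply/integrableP; split; first exact/measurable_EFinP/measurable_funD.
  apply: le_lt_trans Eu; rewrite le_eqVlt; apply/orP; left; apply/eqP.
  apply: eq_integral => x _; rewrite /= ger0_norm//.
  by rewrite addr_ge0 ?powR_ge0.
split => //; apply: L1_le ls => // x _; rewrite ger0_norm ?powR_ge0//.
  by rewrite lerDl powR_ge0.
by rewrite lerDr powR_ge0.
Qed.

End energies.

(** * Smooth functions and test functions *)

Section smooth_functions.
Variables (R : realType) (n : nat).
Implicit Types (f g : 'rV[R]_n -> R) (i : 'I_n).
Local Notation e_ i := (delta_mx ord0 i : 'rV[R]_n).

Lemma smooth_continuous f : smooth f -> continuous f.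
Proof. by move=> /(_ [::])[]. Qed.

Lemma smooth_derivable f i x : smooth f -> derivable f x (e_ i).
Proof. by move=> /(_ [::])[_]. Qed.

Lemma smooth_partial f i : smooth f -> smooth (partial i f).
Proof. by move=> sf l; have := sf (rcons l i); rewrite foldr_rcons. Qed.

(** Smoothness by coinduction: it is enough to put a function in a class of
    continuous, partially derivable functions that is stable under partial
    derivatives. *)
Lemma smooth_class (C : set ('rV[R]_n -> R)) :
  (forall f, C f -> continuous f) ->
  (forall f i x, C f -> derivable f x (e_ i)) ->
  (forall f i, C f -> C (partial i f)) ->
  forall f, C f -> smooth f.
Proof.
move=> Cc Cd Cp f Cf l.
have Cl : C (foldr (@partial R n) f l) by elim: l => //= i l; exact: Cp.
by split; [exact: Cc|move=> i x; exact: Cd].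
Qed.

Lemma partialD f g i x : derivable f x (e_ i) -> derivable g x (e_ i) ->
  partial i (fun x => f x + g x) x = partial i f x + partial i g x.
Proof. move=> df dg; exact: (deriveD df dg). Qed.

Lemma partialM f g i x : derivable f x (e_ i) -> derivable g x (e_ i) ->
  partial i (fun x => f x * g x) x = partial i f x * g x + f x * partial i g x.
Proof.
move=> df dg; rewrite /partial (deriveM df dg)/= addrC.
by rewrite /GRing.scale/= mulrC [X in X + _]mulrC addrC mulrC addrC [X in X + _]mulrC.
Qed.

Lemma smooth_cst (c : R) : smooth (fun _ : 'rV[R]_n => c).
Proof.
apply: (@smooth_class [set f | exists c : R, f = (fun _ => c)]); last by exists c.
- by move=> _ [k ->]; exact: cst_continuous.
- by move=> _ i x [k ->]; exact: derivable_cst.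
- move=> _ i [k ->]; exists 0; apply/funext => x.
  by rewrite /partial (derive_cst k).
Qed.

(** The algebra generated by the smooth functions and one more function. *)
Inductive smooth_alg (r : 'rV[R]_n -> R) : ('rV[R]_n -> R) -> Prop :=
| alg_smooth f : smooth f -> smooth_alg r f
| alg_gen : smooth_alg r r
| alg_add f g : smooth_alg r f -> smooth_alg r g ->
    smooth_alg r (fun x => f x + g x)
| alg_mul f g : smooth_alg r f -> smooth_alg r g ->
    smooth_alg r (fun x => f x * g x).

(** The derivatives of [r] need only be polynomials in [r] and smooth functions:
    the algebra is then stable under partial derivatives. *)
Lemma smooth_alg_smooth r : continuous r ->
  (forall i x, derivable r x (e_ i)) ->
  (forall i, smooth_alg r (partial i r)) ->
  forall f, smooth_alg r f -> smooth f.
Proof.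
move=> cr dr pr; apply: smooth_class.
- move=> f; elim => {f} [f sf||f g _ cf _ cg|f g _ cf _ cg].
  + exact: smooth_continuous sf.
  + exact: cr.
  + by move=> x; exact: (cvgD (cf x) (cg x)).
  + by move=> x; exact: (cvgM (cf x) (cg x)).
- move=> f i x; elim => {f} [f sf||f g _ df _ dg|f g _ df _ dg].
  + exact: smooth_derivable sf.
  + exact: dr.
  + exact: (derivableD df dg).
  + exact: (derivableM df dg).
- move=> f i H.
  have D h : smooth_alg r h -> forall x, derivable h x (e_ i).
    move=> + x; elim => {h} [h sh||f1 g _ df _ dg|f1 g _ df _ dg].
    + exact: smooth_derivable sh.
    + exact: dr.
    + exact: (derivableD df dg).
    + exact: (derivableM df dg).
  elim: H => {f} [f sf||f g Cf pf Cg pg|f g Cf pf Cg pg].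
  + by apply: alg_smooth; exact: smooth_partial.
  + exact: pr.
  + rewrite (_ : partial i _ = (fun x => partial i f x + partial i g x)).
      exact: alg_add.
    by apply/funext => x; exact: (partialD (D _ Cf x) (D _ Cg x)).
  + rewrite (_ : partial i _ =
        (fun x => partial i f x * g x + f x * partial i g x)).
      by apply: alg_add; exact: alg_mul.
    by apply/funext => x; exact: (partialM (D _ Cf x) (D _ Cg x)).
Qed.

Let smooth_alg0 f : smooth_alg (fun => 0) f -> smooth f.
Proof.
have s0 := smooth_cst 0.
apply: smooth_alg_smooth; first exact: smooth_continuous.
  by move=> i x; exact: smooth_derivable.
by move=> i; apply/alg_smooth/smooth_partial.
Qed.

Lemma smoothD f g : smooth f -> smooth g -> smooth (fun x => f x + g x).
Proof. by move=> sf sg; apply/smooth_alg0/alg_add; exact: alg_smooth. Qed.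

Lemma smoothM f g : smooth f -> smooth g -> smooth (fun x => f x * g x).
Proof. by move=> sf sg; apply/smooth_alg0/alg_mul; exact: alg_smooth. Qed.

Lemma gradientD f g : smooth f -> smooth g ->
  gradient (f + g) = gradient f + gradient g.
Proof.
move=> sf sg; apply/funext => x; apply/rowP => i; rewrite !mxE.
by apply: partialD; exact: smooth_derivable.
Qed.

Lemma gradientZ (c : R) f : smooth f -> gradient (c *: f) = c *: gradient f.
Proof.
move=> sf; apply/funext => x; apply/rowP => i; rewrite !mxE.
by rewrite /partial (deriveZ c (smooth_derivable sf)).
Qed.

Section tests.
Variable Omega : set 'rV[R]_n.

Lemma test_out f x : test_function Omega f -> ~ Omega x ->
  \forall y \near x, f y = 0.
Proof.
move=> [_ _ sO] nO; have : ~ closure [set x | f x != 0] x by move=> /sO.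
move=> /existsNP[B] /not_implyP[xB fB]; near=> y.
apply/eqP/negPn/negP => fy; apply: fB; exists y; split => //.
by near: y.
Unshelve. all: by end_near. Qed.

Lemma test_support f g : test_function Omega f -> smooth g ->
  (forall x, f x = 0 -> g x = 0) -> test_function Omega g.
Proof.
move=> [sf cf fO] sg fg.
have fgs : closure [set x | g x != 0] `<=` closure [set x | f x != 0].
  apply: closure_subset => x /= gx; apply: contra_neq gx; exact: fg.
split => //; last exact: subset_trans fO.
apply: subclosed_compact cf fgs; exact: closed_closure.
Qed.

Lemma testD f g : test_function Omega f -> test_function Omega g ->
  test_function Omega (f + g).
Proof.
move=> [sf cf fO] [sg cg gO].
have H : closure [set x | (f + g) x != 0] `<=`
    closure [set x | f x != 0] `|` closure [set x | g x != 0].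
  rewrite -closureU; apply: closure_subset => x /=.
  have [f0|f0 _] := eqVneq (f x) 0; last by left.
  by rewrite [X in X != 0](_ : _ = g x); [right|rewrite -[RHS]add0r -f0].
split; first exact: smoothD.
- apply: subclosed_compact H; first exact: closed_closure.
  exact: compactU.
- by apply: subset_trans H _; rewrite subUset.
Qed.

Lemma testZ (c : R) f : test_function Omega f -> test_function Omega (c *: f).
Proof.
move=> tf; have [sf _ _] := tf; apply: test_support tf _ _ => [|x fx].
  by apply: (smoothM (smooth_cst c)).
by rewrite [LHS](_ : _ = c * f x)// fx mulr0.
Qed.

Lemma test_bounded_support f : test_function Omega f ->
  exists M, forall x, M < `|x| -> f x = 0.
Proof.
move=> [_ /compact_bounded[M [Mr HM]] _]; exists (M + 1) => x Mx.
apply/eqP/negPn/negP => fx; have := HM (M + 1); rewrite ltrDl ltr01 => /(_ isT x).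
have cx : closure [set x | f x != 0] x by exact: subset_closure.
by move=> /(_ cx) /=; rewrite leNgt Mx.
Qed.

End tests.
End smooth_functions.

(** * The space [W^{1,p}_0] as the closure of the test functions *)

Section sobolev_closure.
Variables (R : realType) (n : nat) (Omega : set 'rV[R]_n) (p : R).
Hypotheses (OmegaP : bounded_domain Omega) (p1 : 1 < p).
Local Notation mu := (lebesgue_rV R n).
Local Notation L1 f := (mu.-integrable Omega (EFin \o f)).
Local Notation mass := (mass Omega p).
Local Notation dir := (dir Omega p).
Local Notation Lp_pair := (Lp_pair Omega p).
Local Notation W0 := (W1p0 Omega p).
Implicit Types (u v w : sobolev_pair R n) (f g h : 'rV[R]_n -> R) (c : R).
Let p0 : 0 < p. Proof. exact: lt_trans p1. Qed.

Lemma domain_measurable : measurable Omega.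
Proof. by case: OmegaP => oO _ _ _; exact: open_measurable_rV. Qed.
Let mO := domain_measurable.

Lemma domain_sub_ball : exists M, forall x, Omega x -> `|x| <= M.
Proof.
case: OmegaP => _ _ _ [M [_ HM]]; exists (M + 1) => x Ox.
by apply: HM => //; rewrite ltrDl.
Qed.

Lemma domain_lty : (mu Omega < +oo)%E.
Proof.
have [M HM] := domain_sub_ball.
apply: le_lt_trans (ball_lty n M); apply: le_measure; rewrite ?inE//.
rewrite -[X in measurable X]setTI (_ : [set v | _] = Num.norm @^-1` `]-oo, M]).
  by apply: (continuous_measurable_rV (@norm_continuous _ _)).
by apply/seteqP; split => v /=; rewrite in_itv.
Qed.

Lemma continuous_bounded f : continuous f ->
  exists2 M, 0 < M & forall x, Omega x -> `|f x| <= M.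
Proof.
move=> cf; have [M HM] := domain_sub_ball.
have cB : closed [set x : 'rV[R]_n | `|x| <= M].
  rewrite (_ : mkset _ = Num.norm @^-1` [set x | x <= M])//.
  by apply: preimage_closed => [x _|]; [exact: norm_continuous|exact: closed_le].
have bB : bounded_set [set x : 'rV[R]_n | `|x| <= M].
  by exists M; split => [|y My x /le_trans]; [exact: num_real|apply; exact: ltW].
have /compact_bounded[N [Nr HN]] : compact (f @` [set x : 'rV[R]_n | `|x| <= M]).
  apply: continuous_compact; first exact: continuous_subspaceT.
  exact: bounded_closed_compact.
exists (`|N| + 1); first by rewrite ltr_wpDl.
move=> x Ox; apply: HN; first by rewrite (le_lt_trans (ler_norm _))// ltrDl.
by exists x => //; exact: HM.
Qed.

Lemma bounded_L1 f M : measurable_fun Omega f ->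
  (forall x, Omega x -> `|f x| <= M) -> L1 f.
Proof.
move=> mf fM; apply: measurable_bounded_integrable => //; first exact: domain_lty.
by exists M; split => [|y My x Ox]; [exact: num_real|exact: le_trans (fM _ Ox) (ltW My)].
Qed.

Lemma continuous_L1 f : continuous f -> L1 f.
Proof.
move=> cf; have [M _ fM] := continuous_bounded cf.
apply: bounded_L1 fM; apply: measurable_funTS; exact: continuous_measurable_rV.
Qed.

Lemma cst_L1 c : L1 (fun => c).
Proof. by apply: (@bounded_L1 _ `|c|). Qed.

Lemma L1M f g : L1 f -> continuous g -> L1 (fun x => f x * g x).
Proof.
move=> lf cg; have [M M0 gM] := continuous_bounded cg.
apply: (L1_le mO _ _ (L1Z mO M (integrable_norm lf))) => [|x Ox].
  apply: measurable_funM; first exact: L1_measurable lf.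
  by apply: measurable_funTS; exact: continuous_measurable_rV.
by rewrite normrM mulrC ler_wpM2r// gM.
Qed.

Lemma Lp_pair_L1 u : Lp_pair u ->
  L1 u.1 /\ forall i, L1 (fun x => u.2 x ord0 i).
Proof.
move=> [[mu1 mu2] lu ldu]; split=> [|i].
  apply: (L1_le mO mu1 _ (L1D mO (cst_L1 1) lu)) => x _.
  by have := powR_chebyshev p1 (normr_ge0 (u.1 x)) ltr01; rewrite powR1 mul1r.
apply: (L1_le mO (mu2 i) _ (L1D mO (cst_L1 1) ldu)) => x _.
apply: le_trans (coord_le_enorm _ i) _.
by have := powR_chebyshev p1 (enorm_ge0 (u.2 x)) ltr01; rewrite powR1 mul1r.
Qed.

(** The crude replacement of Hoelder's inequality on a set of finite
    measure: it bounds an integral by the integral of a power. *)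
Lemma Rintegral_chebyshev f d : L1 f -> L1 (fun x => `|f x| `^ p) -> 0 < d ->
  \int[mu]_(x in Omega) `|f x| <=
  d * fine (mu Omega) + d `^ (1 - p) * \int[mu]_(x in Omega) (`|f x| `^ p).
Proof.
move=> lf lfp d0; rewrite -Rintegral_cst// -RintegralZl// -RintegralD//; last 2 first.
- exact: cst_L1.
- exact: L1Z.
apply: le_Rintegral => //; first exact: integrable_norm.
  by apply: L1D => //; [exact: cst_L1|exact: L1Z].
by move=> x _; exact: powR_chebyshev.
Qed.

Lemma test_Lp_pair f : smooth f -> Lp_pair (f, gradient f).
Proof.
move=> sf; have mf := continuous_measurable_rV (smooth_continuous sf).
have mg i : measurable_fun setT (partial i f).
  exact: continuous_measurable_rV (smooth_continuous (smooth_partial i sf)).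
have mG i : measurable_fun Omega (fun x => gradient f x ord0 i).
  rewrite (_ : (fun x => _) = partial i f); first exact: measurable_funTS.
  by apply/funext => x; rewrite mxE.
split.
- by split => //; exact: measurable_funTS.
- have [M M0 fM] := continuous_bounded (smooth_continuous sf).
  apply: (@bounded_L1 _ (M `^ p)).
    by apply: measurable_norm_powp; exact: measurable_funTS.
  move=> x Ox; rewrite ger0_norm ?powR_ge0//.
  by apply: powR_mono => //; exact: fM.
- have /choice[M HM] (i : 'I_n) :
      exists M, forall x, Omega x -> `|partial i f x| <= M.
    have [M _ HM] := continuous_bounded (smooth_continuous (smooth_partial i sf)).
    by exists M.
  apply: (@bounded_L1 _ (Num.sqrt (\sum_i M i ^+ 2) `^ p)).
    exact: measurable_powp (measurable_enorm mG).
  move=> x Ox; rewrite ger0_norm ?powR_ge0//.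
  apply: powR_mono => //; first exact: enorm_ge0.
  rewrite ler_wsqrtr//; apply: ler_sum => i _.
  by rewrite mxE -expr2 -real_normK ?num_real// lerXn2r ?nnegrE ?HM// (le_trans _ (HM i _ Ox)).
Qed.

(** As the derivative vanishes outside the domain, its integral is the one over
    the whole space. *)
Lemma Rintegral_partial_eq0 i f : C1c i f ->
  (forall x, ~ Omega x -> partial i f x = 0) ->
  \int[mu]_(x in Omega) (partial i f x) = 0.
Proof.
move=> /integral_partial_eq0 f0 out; rewrite Rintegral_mkcond /Rintegral.
rewrite (_ : _ \_ _ = partial i f) ?f0//.
apply/funext => x; rewrite patchE; case: ifPn => // /negP nO.
by rewrite out// => Ox; apply: nO; rewrite inE.
Qed.

(** Integration by parts: the product with a test function has bounded support. *)
Lemma test_weak_gradient f : smooth f -> weak_gradient Omega f (gradient f).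
Proof.
move=> sf phi tphi i; have [sphi _ _] := tphi.
have df x := @smooth_derivable _ _ f i x sf.
have dphi x := @smooth_derivable _ _ phi i x sphi.
have cf := smooth_continuous sf; have cphi := smooth_continuous sphi.
have cpf := smooth_continuous (smooth_partial i sf).
have cpphi := smooth_continuous (smooth_partial i sphi).
have sM := smoothM sf sphi.
have E : \int[mu]_(x in Omega) (partial i (fun x => f x * phi x) x) = 0.
  apply: Rintegral_partial_eq0.
    split.
    - exact: smooth_continuous.
    - by move=> x; exact: smooth_derivable.
    - exact/smooth_continuous/smooth_partial.
    - have [M HM] := test_bounded_support tphi.
      by exists M => x Mx; rewrite HM// mulr0.
  move=> x nO; rewrite /partial -(derive_cst (0 : R) x (delta_mx ord0 i)).
  apply: near_eq_derive; have := test_out tphi nO; apply: filterS => y ->.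
  by rewrite mulr0.
apply/eqP; rewrite -addr_eq0 -RintegralD//; last 2 first.
- by apply: L1M => //; exact: continuous_L1.
- rewrite (_ : (fun x => gradient f x ord0 i * phi x) = (fun x => partial i f x * phi x)).
    by apply: L1M => //; exact: continuous_L1.
  by apply/funext => x; rewrite mxE.
apply/eqP; rewrite -[RHS]E; apply: Rintegral_eq => // x _.
by rewrite partialM// mxE addrC.
Qed.

(** Membership in [W^{1,p}_0] without the weak gradient condition, which follows
    from the approximation. *)
Definition approximable u := Lp_pair u /\ forall d, 0 < d ->
  exists2 f, test_function Omega f &
    mass (u - (f, gradient f)) + dir (u - (f, gradient f)) < d.

(** The defect [D] of the integration by parts formula is linear, vanishes on
    smooth functions and is small on pairs of small energy. *)
Lemma approximable_weak_gradient u : approximable u -> weak_gradient Omega u.1 u.2.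
Proof.
move=> [Lu au] phi tphi i; have [sphi _ _] := tphi.
have cphi := smooth_continuous sphi.
have cpphi := smooth_continuous (smooth_partial i sphi).
have [M1 M10 HM1] := continuous_bounded cphi.
have [M2 M20 HM2] := continuous_bounded cpphi.
pose M := M1 + M2.
have M0 : 0 < M by exact: addr_gt0.
have [lu ldu] := Lp_pair_L1 Lu.
pose D v := \int[mu]_(x in Omega) (v.1 x * partial i phi x) +
  \int[mu]_(x in Omega) (v.2 x ord0 i * phi x).
have DB v w : Lp_pair v -> Lp_pair w -> D (v - w) = D v - D w.
  move=> /Lp_pair_L1[lv ldv] /Lp_pair_L1[lw ldw]; rewrite /D.
  rewrite opprD addrACA -!RintegralB//; try exact: L1M.
  congr (_ + _); apply: Rintegral_eq => // x _; first by rewrite mulrBl.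
  by rewrite !mxE mulrBl.
have Dle v d : Lp_pair v -> 0 < d ->
    `|D v| <= M * (2 * (d * fine (mu Omega)) + d `^ (1 - p) * (mass v + dir v)).
  move=> Lv d0; have [lv ldv] := Lp_pair_L1 Lv; have [[mv1 mv2] lvp ldvp] := Lv.
  have H f g K (mf : L1 f) : continuous g -> (forall x, Omega x -> `|g x| <= K) ->
      K <= M ->
      `|\int[mu]_(x in Omega) (f x * g x)| <= M * \int[mu]_(x in Omega) `|f x|.
    move=> cg gK KM; apply: le_trans (le_normr_Rintegral mO (L1M mf cg)) _.
    rewrite -RintegralZl//; last exact: integrable_norm.
    apply: le_Rintegral => //.
    - by apply: integrable_norm; exact: L1M.
    - by apply: L1Z => //; exact: integrable_norm.
    - move=> x Ox; rewrite normrM mulrC ler_wpM2r//.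
      exact: le_trans (gK _ Ox) KM.
  apply: le_trans (ler_normD _ _) _.
  apply: (@le_trans _ _ (M * \int[mu]_(x in Omega) `|v.1 x| +
                         M * \int[mu]_(x in Omega) `|v.2 x ord0 i|)).
    apply: lerD.
      by apply: (H _ _ M2) => //; rewrite lerDr ltW.
    by apply: (H _ _ M1) => //; rewrite lerDl ltW.
  rewrite -mulrDr ler_wpM2l ?(ltW M0)// mulr_natl mulr2n mulrDr addrACA.
  have lvi : L1 (fun x => `|v.2 x ord0 i| `^ p).
    apply: (L1_le mO _ _ ldvp) => [|x _]; first exact: measurable_norm_powp.
    rewrite ger0_norm ?powR_ge0//.
    by apply: powR_mono => //; exact: coord_le_enorm.
  apply: lerD; first exact: Rintegral_chebyshev.
  apply: le_trans (Rintegral_chebyshev (ldv i) lvi d0) _.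
  rewrite lerD2l; apply: ler_wpM2l; first exact: powR_ge0.
  apply: le_Rintegral => // x _.
  by apply: powR_mono => //; exact: coord_le_enorm.
suff Du : D u = 0 by apply/eqP; rewrite -addr_eq0; apply/eqP.
apply/eqP; rewrite -normr_le0; apply/ler_addgt0Pr => e e0; rewrite add0r.
have muO0 : 0 <= fine (mu Omega) by rewrite fine_ge0.
pose d := e / (4 * M * (fine (mu Omega) + 1)).
have d0 : 0 < d by rewrite divr_gt0// !mulr_gt0// ltr_wpDl.
have d'0 : 0 < d `^ (1 - p) by rewrite powR_gt0.
have d''0 : 0 < e / (2 * M * d `^ (1 - p)) by rewrite divr_gt0// !mulr_gt0.
have [f tf Hf] := au _ d''0.
have [sf _ _] := tf; have Lf := test_Lp_pair sf.
have Df : D (f, gradient f) = 0.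
  by rewrite /D/= (test_weak_gradient sf tphi) addNr.
rewrite -[D u]subr0 -Df -DB//.
apply: le_trans (Dle _ _ (Lp_pairB mO p1 Lu Lf) d0) _.
rewrite [leRHS]splitr mulrDr; apply: lerD.
  rewrite /d; set m := fine _ in muO0 *.
  have m10 : 0 < m + 1 by rewrite ltr_wpDl.
  rewrite (_ : M * _ = e / 2 * (m / (m + 1))); last first.
    by field; rewrite !gt_eqF.
  by rewrite ger_pMr ?divr_gt0// ler_pdivrMr// mul1r lerDl.
rewrite mulrA -ler_pdivlMl ?mulr_gt0//.
apply: le_trans (ltW Hf) _; rewrite le_eqVlt; apply/orP; left; apply/eqP.
by field; rewrite !gt_eqF.
Qed.

Lemma W0_approximable u : W0 u <-> approximable u.
Proof.
split=> [[[mu1 mu2 Eu wu] [phi tphi cphi]]|au].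
- have Lu : Lp_pair u by apply: energy_lty => //; split.
  split => // d d0.
  have /cphi[k _ /(_ k (leqnn k)) /=] : nbhs (0%E : \bar R) [set y | (y < d%:E)%E].
    by apply: open_nbhs_nbhs; split; [exact: open_ereal_lt_ereal|rewrite /= lte_fin].
  have [sk _ _] := tphi k.
  rewrite (energyE mO (Lp_pairB mO p1 Lu (test_Lp_pair sk))).
  by rewrite lte_fin => Hk; exists (phi k).
- have wu := approximable_weak_gradient au; have [Lu au'] := au.
  have [[mu1 mu2] _ _] := Lu.
  split; first by split => //; rewrite energyE// ltry.
  have /choice[phi Hphi] (k : nat) : exists f, test_function Omega f /\
      mass (u - (f, gradient f)) + dir (u - (f, gradient f)) < k.+1%:R^-1.
    have k0 : 0 < k.+1%:R^-1 :> R by rewrite invr_gt0.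
    by have [f tf Hf] := au' _ k0; exists f.
  exists phi => [k|]; first by case: (Hphi k).
  rewrite (_ : (fun k => _) = EFin \o (fun k => mass (u - (phi k, gradient (phi k))) +
      dir (u - (phi k, gradient (phi k))))); last first.
    apply/funext => k; have [[sk _ _] _] := Hphi k.
    exact: (energyE mO (Lp_pairB mO p1 Lu (test_Lp_pair sk))).
  apply: cvg_EFin; first exact: nearW.
  apply: (@squeeze_cvgr _ _ _ _ (fun=> 0) (fun k => k.+1%:R^-1)).
  - apply: nearW => k; rewrite addr_ge0 ?mass_ge0 ?dir_ge0//=.
    by have [_ /ltW] := Hphi k.
  - exact: cvg_cst.
  - exact: cvg_harmonic.
Qed.

Lemma W0_Lp u : W0 u -> Lp_pair u.
Proof. by move=> /W0_approximable[]. Qed.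

Lemma W0D u v : W0 u -> W0 v -> W0 (u + v).
Proof.
move=> /W0_approximable[Lu au] /W0_approximable[Lv av]; apply/W0_approximable.
split; first exact: Lp_pairD.
have K0 : 0 < 2 * 2 `^ p :> R by rewrite mulr_gt0// powR_gt0.
move=> d d0; have d20 : 0 < d / (2 * 2 `^ p) by rewrite divr_gt0.
have [f tf Hf] := au _ d20; have [g tg Hg] := av _ d20.
have [sf _ _] := tf; have [sg _ _] := tg.
exists (f + g); first exact: testD.
have Lf := Lp_pairB mO p1 Lu (test_Lp_pair sf).
have Lg := Lp_pairB mO p1 Lv (test_Lp_pair sg).
rewrite (_ : u + v - _ = (u - (f, gradient f)) + (v - (g, gradient g))); last first.
  by rewrite (gradientD sf sg) addrACA -[in RHS]opprD.
have H1 := massD_le mO p1 Lf Lg; have H2 := dirD_le mO p1 Lf Lg.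
apply: (le_lt_trans (lerD H1 H2)); rewrite -mulrDr mulrC -ltr_pdivlMr ?powR_gt0//.
rewrite addrACA (lt_le_trans (ltrD Hf Hg))// le_eqVlt; apply/orP; left; apply/eqP.
by field; rewrite gt_eqF// powR_gt0.
Qed.

Lemma W0Z c u : W0 u -> W0 (c *: u).
Proof.
move=> /W0_approximable[Lu au]; apply/W0_approximable.
split; first exact: Lp_pairZ.
have K0 : 0 < `|c| `^ p + 1 by rewrite ltr_wpDl ?powR_ge0.
move=> d d0; have d20 : 0 < d / (`|c| `^ p + 1) by rewrite divr_gt0.
have [f tf Hf] := au _ d20; have [sf _ _] := tf.
exists (c *: f); first exact: testZ.
have Lf := Lp_pairB mO p1 Lu (test_Lp_pair sf).
rewrite gradientZ// (_ : c *: u - _ = c *: (u - (f, gradient f))); last first.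
  by rewrite scalerBr.
rewrite massZ// dirZ// -mulrDr.
rewrite ltr_pdivlMr// in Hf; apply: le_lt_trans Hf; rewrite mulrC ler_wpM2l ?lerDl//.
by rewrite addr_ge0 ?mass_ge0 ?dir_ge0.
Qed.

Lemma W0N u : W0 u -> W0 (- u).
Proof. by rewrite -scaleN1r; exact: W0Z. Qed.

Lemma W0B u v : W0 u -> W0 v -> W0 (u - v).
Proof. by move=> wu wv; exact: (W0D wu (W0N wv)). Qed.

End sobolev_closure.

(** * Positive parts *)

Section smooth_positive_part.
Variables (R : realType) (e : R).
Hypothesis e0 : 0 < e.
Implicit Types t s : R.

Definition soft_abs t := Num.sqrt ((t - e) ^+ 2 + (e ^+ 2) ^+ 2).

(** A smooth approximation of the positive part that vanishes at [0]; the
    shift by [e] in [soft_abs] makes its derivative at [0] small, so that in the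
    limit the derivative is the indicator of the open half-line. *)
Definition soft_pos t := 2^-1 * (t + soft_abs t - soft_abs 0).
Definition soft_step t := 2^-1 * (1 + (t - e) / soft_abs t).

Let arg_gt0 t : 0 < (t - e) ^+ 2 + (e ^+ 2) ^+ 2.
Proof. by rewrite ltr_wpDl ?sqr_ge0// !exprn_gt0. Qed.

Lemma soft_abs_gt0 t : 0 < soft_abs t.
Proof. by rewrite sqrtr_gt0. Qed.

Lemma soft_abs_sqr t : soft_abs t ^+ 2 = (t - e) ^+ 2 + (e ^+ 2) ^+ 2.
Proof. by rewrite sqr_sqrtr// ltW. Qed.

Lemma soft_abs_ge t : `|t - e| <= soft_abs t.
Proof. by rewrite -sqrtr_sqr ler_wsqrtr// lerDl sqr_ge0. Qed.

Lemma soft_abs_ge_sqr t : e ^+ 2 <= soft_abs t.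
Proof.
by rewrite -[leLHS]ger0_norm ?sqr_ge0// -sqrtr_sqr ler_wsqrtr// lerDr sqr_ge0.
Qed.

Lemma soft_abs_le t : soft_abs t <= `|t - e| + e ^+ 2.
Proof.
rewrite -[leRHS]ger0_norm ?addr_ge0 ?sqr_ge0// -sqrtr_sqr ler_wsqrtr//.
by rewrite [leRHS]sqrrD real_normK ?num_real// lerD2r lerDl mulrn_wge0// mulr_ge0 ?sqr_ge0.
Qed.

Lemma soft_ratio_le1 t : `|(t - e) / soft_abs t| <= 1.
Proof.
rewrite normrM normfV (gtr0_norm (soft_abs_gt0 t)).
by rewrite ler_pdivrMr ?soft_abs_gt0// mul1r soft_abs_ge.
Qed.

Lemma soft_step_itv t : 0 <= soft_step t <= 1.
Proof.
have := soft_ratio_le1 t; rewrite ler_norml => /andP[h1 h2].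
by rewrite /soft_step; apply/andP; split; lra.
Qed.

Lemma soft_abs_lip t s : `|soft_abs t - soft_abs s| <= `|t - s|.
Proof.
have S0 : 0 < soft_abs t + soft_abs s by rewrite addr_gt0 ?soft_abs_gt0.
rewrite -(ler_pM2r S0) -[X in _ * X <= _](gtr0_norm S0) -normrM -subr_sqr.
rewrite !soft_abs_sqr opprD addrACA subrr addr0 subr_sqr normrM.
rewrite (_ : t - e - (s - e) = t - s); last by ring.
rewrite ler_wpM2l// (le_trans (ler_normD _ _))// lerD//; exact: soft_abs_ge.
Qed.

Lemma soft_pos_lip t s : `|soft_pos t - soft_pos s| <= `|t - s|.
Proof.
rewrite /soft_pos -mulrBr normrM ger0_norm ?invr_ge0//.
rewrite (_ : _ - _ = (t - s) + (soft_abs t - soft_abs s)); last by ring.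
have := ler_normD (t - s) (soft_abs t - soft_abs s).
have := soft_abs_lip t s; lra.
Qed.

Lemma soft_pos0 : soft_pos 0 = 0.
Proof. by rewrite /soft_pos add0r subrr mulr0. Qed.

Lemma soft_pos_le t : `|soft_pos t| <= `|t|.
Proof. by have := soft_pos_lip t 0; rewrite soft_pos0 !subr0. Qed.

Lemma soft_step_lip t s : `|soft_step t - soft_step s| <= (e ^+ 2)^-1 * `|t - s|.
Proof.
have qt := soft_abs_gt0 t; have qs := soft_abs_gt0 s.
have e20 : 0 < e ^+ 2 by rewrite exprn_gt0.
have -> : soft_step t - soft_step s = 2^-1 * ((t - s) / soft_abs t +
    (s - e) / soft_abs s * (soft_abs s - soft_abs t) / soft_abs t).
  by rewrite /soft_step; field; rewrite !gt_eqF.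
rewrite normrM ger0_norm ?invr_ge0//.
have H x : `|x| <= `|t - s| -> `|x / soft_abs t| <= (e ^+ 2)^-1 * `|t - s|.
  move=> xts; rewrite normrM normfV (gtr0_norm qt) mulrC.
  by apply: ler_pM => //; [rewrite invr_ge0 ltW|rewrite lef_pV2 ?posrE// soft_abs_ge_sqr].
have H1 := H _ (lexx _).
have H2 : `|(s - e) / soft_abs s * (soft_abs s - soft_abs t) / soft_abs t|
    <= (e ^+ 2)^-1 * `|t - s|.
  apply: H; rewrite normrM -[leRHS]mul1r ler_pM// ?soft_ratio_le1//.
  by rewrite distrC soft_abs_lip.
have := ler_normD ((t - s) / soft_abs t)
  ((s - e) / soft_abs s * (soft_abs s - soft_abs t) / soft_abs t); lra.
Qed.

Lemma soft_pos_approx t : `|soft_pos t - Num.max t 0| <= e + e ^+ 2.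
Proof.
have q1 := soft_abs_ge t; have q2 := soft_abs_le t.
have q3 := soft_abs_ge 0; have q4 := soft_abs_le 0.
move: q3 q4; rewrite sub0r normrN (gtr0_norm e0) => q3 q4.
have n1 := ler_normB t e; have n2 := lerB_normD t (- e).
rewrite normrN (gtr0_norm e0) in n1 n2.
have tm : Num.max t 0 = 2^-1 * (t + `|t|).
  by have [t0|t0] := leP 0 t; rewrite ?(ger0_norm t0) ?(ltr0_norm t0); lra.
rewrite tm /soft_pos ler_norml; apply/andP; split; lra.
Qed.

(** The derivative of [soft_pos] tends to the indicator of the positive
    half-line as [e] tends to [0]. *)
Lemma soft_step_approx t : (0 < t -> e <= t / 2) ->
  `|soft_step t - (0 < t)%R%:R| <= e.
Proof.
move=> et; have q0 := soft_abs_gt0 t; have q1 := soft_abs_ge t.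
have q2 := soft_abs_le t; have e2 : 0 < e ^+ 2 by rewrite exprn_gt0.
have [t0|t0] := ltP 0 t.
  have {}et := et t0; have te : 0 < t - e by lra.
  rewrite (gtr0_norm te) in q1 q2.
  have -> : soft_step t - true%:R = - (2^-1 * ((soft_abs t - (t - e)) / soft_abs t)).
    by rewrite (_ : true%:R = 1 :> R)// /soft_step; field; rewrite gt_eqF.
  rewrite normrN ger0_norm; last first.
    by rewrite mulr_ge0 ?invr_ge0// divr_ge0 ?subr_ge0// ltW.
  rewrite mulrA ler_pdivrMr//.
  apply: (@le_trans _ _ (e * (t - e))); last by rewrite ler_pM2l.
  apply: (@le_trans _ _ (2^-1 * e ^+ 2)); first by rewrite ler_pM2l ?invr_gt0//; lra.
  rewrite expr2 mulrCA ler_pM2l//; lra.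
rewrite (_ : false%:R = 0 :> R)// subr0.
have te : t - e < 0 by rewrite subr_lt0; exact: le_lt_trans e0.
rewrite (ltr0_norm te) in q1 q2.
have -> : soft_step t = 2^-1 * ((soft_abs t - (e - t)) / soft_abs t).
  by rewrite /soft_step; field; rewrite gt_eqF.
rewrite ger0_norm; last first.
  by rewrite mulr_ge0 ?invr_ge0// divr_ge0 ?(ltW q0)// subr_ge0; lra.
rewrite mulrA ler_pdivrMr//.
apply: (@le_trans _ _ (e * e)); last by rewrite ler_pM2l//; lra.
apply: (@le_trans _ _ (2^-1 * e ^+ 2)); first by rewrite ler_pM2l ?invr_gt0//; lra.
by rewrite expr2; rewrite expr2 in e2; lra.
Qed.

Lemma is_derive_soft_abs t : is_derive t 1 soft_abs ((t - e) / soft_abs t).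
Proof.
have d1 : is_derive t 1 (fun t => (t - e) ^+ 2 + (e ^+ 2) ^+ 2) (2 * (t - e)).
  apply: is_derive_eq; rewrite /GRing.scale/=.
  by ring.
have := @is_derive1_comp _ Num.sqrt (fun t => (t - e) ^+ 2 + (e ^+ 2) ^+ 2) t _ _
  (is_derive1_sqrt (arg_gt0 t)) d1.
rewrite (_ : _ * _ = (t - e) / soft_abs t)//.
by rewrite -/(soft_abs t); field; rewrite gt_eqF ?soft_abs_gt0.
Qed.

Lemma is_derive_soft_absV t :
  is_derive t 1 (fun t => (soft_abs t)^-1) (- ((t - e) * (soft_abs t)^-1 ^+ 3)).
Proof.
have qn : soft_abs t != 0 by rewrite gt_eqF ?soft_abs_gt0.
have := is_derive_soft_abs t => ds.
have := @is_deriveV _ soft_abs t _ 1 qn ds.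
rewrite (_ : _ *: _ = - ((t - e) * (soft_abs t)^-1 ^+ 3))//.
by rewrite /GRing.scale/= -exprVn; field.
Qed.

Lemma is_derive_soft_pos t : is_derive t 1 soft_pos (soft_step t).
Proof.
have ds := is_derive_soft_abs t.
have -> : soft_pos = (fun t => 2^-1 *: (t + soft_abs t - soft_abs 0)) by [].
apply: is_derive_eq; rewrite /soft_step /GRing.scale/=.
by ring.
Qed.

Lemma smooth_soft_pos n (f : 'rV[R]_n -> R) : smooth f ->
  smooth (fun x => soft_pos (f x)).
Proof.
move=> sf; pose r x := (soft_abs (f x))^-1.
have dr i x : is_derive x (delta_mx ord0 i) r
    (- ((f x - e) * r x ^+ 3) * partial i f x).
  apply: (@is_derive_comp_dir _ _ (fun t => (soft_abs t)^-1)).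
    exact: is_derive_soft_absV.
  by split => //; exact: smooth_derivable.
have c k : smooth_alg r (fun=> k) by apply/alg_smooth/smooth_cst.
have F : smooth_alg r (fun x => f x + - e).
  by apply: alg_add => //; exact: alg_smooth.
apply: (@smooth_alg_smooth _ _ r).
- move=> x; apply: (continuous_comp (f := f) (g := fun t => (soft_abs t)^-1)).
    exact: smooth_continuous sf x.
  apply: differentiable_continuous; apply/derivable1_diffP.
  by have [] := is_derive_soft_absV (f x).
- by move=> i x; have [] := dr i x.
- move=> i; rewrite (_ : partial i r = (fun x =>
      -1 * ((f x + - e) * (r x * (r x * r x))) * partial i f x)); last first.
    apply/funext => x; rewrite /partial (@derive_val _ _ _ _ _ _ _ (dr i x)).
    by rewrite mulN1r -!expr2 -exprS.
  apply: alg_mul; last by apply/alg_smooth/smooth_partial.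
  apply: alg_mul => //; apply: alg_mul => //.
  by apply: alg_mul; [exact: alg_gen|apply: alg_mul; exact: alg_gen].
- rewrite (_ : (fun x => _) = (fun x => 2^-1 * ((f x +
      ((f x + - e) * (f x + - e) + (e ^+ 2) ^+ 2) * r x) + - soft_abs 0))); last first.
    apply/funext => x; rewrite /soft_pos -expr2 -soft_abs_sqr /r expr2 mulfK//.
    by rewrite gt_eqF ?soft_abs_gt0.
  apply: alg_mul => //; apply: alg_add => //; apply: alg_add.
    exact: alg_smooth.
  apply: alg_mul; last exact: alg_gen.
  by apply: alg_add => //; exact: alg_mul.
Qed.

Lemma gradient_soft_pos n (f : 'rV[R]_n -> R) x : smooth f ->
  gradient (fun x => soft_pos (f x)) x = soft_step (f x) *: gradient f x.
Proof.
move=> sf; apply/rowP => i; rewrite !mxE.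
have df : is_derive x (delta_mx ord0 i) f (partial i f x).
  by split => //; exact: smooth_derivable.
by have [_] := is_derive_comp_dir (is_derive_soft_pos (f x)) df.
Qed.

End smooth_positive_part.

Lemma soft_arith (R : realType) (a l x y i : R) :
  0 <= a -> 0 <= l -> 0 <= x -> 0 <= y ->
  x + a * (y + (i + l * x)) <= (1 + a + a * l) * (x + y) + a * i.
Proof.
move=> a0 l0 x0 y0; have ax := mulr_ge0 a0 x0.
have aly := mulr_ge0 (mulr_ge0 a0 l0) y0; lra.
Qed.

Section positive_part.
Variables (R : realType) (n : nat) (Omega : set 'rV[R]_n) (p : R).
Hypotheses (OmegaP : bounded_domain Omega) (p1 : 1 < p).
Local Notation mu := (lebesgue_rV R n).
Local Notation L1 f := (mu.-integrable Omega (EFin \o f)).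
Local Notation mass := (mass Omega p).
Local Notation dir := (dir Omega p).
Local Notation Lp_pair := (Lp_pair Omega p).
Local Notation W0 := (W1p0 Omega p).
Implicit Types (u v w : sobolev_pair R n) (f g h : 'rV[R]_n -> R) (c : R).
Let p0 : 0 < p. Proof. exact: lt_trans p1. Qed.
Let mO := domain_measurable OmegaP.

(** The approximation [v] is itself approximated by a test function. *)
Lemma W0_closed u : Lp_pair u ->
  (forall d, 0 < d -> exists2 v, W0 v & mass (u - v) + dir (u - v) < d) -> W0 u.
Proof.
move=> Lu H; apply/(W0_approximable OmegaP p1); split => // d d0.
have K0 : 0 < 2 * 2 `^ p :> R by rewrite mulr_gt0// powR_gt0.
have d20 : 0 < d / (2 * 2 `^ p) by rewrite divr_gt0.
have [v /(W0_approximable OmegaP p1)[Lv av] Hv] := H _ d20.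
have [f tf Hf] := av _ d20; exists f => //; have [sf _ _] := tf.
rewrite -(subrKA v).
have L1uv := Lp_pairB mO p1 Lu Lv.
have L1vf := Lp_pairB mO p1 Lv (test_Lp_pair OmegaP p1 sf).
apply: (le_lt_trans (lerD (massD_le mO p1 L1uv L1vf) (dirD_le mO p1 L1uv L1vf))).
rewrite -mulrDr mulrC -ltr_pdivlMr ?powR_gt0// addrACA.
rewrite (lt_le_trans (ltrD Hv Hf))// le_eqVlt; apply/orP; left; apply/eqP.
by field; rewrite gt_eqF// powR_gt0.
Qed.

(** Dominated convergence for cut-off factors [k m]. *)
Lemma Rintegral_vanish (k : nat -> 'rV[R]_n -> R) h :
  (forall m, measurable_fun Omega (k m)) ->
  (forall m x, 0 <= k m x <= 1) -> L1 h -> (forall x, 0 <= h x) ->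
  (forall x, Omega x -> k ^~ x @ \oo --> 0) ->
  \int[mu]_(x in Omega) (k m x * h x) @[m --> \oo] --> 0.
Proof.
move=> mk k01 lh h0 kc; have mh := L1_measurable lh.
pose F m := EFin \o (fun x => k m x * h x).
have mF m : measurable_fun Omega (F m).
  by apply/measurable_EFinP; exact: measurable_funM.
have cF : {ae mu, forall x, Omega x -> F ^~ x @ \oo --> cst 0%E x}.
  apply: aeW => x Ox; apply: cvg_EFin; first exact: nearW.
  rewrite -[X in _ --> X](mul0r (h x)).
  exact: cvgMr_tmp (kc x Ox).
have bF : {ae mu, forall x m, Omega x -> (`|F m x| <= (EFin \o h) x)%E}.
  apply: aeW => x m Ox /=; rewrite lee_fin.
  have /andP[k0 k1] := k01 m x.
  by rewrite ger0_norm ?mulr_ge0// ler_piMl.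
have [_ _] := dominated_convergence mO mF (measurable_cst _) cF lh bF.
by rewrite integral0_eq// => H; exact: (fine_cvg H).
Qed.

Definition pos u : sobolev_pair R n :=
  (fun x => Num.max (u.1 x) 0, fun x => if 0 < u.1 x then u.2 x else 0).

Lemma pos2E u x : (pos u).2 x = (0 < u.1 x)%R%:R *: u.2 x.
Proof. by rewrite /=; case: ifP; rewrite ?scale1r ?scale0r. Qed.

Lemma measurable_ind_pos f : measurable_fun Omega f ->
  measurable_fun Omega (fun x => (0 < f x)%R%:R : R).
Proof.
move=> mf; rewrite (_ : (fun x => _) = (fun x => \1_[set y : R | 0 < y] (f x))); last first.
  by apply/funext => x; rewrite indicE; congr (nat_of_bool _)%:R;
    apply/idP/idP; rewrite inE.
apply: measurableT_comp mf; apply: measurable_indic.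
rewrite (_ : mkset _ = `]0, +oo[%classic)//.
by apply/seteqP; split => y /=; rewrite in_itv/= andbT.
Qed.

Lemma Lp_pair_scale u f g : Lp_pair u ->
  measurable_fun Omega f -> (forall x, `|f x| <= `|u.1 x|) ->
  measurable_fun Omega g -> (forall x, `|g x| <= 1) ->
  Lp_pair (f, fun x => g x *: u.2 x).
Proof.
move=> [[mu1 mu2] lu ldu] mf fu mg g1.
have mG i : measurable_fun Omega (fun x => (g x *: u.2 x) ord0 i).
  rewrite (_ : (fun x => _) = (fun x => g x * u.2 x ord0 i)).
    exact: measurable_funM.
  by apply/funext => x; rewrite mxE.
split; first by split.
- apply: (L1_le mO _ _ lu) => [|x _]; first exact: measurable_norm_powp.
  by rewrite ger0_norm ?powR_ge0//; apply: powR_mono.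
- apply: (L1_le mO _ _ ldu) => [|x _].
    exact: measurable_powp (measurable_enorm mG).
  rewrite ger0_norm ?powR_ge0//; apply: powR_mono => //; first exact: enorm_ge0.
  by rewrite /= enormZ ler_piMl ?enorm_ge0.
Qed.

Lemma pos_Lp u : Lp_pair u -> Lp_pair (pos u).
Proof.
move=> Lu; have [[mu1 mu2] _ _] := Lu.
rewrite (_ : pos u = (fun x => Num.max (u.1 x) 0,
    fun x => ((0 < u.1 x)%R%:R : R) *: u.2 x)); last first.
  by congr pair; apply/funext => x; rewrite -pos2E.
apply: Lp_pair_scale => //.
- exact: measurable_maxr.
- move=> x; have [h|h] := leP (u.1 x) 0; first by rewrite normr0.
  by [].
- exact: measurable_ind_pos.
- by move=> x; case: (0 < u.1 x) => /=; rewrite ?normr1 ?normr0.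
Qed.

Section fixed_scale.
Variable e : R.
Hypothesis e0 : 0 < e.

Definition soft u : sobolev_pair R n :=
  (fun x => soft_pos e (u.1 x), fun x => soft_step e (u.1 x) *: u.2 x).

Lemma measurable_soft_pos : measurable_fun setT (soft_pos e).
Proof.
apply: continuous_measurable_fun => t.
apply: differentiable_continuous; apply/derivable1_diffP.
by have [] := is_derive_soft_pos e0 t.
Qed.

Lemma measurable_soft_step : measurable_fun setT (soft_step e).
Proof.
apply: continuous_measurable_fun => t.
apply/cvgrPdist_lt => d d0; apply/nbhs_normP; exists (e ^+ 2 * d).
  by rewrite /= mulr_gt0// exprn_gt0.
move=> s /= ts; apply: le_lt_trans (soft_step_lip e0 t s) _.
by rewrite -ltr_pdivlMl ?invr_gt0 ?exprn_gt0// invrK.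
Qed.

Let step_norm t : `|soft_step e t| <= 1.
Proof. by have /andP[h0 h1] := soft_step_itv e0 t; rewrite ger0_norm. Qed.

Lemma soft_Lp u : Lp_pair u -> Lp_pair (soft u).
Proof.
move=> Lu; have [[mu1 mu2] _ _] := Lu.
apply: Lp_pair_scale => //.
- exact: measurableT_comp measurable_soft_pos mu1.
- by move=> x; exact: soft_pos_le.
- exact: measurableT_comp measurable_soft_step mu1.
Qed.

(** The chain rule in [W^{1,p}_0]: on the set where the gradient is larger
    than [m], the oscillation of [soft_step] is bounded by [1] and the
    integral is small; elsewhere [soft_step] is Lipschitz. *)
Lemma soft_W0 u : W0 u -> W0 (soft u).
Proof.
move=> Wu; have /(W0_approximable OmegaP p1)[Lu au] := Wu.
have [[mu1 mu2] lu ldu] := Lu.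
apply/(W0_approximable OmegaP p1); split; first exact: soft_Lp.
move=> d d0.
pose A := 2 `^ p : R; have A0 : 0 < A by rewrite powR_gt0.
pose k (m : nat) x : R := (m%:R < enorm (u.2 x))%R%:R.
have mk m : measurable_fun Omega (k m).
  rewrite (_ : k m = (fun x => (0 < enorm (u.2 x) - m%:R)%R%:R)).
    by apply: measurable_ind_pos; apply: measurable_funB => //; exact: measurable_enorm.
  by apply/funext => x; rewrite subr_gt0.
have k01 m x : 0 <= k m x <= 1 by rewrite /k; case: (_ < _); rewrite /= ?lexx ?ler01.
have kc : \int[mu]_(x in Omega) (k m x * enorm (u.2 x) `^ p) @[m --> \oo] --> 0.
  apply: Rintegral_vanish => // [x|x _]; first exact: powR_ge0.
  apply: cvg_near_cst; exists (Num.truncn (enorm (u.2 x))).+1 => // m /= Hm.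
  rewrite /k ltNge (le_trans (ltW (truncnS_gt (enorm (u.2 x)))))//.
  by rewrite ler_nat.
have dA0 : 0 < d / (2 * A) by rewrite divr_gt0// mulr_gt0.
have /cvgrPdist_lt/(_ _ dA0)[m _ /(_ m (leqnn m)) Hm] := kc.
rewrite /= sub0r normrN ger0_norm in Hm; last first.
  by apply: Rintegral_ge0 => x _; rewrite mulr_ge0 ?powR_ge0//; have /andP[] := k01 m x.
pose L := ((e ^+ 2)^-1 * m%:R) `^ p.
pose C := 1 + A + A * L.
have L0 : 0 <= L by rewrite powR_ge0.
have C0 : 0 < C.
  by rewrite /C addrAC ltr_wpDl ?addr_ge0// mulr_ge0// ltW.
have dC0 : 0 < d / (2 * C) by rewrite divr_gt0// mulr_gt0.
have [f tf Hf] := au _ dC0; have [sf _ _] := tf.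
exists (fun x => soft_pos e (f x)).
  apply: test_support tf (smooth_soft_pos e0 sf) _ => x ->.
  exact: soft_pos0.
set v := (f, gradient f) in Hf.
have Lv : Lp_pair v := test_Lp_pair OmegaP p1 sf.
have -> : (fun x => soft_pos e (f x), gradient (fun x => soft_pos e (f x))) = soft v.
  by congr pair; apply/funext => x; rewrite gradient_soft_pos.
have Luv := Lp_pairB mO p1 Lu Lv.
have [_ luv lduv] := Luv.
have [_ ls lds] := Lp_pairB mO p1 (soft_Lp Lu) (soft_Lp Lv).
have Hmass : mass (soft u - soft v) <= mass (u - v).
  apply: (le_Rintegral mO ls luv) => x _; apply: powR_mono => //.
  exact: soft_pos_lip.
have lk : L1 (fun x => k m x * enorm (u.2 x) `^ p).
  apply: (L1_le mO _ _ ldu) => [|x _].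
    by apply: measurable_funM => //; exact: L1_measurable ldu.
  have /andP[h0 h1] := k01 m x.
  by rewrite ger0_norm ?mulr_ge0 ?powR_ge0// ler_piMl ?powR_ge0.
have Hdir : dir (soft u - soft v) <= A * (dir (u - v) +
    (\int[mu]_(x in Omega) (k m x * enorm (u.2 x) `^ p) + L * mass (u - v))).
  have l2 : L1 (fun x => k m x * enorm (u.2 x) `^ p + L * `|(u - v).1 x| `^ p).
    exact: (L1D mO lk (L1Z mO L luv)).
  have l3 := L1D mO lduv l2.
  rewrite -(@RintegralZl _ _ _ mu Omega _ L mO luv).
  rewrite -(RintegralD mO lk (L1Z mO L luv)) -(RintegralD mO lduv l2).
  rewrite -(@RintegralZl _ _ _ mu Omega _ A mO l3).
  apply: (le_Rintegral mO lds (L1Z mO A l3)) => x _.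
  have -> : (soft u - soft v).2 x = soft_step e (v.1 x) *: (u - v).2 x +
      (soft_step e (u.1 x) - soft_step e (v.1 x)) *: u.2 x.
    by rewrite /soft/= scalerBr scalerBl [RHS]addrC subrKA.
  set a := enorm (soft_step e (v.1 x) *: (u - v).2 x).
  set b := enorm ((soft_step e (u.1 x) - soft_step e (v.1 x)) *: u.2 x).
  apply: (@le_trans _ _ ((a + b) `^ p)).
    by apply: powR_mono => //; [exact: enorm_ge0|exact: enormD].
  apply: le_trans (powRD_le p1 (enorm_ge0 _) (enorm_ge0 _)) _.
  rewrite ler_pM2l//; apply: lerD.
    apply: powR_mono => //; first exact: enorm_ge0.
    by rewrite /a enormZ ler_piMl ?enorm_ge0.
  rewrite /b enormZ /k; have [mu2x|mu2x] := ltP m%:R (enorm (u.2 x)).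
    rewrite mul1r; apply: (@le_trans _ _ (enorm (u.2 x) `^ p)); last first.
      by rewrite lerDl mulr_ge0// powR_ge0.
    apply: powR_mono => //; first by rewrite mulr_ge0 ?enorm_ge0.
    rewrite ler_piMl ?enorm_ge0//.
    have /andP[h0 h1] := soft_step_itv e0 (u.1 x).
    have /andP[h2 h3] := soft_step_itv e0 (v.1 x).
    by rewrite ler_norml; apply/andP; split; lra.
  rewrite mul0r add0r -powRM ?mulr_ge0 ?invr_ge0 ?sqr_ge0//.
  apply: powR_mono => //; first by rewrite mulr_ge0 ?enorm_ge0.
  rewrite mulrAC; apply: ler_pM => //; first exact: enorm_ge0.
  exact: soft_step_lip.
apply: le_lt_trans (lerD Hmass Hdir) _.
have m0 := mass_ge0 Omega p (u - v).
have d1 := dir_ge0 Omega p (u - v).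
set I := \int[mu]_(x in Omega) _ in Hm *.
have HI : A * I < d / 2.
  by rewrite -ltr_pdivlMl// (lt_le_trans Hm)// le_eqVlt; apply/orP; left; apply/eqP;
    field; rewrite gt_eqF.
apply: (@le_lt_trans _ _ (C * (mass (u - v) + dir (u - v)) + A * I)).
  exact: soft_arith (ltW A0) L0 m0 d1.
rewrite [d]splitr; apply: ltrD => //.
rewrite -ltr_pdivlMl// (lt_le_trans Hf)// le_eqVlt; apply/orP; left; apply/eqP.
by field; rewrite gt_eqF.
Qed.

End fixed_scale.

(** [pos u] is the limit of [soft e u] as [e] tends to [0]: the functions
    converge uniformly on a set of finite measure, and the gradients differ by a
    bounded factor that vanishes in the limit. By the choice of [soft_pos] the
    limit gradient is zero on the zero set of [u.1]. *)
Lemma pos_W0 u : W0 u -> W0 (pos u).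
Proof.
move=> Wu; have Lu := W0_Lp OmegaP p1 Wu; have [[mu1 mu2] lu ldu] := Lu.
have Lpos := pos_Lp Lu.
apply: W0_closed => // d d0.
pose e (m : nat) : R := m.+1%:R^-1.
have e0 m : 0 < e m by rewrite invr_gt0.
pose k m x := `|soft_step (e m) (u.1 x) - (0 < u.1 x)%R%:R| `^ p.
have ec : e m @[m --> \oo] --> 0 by exact: cvg_harmonic.
have k_norm m x : `|soft_step (e m) (u.1 x) - (0 < u.1 x)%R%:R| <= 1.
  have /andP[h0 h1] := soft_step_itv (e0 m) (u.1 x).
  by case: (0 < u.1 x) => /=; rewrite ler_norml; apply/andP; split; lra.
have mk0 m : measurable_fun Omega (fun x => soft_step (e m) (u.1 x) - (0 < u.1 x)%R%:R).
  apply: measurable_funB; last exact: measurable_ind_pos.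
  exact: measurableT_comp (measurable_soft_step (e0 m)) mu1.
have kc : \int[mu]_(x in Omega) (k m x * enorm (u.2 x) `^ p) @[m --> \oo] --> 0.
  apply: Rintegral_vanish => //.
  - by move=> m; exact: measurable_norm_powp.
  - move=> m x; rewrite powR_ge0/=.
    by have := powR_mono p1 (normr_ge0 _) (k_norm m x); rewrite powR1.
  - by move=> x; exact: powR_ge0.
  - move=> x _; apply/cvgrPdist_lt => c c0.
    have c1 : 0 < Num.min c 1 by rewrite lt_min c0 ltr01.
    have t1 : 0 < (if 0 < u.1 x then u.1 x / 2 else 1).
      by case: ifPn => // t0; rewrite divr_gt0.
    have /cvgrPdist_lt/(_ _ c1) := ec; have /cvgrPdist_lt/(_ _ t1) := ec.
    apply: filterS2 => m; rewrite !sub0r !normrN !(gtr0_norm (e0 m)) => H1.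
    rewrite lt_min => /andP[H2 H3]; rewrite ger0_norm ?powR_ge0//.
    apply: le_lt_trans H2.
    apply: (@le_trans _ _ (e m `^ p)).
      apply: powR_mono => //; apply: soft_step_approx => // t0.
      by rewrite t0 in H1; exact: ltW.
    by apply: ge1r_powR; [rewrite e0 ltW|exact: ltW].
have eec : ((e m + e m ^+ 2) `^ p * fine (mu Omega)) @[m --> \oo] --> 0.
  apply: (@squeeze_cvgr _ _ _ _ (fun=> 0) (fun m => 2 `^ p * fine (mu Omega) * e m)).
  - apply: nearW => m; rewrite mulr_ge0 ?powR_ge0 ?fine_ge0//=.
    rewrite mulrAC ler_wpM2r ?fine_ge0//.
    have em1 : e m <= 1 by rewrite invf_le1 ?ler1n.
    apply: (@le_trans _ _ ((2 * e m) `^ p)).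
      apply: powR_mono => //; first by rewrite addr_ge0 ?sqr_ge0// ltW.
      by rewrite mulr_natl mulr2n lerD2l expr2 ler_piMl// ltW.
    rewrite powRM// ?(ltW (e0 m))// ler_wpM2l ?powR_ge0//.
    by apply: ge1r_powR; [rewrite e0|exact: ltW].
  - exact: cvg_cst.
  - by rewrite -[X in _ --> X](mulr0 (2 `^ p * fine (mu Omega))); exact: cvgMl_tmp.
have d20 : 0 < d / 2 by rewrite divr_gt0.
have /cvgrPdist_lt/(_ _ d20) E2 := kc; have /cvgrPdist_lt/(_ _ d20) E1 := eec.
have [m _ /(_ m (leqnn m))[H1 H2]] := filterI E1 E2.
exists (soft (e m) u); first exact: soft_W0.
have [_ ls lds] := Lp_pairB mO p1 Lpos (soft_Lp (e0 m) Lu).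
move: H1 H2; rewrite /= !sub0r !normrN => H1 H2.
rewrite addrC [d]splitr; apply: ltrD.
- apply: le_lt_trans (le_lt_trans (ler_norm _) H2).
  apply: le_Rintegral => //.
    apply: (L1_le mO _ _ ldu) => [|x _].
      apply: measurable_funM; first exact: measurable_norm_powp.
      exact: measurable_powp (measurable_enorm mu2).
    rewrite ger0_norm ?mulr_ge0 ?powR_ge0// ler_piMl ?powR_ge0//.
    by have := powR_mono p1 (normr_ge0 _) (k_norm m x); rewrite powR1.
  move=> x _; rewrite [(pos u - _).2 x](_ : _ =
      ((0 < u.1 x)%R%:R - soft_step (e m) (u.1 x)) *: u.2 x); last first.
    by rewrite scalerBl -pos2E.
  by rewrite enormZ powRM ?enorm_ge0// /k distrC.
- apply: le_lt_trans (le_lt_trans (ler_norm _) H1).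
  rewrite -Rintegral_cst//; apply: le_Rintegral => //.
    exact: cst_L1.
  move=> x _; apply: powR_mono => //.
  by rewrite distrC; exact: soft_pos_approx.
Qed.

End positive_part.

(** * The Poincare inequality *)

Lemma poincare_arith (R : realType) (A C X Y D k : R) :
  0 <= A -> 0 <= C -> 0 <= X -> 0 <= Y -> (X + Y) * (A * (1 + C * A) + 1) <= k ->
  A * (X + C * (A * (Y + D))) <= A * (C * A) * D + k.
Proof.
move=> A0 C0 X0 Y0 H; have AX := mulr_ge0 A0 X0; have AY := mulr_ge0 A0 Y0.
have CAX := mulr_ge0 (mulr_ge0 C0 A0) AX; lra.
Qed.

Section poincare.
Variables (R : realType) (n : nat) (Omega : set 'rV[R]_n) (p : R).
Hypotheses (OmegaP : bounded_domain Omega) (p1 : 1 < p).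
Local Notation mu := (lebesgue_rV R n).
Local Notation L1 f := (mu.-integrable Omega (EFin \o f)).
Local Notation mass := (mass Omega p).
Local Notation dir := (dir Omega p).
Local Notation W0 := (W1p0 Omega p).
Implicit Types (u v w : sobolev_pair R n) (f : 'rV[R]_n -> R).
Let p0 : 0 < p. Proof. exact: lt_trans p1. Qed.
Let mO := domain_measurable OmegaP.

Section regularized_power.
Variable e : R.
Hypothesis e0 : 0 < e.

Let q (t : R) : R := t ^+ 2 + e ^+ 2.
Let q_gt0 t : 0 < q t. Proof. by rewrite ltr_wpDl ?sqr_ge0// exprn_gt0. Qed.

(** [(t^2 + e^2)^(p/2)], a smooth substitute for [|t|^p], and its derivative. *)
Definition reg_pow (t : R) : R := q t `^ (2^-1 * p).
Definition reg_pow_der (t : R) : R := p * (t * q t `^ (2^-1 * p - 1)).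

Let is_derive_q (t : R) : is_derive t 1 q (2 * t).
Proof.
by apply: is_derive_eq; rewrite /GRing.scale/= addr0 mulr1 mulr_natl.
Qed.

Lemma is_derive_reg_pow (t : R) : is_derive t 1 reg_pow (reg_pow_der t).
Proof.
have := @is_derive1_comp _ (@powR R ^~ (2^-1 * p)) q t _ _
  (is_derive1_powR _ (q_gt0 t)) (is_derive_q t).
rewrite (_ : _ * (2 * t) = reg_pow_der t)//.
by rewrite /reg_pow_der; field.
Qed.

Let continuous_q a : continuous (fun t => q t `^ a).
Proof.
move=> t; apply: differentiable_continuous; apply/derivable1_diffP.
by have [] := @is_derive1_comp _ (@powR R ^~ a) q t _ _
  (is_derive1_powR _ (q_gt0 t)) (is_derive_q t).
Qed.

Lemma continuous_reg_pow_der : continuous reg_pow_der.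
Proof.
move=> t; apply: (cvgMl_tmp (a := p)).
exact: (cvgM (@cvg_id _ _) (@continuous_q (2^-1 * p - 1) t)).
Qed.

Lemma reg_powE t : reg_pow t = (q t `^ 2^-1) `^ p.
Proof. by rewrite -powRrM. Qed.

Let norm_le_root t : `|t| <= q t `^ 2^-1.
Proof.
by rewrite powR12_sqrt ?(ltW (q_gt0 t))// -sqrtr_sqr ler_wsqrtr// lerDl sqr_ge0.
Qed.

Lemma norm_le_reg_pow t : `|t| `^ p <= reg_pow t.
Proof. by rewrite reg_powE; apply: powR_mono. Qed.

Lemma reg_pow0 : reg_pow 0 = e `^ p.
Proof.
by rewrite reg_powE /q expr0n add0r powR12_sqrt ?sqr_ge0// sqrtr_sqr gtr0_norm.
Qed.

Lemma reg_pow_der_le t : `|reg_pow_der t| <= p * (q t `^ 2^-1) `^ (p - 1).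
Proof.
rewrite /reg_pow_der normrM (gtr0_norm p0) ler_pM2l// normrM.
rewrite [`|_ `^ _|]ger0_norm ?powR_ge0//.
apply: (le_trans (ler_wpM2r (powR_ge0 _ _) (norm_le_root t))).
rewrite -powRrM -powRD; last by rewrite (gt_eqF (q_gt0 t)) implybT.
by rewrite le_eqVlt; apply/orP; left; apply/eqP; congr (_ `^ _); field.
Qed.

(** Young's inequality absorbs the factor [|t|^(p-1)] of the derivative term; the
    choice of the weight [(2 K p)^-1] leaves half of [|t|^p]. *)
Lemma reg_pow_young (K D a b t : R) : 0 < K -> `|a| <= K -> `|b| <= D ->
  2^-1 * `|t| `^ p - reg_pow 0 -
    K * p * (2 * K * p)^-1 `^ (1 - p) * D `^ p <=
  reg_pow t - reg_pow 0 + a * (reg_pow_der t * b).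
Proof.
move=> K0 aK bD; have D0 : 0 <= D by exact: le_trans bD.
set d := (2 * K * p)^-1; have d0 : 0 < d by rewrite invr_gt0 !mulr_gt0.
set s := q t `^ 2^-1; have s0 : 0 <= s by exact: powR_ge0.
have H1 : `|a * (reg_pow_der t * b)| <= K * (p * (s `^ (p - 1) * D)).
  rewrite normrM; apply: ler_pM => //.
  by rewrite normrM mulrA; apply: ler_pM => //; exact: reg_pow_der_le.
have H2 := young_delta p1 s0 D0 d0.
have H3 : K * (p * (s `^ (p - 1) * D)) <=
    2^-1 * reg_pow t + K * p * d `^ (1 - p) * D `^ p.
  rewrite mulrA; apply: (le_trans (ler_wpM2l (ltW (mulr_gt0 K0 p0)) H2)).
  rewrite mulrDr !mulrA lerD2r reg_powE -/s ler_wpM2r ?powR_ge0//.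
  by rewrite /d le_eqVlt; apply/orP; left; apply/eqP; field; rewrite !gt_eqF.
have H4 := norm_le_reg_pow t.
move: H1; rewrite ler_norml => /andP[H1 _].
move: H1 H3 H4; clear.
move: (a * _) (K * (p * _)) (_ * D `^ p) (reg_pow t) (`|t| `^ p) (reg_pow 0).
move=> A B C X Y Z; lra.
Qed.

End regularized_power.

Lemma is_derive_coord i (x : 'rV[R]_n) :
  is_derive x (delta_mx ord0 i) (fun y : 'rV[R]_n => y ord0 i) 1.
Proof.
apply/is_derive_line.
rewrite (_ : (fun h : R => _) = (fun h : R => h + x ord0 i)); last first.
  by apply/funext => h; rewrite !mxE !eqxx mulr1.
by apply: is_derive_eq; rewrite addr0.
Qed.

(** The integral of the derivative of [x_i |f|^p] along [x_i] vanishes; this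
    derivative is [|f|^p] plus a term that Young's inequality splits between
    [|f|^p] and [|grad f|^p], since [x_i] is bounded on the domain. The power is
    regularized because [|f|^p] need not be smooth. *)
Lemma poincare_test (i : 'I_n) : exists2 C, 0 <= C &
  forall f, test_function Omega f ->
    mass (f, gradient f) <= C * dir (f, gradient f).
Proof.
have [M HM] := domain_sub_ball OmegaP.
pose K : R := `|M| + 1; have K0 : 0 < K by rewrite ltr_wpDl.
have xK x : Omega x -> `|x ord0 i| <= K.
  move=> Ox; apply: le_trans (ler_coord_norm x i) _.
  by apply: le_trans (HM _ Ox) _; rewrite (le_trans (ler_norm _))// lerDl.
set C := K * p * (2 * K * p)^-1 `^ (1 - p).
have C0 : 0 <= C by rewrite !mulr_ge0 ?powR_ge0 ?(ltW K0)// ltW.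
exists (2 * C); first by rewrite mulr_ge0.
move=> f tf; have [sf _ _] := tf.
have [_ lf ldf] := test_Lp_pair OmegaP p1 sf.
have cf := smooth_continuous sf; have cpf := smooth_continuous (smooth_partial i sf).
set m := mass _ in lf *; set D := dir _ in ldf *.
have muO0 : 0 <= fine (mu Omega) by rewrite fine_ge0.
suff H e : 0 < e -> 2^-1 * m - e `^ p * fine (mu Omega) - C * D <= 0.
  apply/ler_addgt0Pr => k k0.
  pose e := (k / (2 * (fine (mu Omega) + 1))) `^ p^-1.
  have kk : 0 < k / (2 * (fine (mu Omega) + 1)).
    by rewrite divr_gt0// mulr_gt0// ltr_wpDl.
  have e0 : 0 < e by rewrite powR_gt0.
  have He := H _ e0; have ep : e `^ p * fine (mu Omega) <= k / 2.
    rewrite -powRrM mulVf ?gt_eqF// powRr1 ?(ltW kk)//.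
    move: muO0 k0; clear; move: (fine _) => z z0 k0.
    have z1 : 0 < z + 1 by rewrite ltr_wpDl.
    rewrite (_ : _ * z = k / 2 * (z / (z + 1))); last by field; rewrite gt_eqF.
    by rewrite ger_pMr ?divr_gt0// ler_pdivrMr// mul1r lerDl.
  move: He ep; clear; move: (e `^ p * _) => X; rewrite -(mulrA 2 C D).
  move: (C * D) => Y; lra.
move=> e0.
pose F (x : 'rV[R]_n) : R := x ord0 i * (reg_pow e (f x) - reg_pow e 0).
pose F' (x : 'rV[R]_n) : R := reg_pow e (f x) - reg_pow e 0 +
  x ord0 i * (reg_pow_der e (f x) * partial i f x).
have cx : continuous (fun x : 'rV[R]_n => x ord0 i) by exact: coord_continuous.
have dg x : is_derive x (delta_mx ord0 i) (fun x => reg_pow e (f x))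
    (reg_pow_der e (f x) * partial i f x).
  apply: (@is_derive_comp_dir _ _ (reg_pow e)); first exact: is_derive_reg_pow.
  by split => //; exact: smooth_derivable.
have cg : continuous (fun x => reg_pow e (f x) - reg_pow e 0).
  move=> x; have h : reg_pow e (f y) @[y --> x] --> reg_pow e (f x).
    apply: (continuous_comp (f := f) (g := reg_pow e)); first exact: cf.
    apply: differentiable_continuous; apply/derivable1_diffP.
    by have [] := is_derive_reg_pow e0 (f x).
  exact: (cvgB h (cvg_cst _)).
have cF' : continuous F'.
  move=> x; apply: (cvgD (cg x)); apply: (cvgM (cx x)).
  have h : reg_pow_der e (f y) @[y --> x] --> reg_pow_der e (f x).
    apply: (continuous_comp (f := f) (g := reg_pow_der e)); first exact: cf.
    exact: continuous_reg_pow_der.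
  exact: (cvgM h (cpf x)).
have dF x : is_derive x (delta_mx ord0 i) F (F' x).
  have dgc : is_derive x (delta_mx ord0 i) (fun x => reg_pow e (f x) - reg_pow e 0)
      (reg_pow_der e (f x) * partial i f x).
    have := is_deriveB (dg x) (is_derive_cst (reg_pow e 0) x (delta_mx ord0 i)).
    by rewrite subr0.
  have dc := is_derive_coord i x.
  have := is_deriveM dc dgc.
  rewrite [X in is_derive _ _ _ X -> _](_ : _ = F' x)//.
  by rewrite [(_ - _)%:A]mulr1 addrC.
have EF : partial i F = F'.
  by apply/funext => x; rewrite /partial (@derive_val _ _ _ _ _ _ _ (dF x)).
have IF : \int[mu]_(x in Omega) F' x = 0.
  rewrite -EF; apply: Rintegral_partial_eq0.
    split.
    - by move=> x; exact: (cvgM (cx x) (cg x)).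
    - by move=> x; have [] := dF x.
    - by rewrite EF.
    - have [N HN] := test_bounded_support tf.
      by exists N => x Nx; rewrite /F HN// subrr mulr0.
  move=> x nO; rewrite EF /F'; have := test_out tf nO => fx0.
  rewrite (nbhs_singleton fx0) subrr add0r.
  rewrite /partial (near_eq_derive (g := cst 0) _ fx0) (derive_cst (0 : R)).
  by rewrite !mulr0.
have lF' : L1 F' by exact: (continuous_L1 OmegaP).
have l1 := L1Z mO 2^-1 lf; have lc := cst_L1 OmegaP (reg_pow e 0).
have l2 := L1Z mO C ldf.
rewrite -(reg_pow0 e0) -(@Rintegral_cst _ _ _ mu Omega mO) -[X in _ <= X]IF.
rewrite -(@RintegralZl _ _ _ mu Omega _ 2^-1 mO lf).
rewrite -(@RintegralZl _ _ _ mu Omega _ C mO ldf).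
rewrite -(RintegralB mO l1 lc) -(RintegralB mO (L1B mO l1 lc) l2).
apply: (le_Rintegral mO (L1B mO (L1B mO l1 lc) l2) lF') => x Ox.
apply: (reg_pow_young e0) => //; first exact: xK.
by have := coord_le_enorm (gradient f x) i; rewrite mxE.
Qed.

(** By density of the test functions. *)
Lemma poincare (i : 'I_n) : exists2 C, 0 <= C &
  forall u, W0 u -> mass u <= C * dir u.
Proof.
have [C C0 HC] := poincare_test i.
pose A := 2 `^ p : R; have A0 : 0 <= A by exact: powR_ge0.
exists (A * (C * A)); first by rewrite !mulr_ge0.
move=> u /(W0_approximable OmegaP p1)[Lu au].
apply/ler_addgt0Pr => k k0.
pose B := A * (1 + C * A) + 1.
have B0 : 0 < B by rewrite ltr_wpDl// mulr_ge0// addr_ge0// mulr_ge0.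
have [f tf Hf] := au _ (divr_gt0 k0 B0); have [sf _ _] := tf.
have Lf := test_Lp_pair OmegaP p1 sf.
set v := (f, gradient f) in Hf Lf.
have Luv := Lp_pairB mO p1 Lu Lf.
have H1 : mass u <= A * (mass (u - v) + mass v).
  by have := massD_le mO p1 Luv Lf; rewrite subrK.
have H2 : dir v <= A * (dir (u - v) + dir u).
  have E : v = - (u - v) + u by rewrite opprB subrK.
  by have := dirD_le mO p1 (Lp_pairN mO Luv) Lu; rewrite dirN -E.
have H3 := HC f tf.
have m0 := mass_ge0 Omega p (u - v); have d0 := dir_ge0 Omega p (u - v).
apply: (le_trans H1).
apply: (@le_trans _ _ (A * (mass (u - v) + C * (A * (dir (u - v) + dir u))))).
  by rewrite ler_wpM2l// lerD2l (le_trans H3)// ler_wpM2l.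
by apply: poincare_arith => //; rewrite -ler_pdivlMr// ltW.
Qed.

End poincare.

(** * Paths *)

Lemma norm_subr_le (R : realType) (a b d : R) :
  a <= b + d -> b <= a + d -> `|a - b| <= d.
Proof. by move=> h1 h2; rewrite ler_norml; apply/andP; split; lra. Qed.

Lemma radial_split (R : realType) (V : lmodType R) (a b : R) (x y h : V) :
  y = x + h -> b^-1 *: y - a^-1 *: x = b^-1 *: h + (b^-1 - a^-1) *: x.
Proof. by move=> ->; rewrite scalerDr scalerBl addrAC addrC. Qed.

(** The modulus of continuity of [w / N w] along a segment: [a] and [b] are the
    norms at two points of the segment at parameter distance [d']. *)
Lemma radial_bound (R : realType) (a m x y e : R) :
  0 < a -> 0 <= m -> 0 <= x -> 0 <= y -> 0 < e ->
  exists2 d, 0 < d & forall b d', 0 < b -> d' < d -> `|a - b| <= d' * m ->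
    `|b^-1| * (d' * x) + `|b^-1 - a^-1| * y < e.
Proof.
move=> a0 m0 x0 y0 e0; have ia0 : 0 <= a^-1 by rewrite invr_ge0 ltW.
pose K := 2 / a * (x + m / a * y).
have K0 : 0 <= K.
  apply: mulr_ge0; first exact: mulr_ge0.
  by apply: addr_ge0 => //; apply: mulr_ge0 => //; exact: mulr_ge0.
exists (Num.min (a / (2 * (m + 1))) (e / (K + 1))).
  by rewrite lt_min !divr_gt0// ?mulr_gt0// ltr_wpDl.
move=> b d b0; rewrite lt_min => /andP[d1 d2] ab.
have [d0|d0] := leP 0 d; last first.
  have dm : d * m <= 0 by rewrite mulr_le0_ge0// ltW.
  have : `|a - b| <= 0 by exact: le_trans dm.
  rewrite normr_le0 subr_eq0 => /eqP <-; rewrite subrr normr0 mul0r addr0.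
  by apply: le_lt_trans e0; rewrite mulr_ge0_le0// mulr_le0_ge0// ltW.
have b2 : a / 2 <= b.
  have h2 : d * m <= a / 2.
    apply: (@le_trans _ _ (d * (m + 1))); first by rewrite ler_wpM2l// lerDl.
    by rewrite -ler_pdivlMr ?ltr_wpDl// -mulrA -invfM ltW.
  by move: ab; rewrite ler_norml => /andP[_ h]; lra.
have ib : b^-1 <= 2 / a.
  by rewrite -[2 / _]invrK invf_div lef_pV2 ?posrE// divr_gt0.
have db : `|b^-1 - a^-1| <= d * (2 / a * (m / a)).
  have -> : b^-1 - a^-1 = (a - b) * (b^-1 * a^-1) by field; rewrite !gt_eqF.
  have ba0 : 0 <= b^-1 * a^-1 by rewrite mulr_ge0// invr_ge0 ltW.
  rewrite normrM [X in _ * X <= _]ger0_norm//.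
  apply: (@le_trans _ _ (d * m * (2 / a * a^-1))).
    by apply: ler_pM => //; exact: ler_wpM2r.
  by rewrite le_eqVlt; apply/orP; left; apply/eqP; field; rewrite gt_eqF.
rewrite [`|b^-1|]gtr0_norm ?invr_gt0//.
apply: (@le_lt_trans _ _ (d * (K + 1))); last by rewrite -ltr_pdivlMr// ltr_wpDl.
apply: (@le_trans _ _ (d * K)); last by rewrite ler_wpM2l// lerDl.
have -> : d * K = 2 / a * (d * x) + d * (2 / a * (m / a)) * y by rewrite /K; ring.
by apply: lerD; apply: ler_wpM2r => //; exact: mulr_ge0.
Qed.

Section paths.
Variables (R : realType) (n : nat) (Omega : set 'rV[R]_n) (p : R).
Hypotheses (OmegaP : bounded_domain Omega) (p1 : 1 < p).
Local Notation mass := (mass Omega p).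
Local Notation dir := (dir Omega p).
Local Notation Lp_pair := (Lp_pair Omega p).
Local Notation normX := (normX Omega p).
Implicit Types (u v w : sobolev_pair R n) (A B : set (sobolev_pair R n)).
Implicit Types (g : R -> sobolev_pair R n) (r t : R).
Let p0 : 0 < p. Proof. exact: lt_trans p1. Qed.
Let mO := domain_measurable OmegaP.

Definition joined A u v := exists g, path_in Omega p A u v g.

Lemma normX_ge0 u : 0 <= normX u.
Proof. exact: powR_ge0. Qed.

Lemma normXN u : normX (- u) = normX u.
Proof. by rewrite /normX -/(dir _) dirN. Qed.

Lemma normXZ c u : Lp_pair u -> normX (c *: u) = `|c| * normX u.
Proof.
move=> Lu; rewrite /normX -/(dir _) dirZ// powRM ?powR_ge0 ?dir_ge0//.
by rewrite -powRrM mulfV ?gt_eqF// powRr1.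
Qed.

Lemma normXD u v : Lp_pair u -> Lp_pair v -> normX (u + v) <= normX u + normX v.
Proof. exact: dir_minkowski. Qed.

Lemma path_cvgP g t :
  (normX (g r - g t) @[r --> within `[0, 1] (nbhs t)] --> (0 : R)) <->
  forall e, 0 < e -> exists2 d, 0 < d & forall r, r \in `[0, 1] ->
    `|t - r| < d -> normX (g r - g t) < e.
Proof.
split=> [/cvgrPdist_lt H e e0|H].
  have /nbhs_normP[d /= d0 Hd] := H _ e0; exists d => // r r01 tr.
  have := Hd r tr r01.
  by rewrite sub0r normrN ger0_norm// normX_ge0.
apply/cvgrPdist_lt => e e0; have [d d0 Hd] := H _ e0.
apply/nbhs_normP; exists d => // r /= tr r01.
by rewrite sub0r normrN ger0_norm ?normX_ge0//; exact: Hd.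
Qed.

Let itv01 r : (r \in `[0, 1]) = (0 <= r <= 1).
Proof. by rewrite in_itv. Qed.

Lemma joined_sub A B u v : A `<=` B -> joined A u v -> joined B u v.
Proof.
by move=> AB [g [g0 g1 gA gc]]; exists g; split => // t /gA; exact: AB.
Qed.

Lemma path_reverse A u v g : path_in Omega p A u v g ->
  path_in Omega p A v u (fun t => g (1 - t)).
Proof.
move=> [g0 g1 gA gc].
have I t : t \in `[0, 1] -> 1 - t \in `[0, 1].
  by rewrite !itv01 => /andP[a b]; apply/andP; split; lra.
split; [by rewrite subr0|by rewrite subrr|by move=> t /I/gA|move=> t t01].
apply/(path_cvgP (fun t => g (1 - t)) t) => e e0.
have /path_cvgP/(_ _ e0)[d d0 H] := gc _ (I _ t01).
exists d => // r r01 tr; apply: H; first exact: I.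
by rewrite (_ : 1 - t - (1 - r) = r - t) 1?distrC//; ring.
Qed.

Lemma path_opp A B u v g : (forall w, A w -> B (- w)) ->
  path_in Omega p A u v g -> path_in Omega p B (- u) (- v) (fun t => - g t).
Proof.
move=> AB [g0 g1 gA gc]; split; [by rewrite g0|by rewrite g1|by move=> t /gA/AB|move=> t t01].
rewrite (_ : (fun r => _) = (fun r => normX (g r - g t))); first exact: gc.
by apply/funext => r; rewrite -normXN opprD !opprK.
Qed.

Lemma joined_sym A u v : joined A u v -> joined A v u.
Proof. by move=> [g /path_reverse pg]; eexists; exact: pg. Qed.

Lemma joined_opp A B u v : (forall w, A w -> B (- w)) ->
  joined A u v -> joined B (- u) (- v).
Proof. by move=> AB [g /(path_opp AB) pg]; eexists; exact: pg. Qed.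

Lemma joined_trans A v u w : joined A u v -> joined A v w -> joined A u w.
Proof.
move=> [g [g0 g1 gA gc]] [h [h0 h1 hA hc]].
pose k t := if t <= 2^-1 then g (2 * t) else h (2 * t - 1).
have Ig t : t \in `[0, 1] -> t <= 2^-1 -> 2 * t \in `[0, 1].
  by rewrite !itv01 => /andP[a b] c; apply/andP; split; lra.
have Ih t : t \in `[0, 1] -> 2^-1 <= t -> 2 * t - 1 \in `[0, 1].
  by rewrite !itv01 => /andP[a b] c; apply/andP; split; lra.
have kh t : 2^-1 <= t -> k t = h (2 * t - 1).
  rewrite /k le_eqVlt => /predU1P[<-|]; last by rewrite ltNge => /negbTE ->.
  by rewrite lexx mulfV// subrr g1 h0.
have kg t : t <= 2^-1 -> k t = g (2 * t) by rewrite /k => ->.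
exists k; split.
- by rewrite kg ?invr_ge0// mulr0.
- by rewrite kh; [rewrite mulr1 (_ : 2 - 1 = 1)//; ring|rewrite invf_le1// ler1n].
- move=> t t01; have [tl|/ltW tr] := leP t 2^-1.
    by rewrite kg//; apply/gA/Ig.
  by rewrite kh//; apply/hA/Ih.
move=> t t01; apply/path_cvgP => e e0.
(* one-sided moduli of continuity at [t], void on the side where [t] is
   in the interior of the other half *)
have [d1 d10 H1] : exists2 d, 0 < d & forall r, r \in `[0, 1] -> r <= 2^-1 ->
    `|t - r| < d -> normX (k r - k t) < e.
  have [tl|tr] := leP t 2^-1.
    have /path_cvgP/(_ _ e0)[d d0 H] := gc _ (Ig _ t01 tl).
    exists (d / 2); first by rewrite divr_gt0.
    move=> r r01 rl tr; rewrite !kg//; apply: H; first exact: Ig.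
    by rewrite -mulrBr normrM normr_nat mulrC -ltr_pdivlMr.
  exists (t - 2^-1); first by rewrite subr_gt0.
  move=> r r01 rl; rewrite ger0_norm ?subr_ge0 ?(le_trans rl (ltW tr))//.
  by rewrite ltrD2l ltrN2 ltNge rl.
have [d2 d20 H2] : exists2 d, 0 < d & forall r, r \in `[0, 1] -> 2^-1 <= r ->
    `|t - r| < d -> normX (k r - k t) < e.
  have [tr|tl] := leP 2^-1 t.
    have /path_cvgP/(_ _ e0)[d d0 H] := hc _ (Ih _ t01 tr).
    exists (d / 2); first by rewrite divr_gt0.
    move=> r r01 rl tr'; rewrite !kh//; apply: H; first exact: Ih.
    rewrite (_ : 2 * t - 1 - (2 * r - 1) = 2 * (t - r)); last by ring.
    by rewrite normrM normr_nat mulrC -ltr_pdivlMr.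
  exists (2^-1 - t); first by rewrite subr_gt0.
  move=> r r01 rl; rewrite distrC ger0_norm ?subr_ge0 ?(le_trans (ltW tl) rl)//.
  by rewrite ltrD2r ltNge rl.
exists (Num.min d1 d2); first by rewrite lt_min d10.
move=> r r01; rewrite lt_min => /andP[rd1 rd2].
have [rl|/ltW rr] := leP r 2^-1; first exact: H1.
exact: H2.
Qed.

Definition normalize w := (mass w `^ p^-1)^-1 *: w.

Lemma normalize_mass w : Lp_pair w -> 0 < mass w -> mass (normalize w) = 1.
Proof.
move=> Lw m0; rewrite massZ// gtr0_norm ?invr_gt0 ?powR_gt0//.
have mE : mass w = (mass w `^ p^-1) `^ p.
  by rewrite -powRrM mulVf ?gt_eqF// powRr1// ltW.
rewrite {2}mE -powRM ?invr_ge0 ?powR_ge0// mulVf ?powR1//.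
by rewrite gt_eqF// powR_gt0.
Qed.

Lemma normalize_id w : mass w = 1 -> normalize w = w.
Proof. by move=> w1; rewrite /normalize w1 powR1 invr1 scale1r. Qed.

Lemma normalizeZ c w : Lp_pair w -> 0 < c -> normalize (c *: w) = normalize w.
Proof.
move=> Lw c0; rewrite /normalize massZ// powRM ?powR_ge0 ?mass_ge0//.
rewrite -powRrM mulfV ?gt_eqF// powRr1 ?normr_ge0// gtr0_norm// scalerA.
by rewrite invfM mulrAC mulVf ?gt_eqF// mul1r.
Qed.

Lemma normalizeN w : normalize (- w) = - normalize w.
Proof. by rewrite /normalize massN scalerN. Qed.

Definition segment w0 w1 t := (1 - t) *: w0 + t *: w1.

(** The radial projection of a segment that avoids the origin is a path:
    both norms are Lipschitz along the segment, by Minkowski's inequality. *)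
Lemma joined_segment A w0 w1 : Lp_pair w0 -> Lp_pair w1 ->
  (forall t, 0 <= t <= 1 ->
    0 < mass (segment w0 w1 t) /\ A (normalize (segment w0 w1 t))) ->
  joined A (normalize w0) (normalize w1).
Proof.
move=> L0 L1 H; pose w := segment w0 w1.
have Lw t : Lp_pair (w t) by apply: Lp_pairD => //; exact: Lp_pairZ.
have L10 : Lp_pair (w1 - w0) by exact: Lp_pairB.
have wE t : w t = w0 + t *: (w1 - w0).
  by rewrite /w /segment scalerBl scale1r scalerBr -addrA [- _ + _]addrC.
have wB r t : w r = w t + (r - t) *: (w1 - w0).
  by rewrite !wE -addrA -scalerDl [t + _]addrC subrK.
pose N t := mass (w t) `^ p^-1.
pose Nd := mass (w1 - w0) `^ p^-1.
have Nd0 : 0 <= Nd by exact: powR_ge0.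
have N0 t : 0 <= t <= 1 -> 0 < N t.
  by move=> t01; rewrite powR_gt0//; have [] := H _ t01.
have NL r t : N r <= N t + `|r - t| * Nd.
  rewrite /N (wB r t).
  apply: (le_trans (mass_minkowski mO p1 (Lw t) (Lp_pairZ mO (r - t) L10))).
  rewrite massZ// powRM ?powR_ge0 ?mass_ge0//.
  by rewrite -powRrM mulfV ?gt_eqF// powRr1.
exists (fun t => normalize (w t)); split.
- by rewrite /w /segment subr0 scale1r scale0r addr0.
- by rewrite /w /segment subrr scale1r scale0r add0r.
- by move=> t; rewrite itv01 => /H[].
move=> t; rewrite itv01 => t01; apply/path_cvgP => e e0.
have Nt := N0 _ t01.
have x0 := normX_ge0 (w1 - w0); have y0 := normX_ge0 (w t).
have [d d0 Hd] := radial_bound Nt Nd0 x0 y0 e0.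
exists d => // r; rewrite itv01 => r01 rtd.
have NN : `|N t - N r| <= `|t - r| * Nd.
  by apply: norm_subr_le; [exact: NL|rewrite (distrC t); exact: NL].
have -> : normalize (w r) - normalize (w t) =
    (N r)^-1 *: ((r - t) *: (w1 - w0)) + ((N r)^-1 - (N t)^-1) *: w t.
  exact: (radial_split _ _ (wB r t)).
have Ls := Lp_pairZ mO (r - t) L10.
apply: le_lt_trans (normXD (Lp_pairZ mO _ Ls) (Lp_pairZ mO _ (Lw t))) _.
rewrite (normXZ _ Ls) (normXZ _ L10) (normXZ _ (Lw t)) (distrC r t).
exact: (Hd _ _ (N0 _ r01) rtd NN).
Qed.

End paths.

(** * Nonnegative functions are joined to the first eigenfunction *)

Lemma conv_lt (R : realType) (t x y z : R) : 0 <= t <= 1 -> x < z -> y < z ->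
  (1 - t) * x + t * y < z.
Proof.
move=> /andP[t0 t1] xz yz; have [->|tn0] := eqVneq t 0.
  by rewrite subr0 mul1r mul0r addr0.
have tp : 0 < t by rewrite lt_def tn0.
rewrite (_ : z = (1 - t) * z + t * z); last by ring.
by apply: ler_ltD; [apply: ler_wpM2l; [rewrite subr_ge0|exact: ltW]|rewrite ltr_pM2l].
Qed.

(** Room for the chain below: [K] bounds the energy at the vertices and
    [K q^p] bounds it on the edges. *)
Lemma choose_ratio (R : realType) (p k B : R) : 1 < p -> 0 <= k -> k < B ->
  exists K q, [/\ k < K, 1 < q, k * q `^ p <= K & K * q `^ p < B].
Proof.
move=> p1 k0 kB; have p0 : 0 < p by exact: lt_trans p1.
pose d := (B - k) / 2; have d0 : 0 < d by rewrite divr_gt0// subr_gt0.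
pose K := k + d; have K1 : 0 < K + 1 by rewrite ltr_wpDl// addr_ge0// ltW.
pose rho := 1 + d / (2 * (K + 1)).
have r1 : 1 < rho by rewrite ltrDl divr_gt0// mulr_gt0.
have r0 : 0 <= rho by rewrite ltW// (lt_trans _ r1).
have rx x : 0 <= x -> x <= K -> x * rho < x + d.
  move=> x0 xK; rewrite /rho mulrDr mulr1 ltrD2l mulrCA gtr_pMr//.
  by rewrite ltr_pdivrMr ?mulr_gt0//; lra.
exists K, (rho `^ p^-1).
have E : (rho `^ p^-1) `^ p = rho by rewrite -powRrM mulVf ?gt_eqF// powRr1.
rewrite E; split.
- by rewrite /K ltrDl.
- have := gt0_ltr_powR (r := p^-1); rewrite invr_gt0 => /(_ p0 1 rho).
  by rewrite !nnegrE ler01 r0 powR1 => ->.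
- by apply/ltW/rx; rewrite // lerDl ltW.
- have := rx K; rewrite lexx addr_ge0 ?(ltW d0)// => /(_ isT isT).
  by rewrite /K /d; lra.
Qed.

Section eigenfunction_paths.
Variables (R : realType) (n : nat) (Omega : set 'rV[R]_n) (p lam : R).
Variable phi : sobolev_pair R n.
Hypotheses (OmegaP : bounded_domain Omega) (p1 : 1 < p).
Hypothesis phi_eigen : eigenfunction Omega p lam phi.
Local Notation mu := (lebesgue_rV R n).
Hypothesis phi_gt0 : {ae mu, forall x, Omega x -> 0 < phi.1 x}.
Hypothesis phi_mass : mass Omega p phi = 1.
Local Notation L1 f := (mu.-integrable Omega (EFin \o f)).
Local Notation mass := (mass Omega p).
Local Notation dir := (dir Omega p).
Local Notation Lp_pair := (Lp_pair Omega p).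
Local Notation W0 := (W1p0 Omega p).
Local Notation normalize := (normalize Omega p).
Implicit Types (u v w z : sobolev_pair R n) (c s t : R).
Let p0 : 0 < p. Proof. exact: lt_trans p1. Qed.
Let pm1 : 0 < p - 1. Proof. by rewrite subr_gt0. Qed.
Let mO := domain_measurable OmegaP.
Let Wphi : W0 phi. Proof. by case: phi_eigen. Qed.
Let Lphi : Lp_pair phi. Proof. exact: (W0_Lp OmegaP p1 Wphi). Qed.

Definition dir_form u v :=
  \int[mu]_(x in Omega) (enorm (u.2 x) `^ (p - 2) * dotr (u.2 x) (v.2 x)).
Definition mass_form u v :=
  \int[mu]_(x in Omega) (`|u.1 x| `^ (p - 2) * u.1 x * v.1 x).

Lemma dir_form_L1 u v : Lp_pair u -> Lp_pair v ->
  L1 (fun x => enorm (u.2 x) `^ (p - 2) * dotr (u.2 x) (v.2 x)).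
Proof.
move=> [[mu1 mu2] _ ldu] [[mv1 mv2] _ ldv].
apply: (L1_le mO _ _ (L1D mO ldu ldv)) => [|x _].
  apply: measurable_funM; last exact: measurable_dotr.
  exact: (measurableT_comp (measurable_powR _) (measurable_enorm mu2)).
rewrite normrM ger0_norm ?powR_ge0//.
have H := young_delta p1 (enorm_ge0 (u.2 x)) (enorm_ge0 (v.2 x)) ltr01.
rewrite powR1 !mul1r -powRp2 ?enorm_ge0// -mulrA in H.
apply: le_trans H; apply: ler_wpM2l; first exact: powR_ge0.
rewrite ler_norml cauchy_schwarz andbT.
by rewrite lerNl -[X in X * _]enormN -dotrNl cauchy_schwarz.
Qed.

Lemma mass_form_L1 u v : Lp_pair u -> Lp_pair v ->
  L1 (fun x => `|u.1 x| `^ (p - 2) * u.1 x * v.1 x).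
Proof.
move=> [[mu1 mu2] lu _] [[mv1 mv2] lv _].
apply: (L1_le mO _ _ (L1D mO lu lv)) => [|x _].
  apply: measurable_funM => //; apply: measurable_funM => //.
  apply: (measurableT_comp (measurable_powR _)).
  exact: measurableT_comp.
rewrite !normrM [X in X * _ * _]ger0_norm ?powR_ge0//.
have H := young_delta p1 (normr_ge0 (u.1 x)) (normr_ge0 (v.1 x)) ltr01.
by rewrite powR1 !mul1r -powRp2 in H.
Qed.

(** The equation tested with the eigenfunction itself. *)
Lemma dir_phi : dir phi = lam.
Proof.
have [_ _ /(_ _ Wphi)] := phi_eigen.
have -> : \int[mu]_(x in Omega)
    (enorm (phi.2 x) `^ (p - 2) * dotr (phi.2 x) (phi.2 x)) = dir phi.
  apply: Rintegral_eq => x _.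
  by rewrite -enorm_sqr expr2 mulrA powRp2 ?enorm_ge0// mulrC powRp1 ?enorm_ge0.
move=> ->; rewrite -[RHS]mulr1 -[X in _ = _ * X]phi_mass; congr (_ * _).
apply: Rintegral_eq => x _.
by rewrite -mulrA -expr2 -real_normK ?num_real// expr2 mulrA powRp2// mulrC powRp1.
Qed.

Lemma lam_ge0 : 0 <= lam.
Proof. by rewrite -dir_phi dir_ge0. Qed.

Lemma mass_le u v : Lp_pair u -> Lp_pair v ->
  {ae mu, forall x, Omega x -> `|u.1 x| <= `|v.1 x|} -> mass u <= mass v.
Proof.
move=> [_ lu _] [_ lv _] uv; apply: (ae_le_Rintegral mO lu lv).
by apply: filterS uv => x H Ox; apply: powR_mono => //; exact: H.
Qed.

(** The maximum of [u] and [c phi], written as a sum so that it inherits its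
    gradient from [pos]. *)
Definition raise c u := u + pos (c *: phi - u).

Lemma raiseE c u x : (raise c u).1 x = Num.max (u.1 x) (c * phi.1 x).
Proof.
rewrite [LHS](_ : _ = u.1 x + Num.max (c * phi.1 x - u.1 x) 0)//.
have [h|h] := leP (u.1 x) (c * phi.1 x).
  by rewrite max_l ?subr_ge0// addrC subrK.
by rewrite max_r ?addr0// subr_le0 ltW.
Qed.

Lemma raise_W0 c u : W0 u -> W0 (raise c u).
Proof.
move=> Wu; apply: (W0D OmegaP p1 Wu); apply: (pos_W0 OmegaP p1).
exact: (W0B OmegaP p1 (W0Z OmegaP p1 c Wphi) Wu).
Qed.

(** Raising only changes [u] where [u < c phi]; there the convexity of
    [|v|^p] compares the gradients, and the result is the weak form of the
    equation for [phi] tested with the positive part of [c phi - u]. *)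
Lemma dir_raise c u : 0 < c -> W0 u ->
  dir (raise c u) - dir u <=
  p * (c `^ (p - 1) * (lam * mass_form phi (pos (c *: phi - u)))).
Proof.
move=> c0 Wu; have Lu := W0_Lp OmegaP p1 Wu.
have Wz : W0 (pos (c *: phi - u)).
  apply: (pos_W0 OmegaP p1).
  exact: (W0B OmegaP p1 (W0Z OmegaP p1 c Wphi) Wu).
have Lz := W0_Lp OmegaP p1 Wz.
have Lr := W0_Lp OmegaP p1 (raise_W0 c Wu).
set z := pos _ in Wz Lz *.
have [_ _ /(_ _ Wz)] := phi_eigen; rewrite -/(dir_form phi z) -/(mass_form phi z) => <-.
have lf := dir_form_L1 Lphi Lz.
have [_ _ ldu] := Lu; have [_ _ ldr] := Lr.
rewrite -(RintegralB mO ldr ldu) mulrA -(@RintegralZl _ _ _ mu Omega _ _ mO lf).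
apply: (le_Rintegral mO (L1B mO ldr ldu) (L1Z mO _ lf)) => x _.
have -> : p * c `^ (p - 1) * (enorm (phi.2 x) `^ (p - 2) * dotr (phi.2 x) (z.2 x)) =
    p * (enorm (c *: phi.2 x) `^ (p - 2) * dotr (c *: phi.2 x) (z.2 x)).
  rewrite enormZ (gtr0_norm c0) powRM ?enorm_ge0 ?(ltW c0)// dotrZl.
  by rewrite -(powRp2 p1 (ltW c0)); ring.
rewrite [(raise c u).2 x](_ : _ = u.2 x + z.2 x)// /z pos2E.
case: (0 < _) => /=.
  rewrite scale1r (_ : (c *: phi.2 - u.2) x = c *: phi.2 x - u.2 x)//.
  by rewrite [u.2 x + _]addrC subrK; exact: enorm_tangent.
by rewrite scale0r addr0 subrr dotr0 !mulr0.
Qed.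

Definition nonneg u := {ae mu, forall x, Omega x -> 0 <= u.1 x}.
Definition above c u := {ae mu, forall x, Omega x -> c * phi.1 x <= u.1 x}.

Lemma above_nonneg c u : 0 <= c -> above c u -> nonneg u.
Proof.
move=> c0; apply: filterS2 phi_gt0 => x px cu Ox.
by apply: le_trans (cu Ox); rewrite mulr_ge0// ltW// px.
Qed.

Lemma raise_above c u : above c (raise c u).
Proof. by apply: aeW => x _; rewrite raiseE le_max lexx orbT. Qed.

Lemma raise_ge c u x : u.1 x <= (raise c u).1 x.
Proof. by rewrite raiseE le_max lexx. Qed.

Lemma mass_phiZ c : 0 < c -> mass (c *: phi) = c `^ p.
Proof. by move=> c0; rewrite massZ// phi_mass mulr1 gtr0_norm. Qed.

Lemma mass_above c u : 0 < c -> W0 u -> above c u -> c `^ p <= mass u.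
Proof.
move=> c0 /(W0_Lp OmegaP p1) Lu cu.
rewrite -(mass_phiZ c0); apply: (mass_le (Lp_pairZ mO c Lphi) Lu).
have := phi_gt0; apply: filterS2 cu => x cu px Ox.
have cp : 0 <= c * phi.1 x by rewrite mulr_ge0// ltW// px.
rewrite [(c *: phi).1 x](_ : _ = c * phi.1 x)// !ger0_norm ?cu//.
exact: le_trans (cu Ox).
Qed.

Lemma mass_raise_ge c u : W0 u -> nonneg u -> mass u <= mass (raise c u).
Proof.
move=> Wu u0; have Lu := W0_Lp OmegaP p1 Wu.
have Lr := W0_Lp OmegaP p1 (raise_W0 c Wu).
apply: (mass_le Lu Lr); apply: filterS u0 => x u0 Ox.
have ur := raise_ge c u x.
by rewrite !ger0_norm ?u0// (le_trans _ ur)// u0.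
Qed.

Lemma mass_raise_le c u : 0 < c -> W0 u -> nonneg u ->
  mass (raise c u) <= mass u + c `^ p.
Proof.
move=> c0 Wu u0; have Lu := W0_Lp OmegaP p1 Wu.
have Lr := W0_Lp OmegaP p1 (raise_W0 c Wu).
rewrite -(mass_phiZ c0).
have [_ lu _] := Lu; have [_ lr _] := Lr; have [_ lc _] := Lp_pairZ mO c Lphi.
rewrite -(RintegralD mO lu lc); apply: (ae_le_Rintegral mO lr (L1D mO lu lc)).
apply: aeW => x _; rewrite raiseE.
rewrite [(c *: phi).1 x](_ : _ = c * phi.1 x)//.
by have [_|_] := leP (u.1 x) (c * phi.1 x); rewrite ?lerDl ?lerDr powR_ge0.
Qed.

(** The first bound controls the mass on one edge of the chain, the second one
    telescopes along the chain. *)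
Lemma mass_raise_step q s u : 1 < q -> 0 < s -> W0 u -> above s u ->
  mass (raise (q * s) u) <= q `^ p * mass u /\
  mass (raise (q * s) u) <= mass u + (q * s) `^ p - s `^ p.
Proof.
move=> q1 s0 Wu su; have Lu := W0_Lp OmegaP p1 Wu.
have q0 : 0 < q by exact: lt_trans q1.
have Lr := W0_Lp OmegaP p1 (raise_W0 (q * s) Wu).
have u0 := above_nonneg (ltW s0) su.
split.
  have -> : q `^ p * mass u = mass (q *: u) by rewrite massZ// gtr0_norm.
  apply: (mass_le Lr (Lp_pairZ mO q Lu)).
  have := phi_gt0; move: u0; apply: filterS3 su => x su u0 px Ox.
  have pp : 0 <= s * phi.1 x by rewrite mulr_ge0 ?(ltW s0)// ltW// px.
  rewrite [(q *: u).1 x](_ : _ = q * u.1 x)// !ger0_norm.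
  - rewrite raiseE ge_max -mulrA ler_pM2l// su// andbT.
    by rewrite ler_peMl ?u0// ltW.
  - by rewrite mulr_ge0 ?u0// ltW.
  - by apply: le_trans (raise_ge _ _ _); exact: u0.
have [_ lu _] := Lu; have [_ lr _] := Lr.
have [_ lq _] := Lp_pairZ mO (q * s) Lphi; have [_ ls _] := Lp_pairZ mO s Lphi.
rewrite -(mass_phiZ (mulr_gt0 q0 s0)) -(mass_phiZ s0).
rewrite -(RintegralD mO lu lq) -(RintegralB mO (L1D mO lu lq) ls).
apply: (ae_le_Rintegral mO lr (L1B mO (L1D mO lu lq) ls)).
have := phi_gt0; apply: filterS2 su => x su px Ox.
have pp : 0 <= s * phi.1 x by rewrite mulr_ge0 ?(ltW s0)// ltW// px.
rewrite raiseE [(s *: phi).1 x](_ : _ = s * phi.1 x)//.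
rewrite [((q * s) *: phi).1 x](_ : _ = q * s * phi.1 x)//.
have [_|_] := leP (u.1 x) (q * s * phi.1 x).
  rewrite addrAC lerDr subr_ge0; apply: powR_mono => //.
  by rewrite !ger0_norm ?(le_trans pp)// su.
rewrite -addrA lerDl subr_ge0; apply: powR_mono => //.
have qs : s * phi.1 x <= q * s * phi.1 x.
  by rewrite -mulrA ler_peMl// ltW.
by rewrite !ger0_norm// (le_trans pp).
Qed.

(** The positive part of [c phi - u] is at most [c phi] as [u] is nonnegative, so
    the cost of raising is of order [c^p]. *)
Lemma dir_raise_small c u : 0 < c -> W0 u -> nonneg u ->
  dir (raise c u) <= dir u + p * c `^ p * lam.
Proof.
move=> c0 Wu u0; rewrite -lerBlDl; apply: le_trans (dir_raise c0 Wu) _.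
have Wz : W0 (pos (c *: phi - u)).
  apply: (pos_W0 OmegaP p1).
  exact: (W0B OmegaP p1 (W0Z OmegaP p1 c Wphi) Wu).
have Lz := W0_Lp OmegaP p1 Wz; have [_ lphi _] := Lphi.
have H : mass_form phi (pos (c *: phi - u)) <= c.
  rewrite -[leRHS]mulr1 -[X in _ <= _ * X]phi_mass -(@RintegralZl _ _ _ mu Omega _ _ mO lphi).
  apply: (ae_le_Rintegral mO (mass_form_L1 Lphi Lz) (L1Z mO _ lphi)).
  have := phi_gt0; apply: filterS2 u0 => x u0 px Ox.
  have p0' := ltW (px Ox); rewrite ger0_norm// powRp2//.
  rewrite -(powRp1 p1 p0') mulrA [c * _ * _]mulrC ler_wpM2l ?powR_ge0//.
  rewrite [(pos _).1 x](_ : _ = Num.max (c * phi.1 x - u.1 x) 0)//.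
  by rewrite ge_max mulr_ge0 ?(ltW c0)// andbT lerBlDr lerDl u0.
rewrite -[leRHS]mulrA ler_pM2l// -(powRp1 p1 (ltW c0)) [c * _]mulrC.
rewrite -[leRHS]mulrA; apply: ler_wpM2l; first exact: powR_ge0.
by rewrite mulrC; apply: ler_wpM2r => //; exact: lam_ge0.
Qed.

(** Since [s phi <= u], the factor [phi^(p-1)] is controlled by [u^(p-1)], and
    convexity bounds the form by the gain of mass: the energy grows
    at most at the rate [q^(p-1) lam]. *)
Lemma dir_raise_step q s u : 1 < q -> 0 < s -> W0 u -> above s u ->
  dir (raise (q * s) u) - dir u <=
  q `^ (p - 1) * lam * (mass (raise (q * s) u) - mass u).
Proof.
move=> q1 s0 Wu su; have q0 : 0 < q by exact: lt_trans q1.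
have c0 : 0 < q * s by exact: mulr_gt0.
apply: le_trans (dir_raise c0 Wu) _.
have Wz : W0 (pos ((q * s) *: phi - u)).
  apply: (pos_W0 OmegaP p1).
  exact: (W0B OmegaP p1 (W0Z OmegaP p1 (q * s) Wphi) Wu).
have Lz := W0_Lp OmegaP p1 Wz; have Lu := W0_Lp OmegaP p1 Wu.
have Lr := W0_Lp OmegaP p1 (raise_W0 (q * s) Wu).
have H : p * (s `^ (p - 1) * mass_form phi (pos ((q * s) *: phi - u))) <=
    mass (raise (q * s) u) - mass u.
  have [_ lu _] := Lu; have [_ lr _] := Lr.
  have lf := mass_form_L1 Lphi Lz.
  rewrite -(RintegralB mO lr lu) mulrA -(@RintegralZl _ _ _ mu Omega _ _ mO lf).
  apply: (ae_le_Rintegral mO (L1Z mO _ lf) (L1B mO lr lu)).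
  have := phi_gt0; apply: filterS2 su => x su px Ox.
  have pp := px Ox; have spu := su Ox.
  have sp0 : 0 <= s * phi.1 x by rewrite mulr_ge0// ltW.
  have u0 : 0 <= u.1 x by exact: le_trans spu.
  have r0 : 0 <= (raise (q * s) u).1 x by exact: le_trans (raise_ge _ _ _).
  have z0 : 0 <= (pos ((q * s) *: phi - u)).1 x by rewrite /= le_max lexx orbT.
  rewrite !ger0_norm ?(ltW pp)//.
  apply: le_trans (powR_tangent p1 u0 r0).
  rewrite [(raise _ u).1 x](_ : _ = u.1 x + (pos ((q * s) *: phi - u)).1 x)//.
  rewrite [u.1 x + _]addrC addrK -mulrA ler_pM2l// powRp2 ?(ltW pp)// mulrA.
  apply: ler_wpM2r => //; rewrite -powRM ?(ltW s0) ?(ltW pp)//.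
  by apply: ge0_ler_powR; rewrite ?nnegrE// ltW.
rewrite powRM ?(ltW q0) ?(ltW s0)//.
apply: (@le_trans _ _ (q `^ (p - 1) * lam *
    (p * (s `^ (p - 1) * mass_form phi (pos ((q * s) *: phi - u)))))); last first.
  by apply: ler_wpM2l => //; rewrite mulr_ge0 ?powR_ge0 ?lam_ge0.
by rewrite le_eqVlt; apply/orP; left; apply/eqP; ring.
Qed.

Definition low_sphere (B : R) : set (sobolev_pair R n) :=
  [set w | [/\ sphere Omega p w, nonneg w & dir w < B]].

Lemma normalize_dir w : Lp_pair w -> 0 < mass w ->
  dir (normalize w) = dir w / mass w.
Proof.
move=> Lw m0; have := normalize_mass OmegaP p1 Lw m0.
rewrite /normalize massZ// dirZ//; set a := _ `^ p => am.
have an : a = (mass w)^-1.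
  by rewrite -[RHS]mul1r -am mulfK// gt_eqF.
by rewrite an mulrC.
Qed.

Lemma normalize_sphere w : W0 w -> 0 < mass w -> sphere Omega p (normalize w).
Proof.
move=> Ww m0; split; first exact: (W0Z OmegaP p1 _ Ww).
exact: (normalize_mass OmegaP p1 (W0_Lp OmegaP p1 Ww) m0).
Qed.

(** By convexity the energy of the segment stays below [B m], hence below [B]
    times its mass. *)
Lemma low_segment B m w0 w1 : 0 < m -> W0 w0 -> W0 w1 ->
  nonneg w0 -> nonneg w1 ->
  (forall t, 0 <= t <= 1 -> m <= mass (segment w0 w1 t)) ->
  dir w0 < B * m -> dir w1 < B * m ->
  joined Omega p (low_sphere B) (normalize w0) (normalize w1).
Proof.
move=> m0 W0w W1w w00 w10 Hm D0 D1.
have L0 := W0_Lp OmegaP p1 W0w; have L1w := W0_Lp OmegaP p1 W1w.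
apply: (joined_segment OmegaP p1 L0 L1w) => t t01.
have Ws : W0 (segment w0 w1 t).
  by apply: (W0D OmegaP p1); exact: (W0Z OmegaP p1).
have Ls := W0_Lp OmegaP p1 Ws.
have mt := lt_le_trans m0 (Hm _ t01).
have /andP[t0 t1] := t01.
split; first exact: mt.
split; first exact: normalize_sphere.
- move: w10; apply: filterS2 w00 => x w00 w10 Ox.
  rewrite [(normalize _).1 x](_ : _ = (mass (segment w0 w1 t) `^ p^-1)^-1 *
    ((1 - t) * w0.1 x + t * w1.1 x))//.
  rewrite mulr_ge0// ?invr_ge0 ?powR_ge0// addr_ge0// mulr_ge0 ?w00 ?w10//.
  by rewrite subr_ge0.
- rewrite normalize_dir// ltr_pdivrMr//.
  apply: (@lt_le_trans _ _ (B * m)); last first.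
    have B0 : 0 < B by rewrite -(pmulr_lgt0 _ m0); apply: le_lt_trans D0; exact: dir_ge0.
    by rewrite ler_pM2l// Hm.
  have t01' : 0 <= 1 - t <= 1 by apply/andP; split; [rewrite subr_ge0|rewrite gerBl].
  have := dir_conv mO p1 L0 L1w t01'; rewrite subKr => /le_lt_trans; apply.
  exact: (conv_lt t01 D0 D1).
Qed.

(** The segment from [u] to a larger function stays above [u]. *)
Lemma mass_segment_ge u w t : W0 u -> W0 w -> nonneg u -> 0 <= t <= 1 ->
  {ae mu, forall x, Omega x -> u.1 x <= w.1 x} ->
  mass u <= mass (segment u w t).
Proof.
move=> Wu Ww u0 /andP[t0 t1] uw; apply: mass_le.
- exact: (W0_Lp OmegaP p1 Wu).
- apply: (W0_Lp OmegaP p1).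
  by apply: (W0D OmegaP p1); exact: (W0Z OmegaP p1).
move: uw; apply: filterS2 u0 => x u0 uw Ox; have u0x := u0 Ox; have uwx := uw Ox.
rewrite [(segment _ _ _).1 x](_ : _ = (1 - t) * u.1 x + t * w.1 x)//.
have h : u.1 x <= (1 - t) * u.1 x + t * w.1 x.
  by rewrite mulrBl mul1r -addrA lerDl addrC -mulrBr mulr_ge0// subr_ge0.
by rewrite !ger0_norm// (le_trans u0x).
Qed.

Section chain.
Variables (B K q : R).
Hypotheses (q1 : 1 < q) (lamK : lam * q `^ p <= K) (KB : K * q `^ p < B).

Let q0 : 0 < q. Proof. exact: lt_trans q1. Qed.
Let qp1 : 1 <= q `^ p.
Proof. by have := powR_mono p1 ler01 (ltW q1); rewrite powR1. Qed.
Let K0 : 0 <= K.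
Proof. by apply: le_trans lamK; rewrite mulr_ge0 ?powR_ge0 ?lam_ge0. Qed.

(** The state of the chain at level [s]: [w] is above [s phi], its quotient of
    energy and mass is at most [K], and its mass exceeds that of [s phi] by at
    most [1]. *)
Definition reached u s w := [/\ W0 w, above s w, dir w <= K * mass w,
  mass w <= 1 + s `^ p & joined Omega p (low_sphere B) u (normalize w)].

(** One step costs at most [K] times the gain of mass, because
    [q^(p-1) lam <= K], so the quotient stays at most [K]; on the segment the
    mass varies by a factor at most [q^p] and [K q^p < B]. *)
Lemma reached_step u s w : 0 < s -> reached u s w ->
  reached u (q * s) (raise (q * s) w).
Proof.
move=> s0 [Ww sw Dw Mw Jw].
have c0 : 0 < q * s by exact: mulr_gt0.
have Wr := raise_W0 (q * s) Ww.
have w0 := above_nonneg (ltW s0) sw.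
have [M1 M2] := mass_raise_step q1 s0 Ww sw.
have D1 := dir_raise_step q1 s0 Ww sw.
have Mge := mass_raise_ge (q * s) Ww w0.
have lK : q `^ (p - 1) * lam <= K.
  apply: le_trans lamK; rewrite mulrC ler_wpM2l ?lam_ge0//.
  by apply: ler_powR; [exact: ltW|rewrite gerBl].
have m0 : 0 < mass w.
  by apply: lt_le_trans (mass_above s0 Ww sw); rewrite powR_gt0.
have Dr : dir (raise (q * s) w) <= K * mass (raise (q * s) w).
  have h : q `^ (p - 1) * lam * (mass (raise (q * s) w) - mass w) <=
      K * (mass (raise (q * s) w) - mass w) by rewrite ler_wpM2r// subr_ge0.
  have h3 := le_trans D1 h; rewrite mulrBr lerBlDr in h3.
  by apply: (le_trans h3); rewrite -addrA gerDl addrC subr_le0.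
split => //.
- exact: raise_above.
- by apply: (le_trans M2); rewrite lerBlDr [leRHS]addrAC lerD2r.
apply: (joined_trans Jw).
apply: (@low_segment _ (mass w)) => //.
- exact: above_nonneg (ltW c0) (raise_above _ _).
- move=> t t01; apply: mass_segment_ge => //.
  by apply: aeW => x _; exact: raise_ge.
- apply: (le_lt_trans Dw); rewrite ltr_pM2r//.
  by apply: le_lt_trans KB; rewrite ler_peMr.
- apply: (le_lt_trans Dr); apply: (@le_lt_trans _ _ (K * q `^ p * mass w)).
    by rewrite -mulrA ler_wpM2l.
  by rewrite ltr_pM2r.
Qed.

(** At a high level [T] the excess of mass [1] is negligible with respect to
    [T^p]: the segment to [T phi] stays above [T phi], where the mass is at least
    [T^p], and its energy is at most [K (1 + T^p) < B T^p]. *)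
Lemma reached_phi u s w : 0 < s -> reached u s w ->
  joined Omega p (low_sphere B) u phi.
Proof.
move=> s0 rw.
have [N HN] : exists N, K < (B - K) * (q ^+ N * s) `^ p.
  have qp0 : 0 < q `^ p by rewrite powR_gt0.
  have BK : 0 < B - K by rewrite subr_gt0; apply: le_lt_trans KB; rewrite ler_peMr.
  have qp1' : `|(q `^ p)^-1| < 1.
    rewrite gtr0_norm ?invr_gt0// invf_lt1//.
    by have := gt0_ltr_powR p0 (x := 1) (y := q); rewrite !nnegrE ler01 (ltW q0) powR1 => ->.
  have K10 : 0 < K + 1 by rewrite ltr_wpDl.
  have c0 : 0 < (B - K) * s `^ p / (K + 1).
    by rewrite divr_gt0// mulr_gt0// powR_gt0.
  have /cvgrPdist_lt/(_ _ c0)[N _ /(_ N (leqnn N))] := cvg_expr qp1'.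
  rewrite sub0r normrN gtr0_norm ?exprn_gt0 ?invr_gt0// => HN.
  exists N.
  have E k : (q ^+ k) `^ p = (q `^ p) ^+ k.
    elim: k => [|k ih]; first by rewrite !expr0 powR1.
    by rewrite !exprS powRM ?ih ?exprn_ge0 // ltW.
  rewrite powRM ?exprn_ge0 ?(ltW q0) ?(ltW s0)// E mulrCA.
  rewrite ltr_pdivlMr// exprVn ltr_pdivrMl ?exprn_gt0// in HN.
  by apply: lt_trans HN; rewrite ltrDl.
have [v rv] : exists v, reached u (q ^+ N * s) v.
  elim: N {HN} => [|k [v rv]]; first by exists w; rewrite expr0 mul1r.
  exists (raise (q * (q ^+ k * s)) v); rewrite exprS -mulrA.
  by apply: reached_step => //; rewrite mulr_gt0// exprn_gt0.
move: HN rv; set T := q ^+ N * s => HN [Wv Tv Dv Mv Jv].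
have T0 : 0 < T by rewrite mulr_gt0// exprn_gt0.
have Tp : 0 < T `^ p by rewrite powR_gt0.
rewrite -(normalize_id phi_mass) -(normalizeZ OmegaP p1 Lphi T0).
apply: (joined_trans Jv).
have WT : W0 (T *: phi) := W0Z OmegaP p1 T Wphi.
have aT : above T (T *: phi) by apply: aeW => x _; rewrite lexx.
apply: (@low_segment _ (T `^ p)) => //.
- exact: above_nonneg (ltW T0) Tv.
- exact: above_nonneg (ltW T0) aT.
- move=> t /andP[t0 t1]; apply: (mass_above T0).
    exact: (W0D OmegaP p1 (W0Z OmegaP p1 _ Wv) (W0Z OmegaP p1 _ WT)).
  apply: filterS Tv => x Tv Ox; have h := Tv Ox.
  rewrite [(segment _ _ _).1 x](_ : _ = (1 - t) * v.1 x + t * (T * phi.1 x))//.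
  rewrite [leLHS](_ : _ = (1 - t) * (T * phi.1 x) + t * (T * phi.1 x)); last by ring.
  by rewrite lerD2r ler_wpM2l// subr_ge0.
- apply: (le_lt_trans Dv); apply: (@le_lt_trans _ _ (K * (1 + T `^ p))).
    by rewrite ler_wpM2l.
  by rewrite mulrDr mulr1 -ltrBrDr -mulrBl.
- rewrite dirZ// dir_phi gtr0_norm// mulrC ltr_pM2r//.
  apply: le_lt_trans KB; apply: (@le_trans _ _ K); last by rewrite ler_peMr.
  by apply: le_trans lamK; rewrite ler_peMr// lam_ge0.
Qed.

End chain.

(** A nonnegative function of energy below [B] is first raised to a small
    multiple of [phi], then repeatedly to multiples growing geometrically, and
    is finally joined to a large multiple of [phi]. *)
Theorem joined_phi B u : lam < B -> low_sphere B u ->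
  joined Omega p (low_sphere B) u phi.
Proof.
move=> lB [[Wu u1] u0 uB].
have [K [q [kK q1 kq Kq]]] : exists K q, [/\ Num.max lam (dir u) < K, 1 < q,
    Num.max lam (dir u) * q `^ p <= K & K * q `^ p < B].
  apply: choose_ratio => //; first by rewrite le_max lam_ge0.
  by rewrite gt_max lB.
have lamK : lam * q `^ p <= K.
  by apply: le_trans kq; rewrite ler_wpM2r ?powR_ge0// le_max lexx.
have {}kK : dir u < K by apply: le_lt_trans kK; rewrite le_max lexx orbT.
have K0 : 0 < K by apply: le_lt_trans kK; exact: dir_ge0.
have qp1 : 1 <= q `^ p.
  by have := powR_mono p1 ler01 (ltW q1); rewrite powR1.
pose e := (K - dir u) / (p * lam + 1).
have pl0 : 0 < p * lam + 1 by rewrite ltr_wpDl// mulr_ge0 ?lam_ge0// ltW.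
have e0 : 0 < e by rewrite divr_gt0// subr_gt0.
pose c := e `^ p^-1; have c0 : 0 < c by rewrite powR_gt0.
have cp : c `^ p = e by rewrite -powRrM mulVf ?gt_eqF// powRr1// ltW.
have Wr := raise_W0 c Wu.
have Mge := mass_raise_ge c Wu u0; rewrite [mass u]u1 in Mge.
have Dr : dir (raise c u) <= K.
  apply: le_trans (dir_raise_small c0 Wu u0) _; rewrite cp -lerBrDl mulrAC mulrC.
  by rewrite /e -mulrA ler_piMr ?subr_ge0 ?(ltW kK)// mulrC ler_pdivrMr// mul1r lerDl.
have KB : K < B by apply: le_lt_trans Kq; rewrite ler_peMr// ltW.
apply: (@reached_phi B K q q1 lamK Kq _ c (raise c u)) => //.
split => //.
- exact: raise_above.
- by apply: (le_trans Dr); rewrite ler_peMr// ltW.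
- by have := mass_raise_le c0 Wu u0; rewrite [mass u]u1.
- rewrite -{1}(normalize_id u1); apply: (@low_segment _ 1) => //.
  + exact: above_nonneg (ltW c0) (raise_above _ _).
  + move=> t t01; rewrite -u1; apply: mass_segment_ge => //.
    by apply: aeW => x _; exact: raise_ge.
  + by rewrite mulr1.
  + by rewrite mulr1; apply: le_lt_trans Dr _.
Qed.

End eigenfunction_paths.

(** * The sublevel sets *)

Lemma powR_cvg (R : realType) (p : R) (T : Type) (F : set_system T)
    {FF : Filter F} (f : T -> R) (l : R) : 1 < p ->
  (forall x, 0 <= f x) -> 0 <= l ->
  f x @[x --> F] --> l -> f x `^ p @[x --> F] --> l `^ p.
Proof.
move=> p1 f0 l0 fl; have p0 : 0 < p by exact: lt_trans p1.
pose K := p * (l + 1) `^ (p - 1).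
have K0 : 0 <= K by rewrite mulr_ge0 ?powR_ge0// ltW.
have B x y : 0 <= x -> 0 <= y -> y <= l + 1 -> y `^ p <= x `^ p + K * `|y - x|.
  move=> x0 y0 yl; rewrite -lerBlDl.
  have H := powR_tangent p1 y0 x0; rewrite -lerN2 opprB -mulrN -mulrN opprB in H.
  apply: (le_trans H); rewrite /K -mulrA ler_pM2l//.
  apply: (@le_trans _ _ (y `^ (p - 1) * `|y - x|)).
    by rewrite ler_wpM2l ?powR_ge0// ler_norm.
  rewrite ler_wpM2r//; apply: ge0_ler_powR => //; rewrite ?nnegrE ?subr_ge0 ?(ltW p1)//.
  by rewrite addr_ge0.
apply/cvgrPdist_lt => e e0.
have d0 : 0 < e / (K + 1) by rewrite divr_gt0// ltr_wpDl.
have /cvgrPdist_lt/(_ _ ltr01) := fl; have /cvgrPdist_lt/(_ _ d0) := fl.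
apply: filterS2 => x H1 H2.
have fl1 : f x <= l + 1.
  by move: H2; rewrite ltr_norml => /andP[H2 _]; rewrite -lerBlDl ltW// -ltrN2 opprB.
apply: (@le_lt_trans _ _ (K * `|l - f x|)).
  apply: norm_subr_le; first by apply: B => //; rewrite lerDl.
  by rewrite distrC; exact: B.
apply: (@le_lt_trans _ _ ((K + 1) * `|l - f x|)); first by rewrite ler_wpM2r// lerDl.
by rewrite mulrC -ltr_pdivlMr// ltr_wpDl.
Qed.

Lemma segment_pos (R : realType) (V : lmodType R) (t : R) (u P : V) :
  (1 - t) *: u + t *: P = 1 *: P - (1 - t) *: (P - u).
Proof.
by rewrite scale1r scalerBr opprB addrCA; congr (_ + _); rewrite scalerBl scale1r subKr.
Qed.

Lemma segment_neg (R : realType) (V : lmodType R) (t : R) (u P : V) :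
  (1 - t) *: u + t *: - (P - u) = (1 - t) *: P - 1 *: (P - u).
Proof.
rewrite scale1r scalerN scalerBr !opprB addrA -scalerDl subrK scale1r addrCA.
by congr (_ + _); rewrite scalerBl scale1r addrAC subrr add0r.
Qed.

Lemma quotient_J (R : realType) (s A C d e m : R) :
  A * d + C * e - s * (A * m) = A * (d - s * m) + C * e.
Proof. by ring. Qed.

Lemma quotient_mass (R : realType) (s b A C d e m k : R) :
  A * (d - s * m) + C * e - b * (A * m + C * k) =
  A * (d - (s + b) * m) + C * (e - b * k).
Proof. by ring. Qed.

Lemma ler_dist_max0 (R : realType) (a b : R) :
  `|Num.max a 0 - Num.max b 0| <= `|a - b|.
Proof.
have := ler_norm (a - b); have := ler_norm (b - a); rewrite (distrC b) => h1 h2.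
have h3 := normr_ge0 (a - b).
by apply: norm_subr_le; have [ha|ha] := leP a 0; have [hb|hb] := leP b 0; lra.
Qed.

Section sublevels.
Variables (R : realType) (n : nat) (Omega : set 'rV[R]_n) (p : R).
Hypotheses (OmegaP : bounded_domain Omega) (p1 : 1 < p).
Local Notation mu := (lebesgue_rV R n).
Local Notation mass := (mass Omega p).
Local Notation dir := (dir Omega p).
Local Notation Lp_pair := (Lp_pair Omega p).
Local Notation W0 := (W1p0 Omega p).
Local Notation normX := (normX Omega p).
Local Notation J := (J Omega p).
Local Notation normalize := (normalize Omega p).
Local Notation low_sphere := (low_sphere Omega p).
Local Notation sublevel := (sublevel Omega p).
Local Notation sphere := (sphere Omega p).
Implicit Types (u v w : sobolev_pair R n) (s b t : R).
Let p0 : 0 < p. Proof. exact: lt_trans p1. Qed.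
Let pn0 : p != 0. Proof. by rewrite gt_eqF. Qed.
Let mO := domain_measurable OmegaP.

Lemma JE s u : Lp_pair u -> J s u = dir u - s * mass (pos u).
Proof.
move=> Lu; have [_ lp _] := pos_Lp OmegaP p1 Lu; have [_ _ ldu] := Lu.
rewrite -(@RintegralZl _ _ _ mu Omega _ s mO lp).
rewrite -(RintegralB mO ldu (L1Z mO s lp)); apply: Rintegral_eq => x _.
by rewrite [`|_|]ger0_norm// le_max lexx orbT.
Qed.

(** The negative part, with the gradient that makes [u = pos u - neg u] hold
    exactly. *)
Definition neg u := pos u - u.

Lemma neg_W0 u : W0 u -> W0 (neg u).
Proof. by move=> Wu; exact: (W0B OmegaP p1 (pos_W0 OmegaP p1 Wu) Wu). Qed.

Lemma neg_ge0 u x : 0 <= (neg u).1 x.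
Proof.
rewrite [(neg u).1 x](_ : _ = Num.max (u.1 x) 0 - u.1 x)//.
by rewrite subr_ge0 le_max lexx.
Qed.

Definition comb (a c : R) u := a *: pos u - c *: neg u.

Lemma comb_id u : comb 1 1 u = u.
Proof. by rewrite /comb !scale1r subKr. Qed.

Lemma comb1 a c u x : 0 <= a -> 0 <= c ->
  (comb a c u).1 x = if 0 < u.1 x then a * u.1 x else c * u.1 x.
Proof.
move=> a0 c0; rewrite [LHS](_ : _ = a * Num.max (u.1 x) 0 - c * (Num.max (u.1 x) 0 - u.1 x))//.
have [h|h] := ltP 0 (u.1 x).
  by rewrite subrr mulr0 subr0.
by rewrite mulr0 !sub0r mulrN opprK.
Qed.

Lemma comb2 a c u x :
  (comb a c u).2 x = if 0 < u.1 x then a *: u.2 x else c *: u.2 x.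
Proof.
rewrite [LHS](_ : _ = a *: (if 0 < u.1 x then u.2 x else 0) -
  c *: ((if 0 < u.1 x then u.2 x else 0) - u.2 x))//.
by case: ifP => _; rewrite ?subrr ?scaler0 ?subr0// !sub0r scalerN opprK.
Qed.

Lemma comb_W0 a c u : W0 u -> W0 (comb a c u).
Proof.
move=> Wu; apply: (W0B OmegaP p1).
  exact: (W0Z OmegaP p1 a (pos_W0 OmegaP p1 Wu)).
exact: (W0Z OmegaP p1 c (neg_W0 Wu)).
Qed.

Lemma mass_comb a c u : 0 <= a -> 0 <= c -> W0 u ->
  mass (comb a c u) = a `^ p * mass (pos u) + c `^ p * mass (neg u).
Proof.
move=> a0 c0 Wu.
have [_ lp _] := W0_Lp OmegaP p1 (pos_W0 OmegaP p1 Wu).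
have [_ ln _] := W0_Lp OmegaP p1 (neg_W0 Wu).
rewrite -(@RintegralZl _ _ _ mu Omega _ _ mO lp) -(@RintegralZl _ _ _ mu Omega _ _ mO ln).
rewrite -(RintegralD mO (L1Z mO _ lp) (L1Z mO _ ln)); apply: Rintegral_eq => x _.
rewrite comb1// [(neg u).1 x](_ : _ = Num.max (u.1 x) 0 - u.1 x)//=.
have [h|h] := ltP 0 (u.1 x).
  rewrite subrr normr0 powR0// mulr0 addr0.
  by rewrite normrM (ger0_norm a0) powRM.
rewrite normr0 powR0// mulr0 add0r sub0r normrN.
by rewrite normrM (ger0_norm c0) powRM.
Qed.

Lemma mass_pos_comb a c u : 0 <= a -> 0 <= c -> W0 u ->
  mass (pos (comb a c u)) = a `^ p * mass (pos u).
Proof.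
move=> a0 c0 Wu; have [_ lp _] := W0_Lp OmegaP p1 (pos_W0 OmegaP p1 Wu).
rewrite -(@RintegralZl _ _ _ mu Omega _ _ mO lp); apply: Rintegral_eq => x _.
rewrite [(pos (comb _ _ _)).1 x](_ : _ = Num.max ((comb a c u).1 x) 0)// comb1//=.
have [h|h] := ltP 0 (u.1 x).
  rewrite max_l ?mulr_ge0 ?(ltW h)//.
  by rewrite normrM (ger0_norm a0) powRM.
by rewrite max_r ?mulr_ge0_le0// normr0 powR0// mulr0.
Qed.

Lemma dir_comb a c u : 0 <= a -> 0 <= c -> W0 u ->
  dir (comb a c u) = a `^ p * dir (pos u) + c `^ p * dir (neg u).
Proof.
move=> a0 c0 Wu.
have [_ _ lp] := W0_Lp OmegaP p1 (pos_W0 OmegaP p1 Wu).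
have [_ _ ln] := W0_Lp OmegaP p1 (neg_W0 Wu).
rewrite -(@RintegralZl _ _ _ mu Omega _ _ mO lp) -(@RintegralZl _ _ _ mu Omega _ _ mO ln).
rewrite -(RintegralD mO (L1Z mO _ lp) (L1Z mO _ ln)); apply: Rintegral_eq => x _.
rewrite comb2 [(neg u).2 x](_ : _ = (pos u).2 x - u.2 x)//=.
case: ifP => _.
  rewrite subrr enorm0 powR0// mulr0 addr0.
  by rewrite enormZ (ger0_norm a0) powRM// enorm_ge0.
rewrite enorm0 powR0// mulr0 add0r sub0r enormN.
by rewrite enormZ (ger0_norm c0) powRM// enorm_ge0.
Qed.

Lemma J_comb s a c u : 0 <= a -> 0 <= c -> W0 u ->
  J s (comb a c u) =
  a `^ p * (dir (pos u) - s * mass (pos u)) + c `^ p * dir (neg u).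
Proof.
move=> a0 c0 Wu; rewrite JE; last exact: (W0_Lp OmegaP p1 (comb_W0 a c Wu)).
by rewrite (dir_comb a0 c0 Wu) (mass_pos_comb a0 c0 Wu) quotient_J.
Qed.

(** The two parts do not overlap, so masses and energies add up with the weights
    [a^p] and [c^p]. *)
Lemma comb_sublevel s b a c u : 0 <= a -> 0 <= c -> W0 u ->
  0 < a `^ p * mass (pos u) + c `^ p * mass (neg u) ->
  a `^ p * (dir (pos u) - (s + b) * mass (pos u)) +
    c `^ p * (dir (neg u) - b * mass (neg u)) < 0 ->
  sublevel s b (normalize (comb a c u)).
Proof.
move=> a0 c0 Wu m0 Jb; have Wc := comb_W0 a c Wu.
have mE := mass_comb a0 c0 Wu.
have m0' : 0 < mass (comb a c u) by rewrite mE.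
split; first exact: (normalize_sphere OmegaP p1 Wc).
set k := (mass (comb a c u) `^ p^-1)^-1.
have k0 : 0 < k by rewrite invr_gt0 powR_gt0.
have kp : k `^ p = (mass (comb a c u))^-1.
  have := normalize_mass OmegaP p1 (W0_Lp OmegaP p1 Wc) m0'.
  rewrite (massZ mO k (W0_Lp OmegaP p1 Wc)) (gtr0_norm k0) => kE.
  by rewrite -[RHS]mul1r -kE mulfK// gt_eqF.
have -> : normalize (comb a c u) = comb (k * a) (k * c) u.
  by rewrite /normalize -/k /comb scalerBr !scalerA.
rewrite (J_comb _ (mulr_ge0 (ltW k0) a0) (mulr_ge0 (ltW k0) c0) Wu).
rewrite !powRM ?(ltW k0)// kp -!mulrA -mulrDr.
by rewrite mulrC ltr_pdivrMr// mE -subr_lt0 quotient_mass.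
Qed.

Lemma mass_pos_nonneg w : Lp_pair w -> nonneg Omega w -> mass (pos w) = mass w.
Proof.
move=> Lw w0; have [_ /L1_measurable mp _] := pos_Lp OmegaP p1 Lw.
have [_ /L1_measurable mw _] := Lw.
apply: ae_eq_Rintegral => //; apply: filterS w0 => x w0 Ox.
by rewrite /= max_l// w0.
Qed.

Lemma mass_pos_nonpos w : Lp_pair w -> nonneg Omega w -> mass (pos (- w)) = 0.
Proof.
move=> Lw w0.
have [_ /L1_measurable mp _] := pos_Lp OmegaP p1 (Lp_pairN mO Lw).
rewrite -[RHS](mul0r (fine (mu Omega))) -(Rintegral_cst _ mO).
apply: ae_eq_Rintegral => //; apply: filterS w0 => x w0 Ox.
rewrite [(pos _).1 x](_ : _ = Num.max (- w.1 x) 0)//.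
by rewrite max_r ?normr0 ?powR0// oppr_le0 w0.
Qed.

Lemma low_sphere_sublevel s b : low_sphere (s + b) `<=` sublevel s b.
Proof.
move=> w [[Ww w1] w0 wd]; split => //; have Lw := W0_Lp OmegaP p1 Ww.
by rewrite JE// mass_pos_nonneg// [mass w]w1 mulr1 ltrBlDl.
Qed.

Lemma opp_low_sphere_sublevel s b w : low_sphere b w -> sublevel s b (- w).
Proof.
move=> [[Ww w1] w0 wd]; have Lw := W0_Lp OmegaP p1 Ww.
split; first by split; [exact: (W0N OmegaP p1 Ww)|rewrite -[LHS]/(mass (- w)) massN].
rewrite JE; last exact: Lp_pairN.
by rewrite mass_pos_nonpos// mulr0 subr0 dirN.
Qed.

Lemma sphere_opp w : sphere w -> sphere (- w).
Proof.
move=> [Ww w1]; split; first exact: (W0N OmegaP p1 Ww).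
by rewrite -[LHS]/(mass (- w)) massN.
Qed.

(** On the sphere the masses of the two parts add up to [1], and [- w] exchanges
    them. *)
Lemma J_opp s w : sphere w -> J (- s) (- w) = J s w + s.
Proof.
move=> [Ww w1]; have Lw := W0_Lp OmegaP p1 Ww.
have E : mass (pos (- w)) = mass (neg w).
  apply: Rintegral_eq => x _.
  rewrite [(pos _).1 x](_ : _ = Num.max (- w.1 x) 0)//.
  rewrite [(neg _).1 x](_ : _ = Num.max (w.1 x) 0 - w.1 x)//.
  have [h|h] := ltP 0 (w.1 x).
    by rewrite max_r ?subrr// oppr_le0 ltW.
  by rewrite max_l ?sub0r// oppr_ge0.
have S : mass (pos w) + mass (neg w) = 1.
  have := mass_comb ler01 ler01 Ww; rewrite comb_id powR1 !mul1r => <-.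
  exact: w1.
rewrite (JE _ Lw) (JE _ (Lp_pairN mO Lw)) dirN E.
by rewrite -[X in _ = _ + X]mulr1 -S mulrDr addrA subrK mulNr opprK.
Qed.

(** Along the segment from [u] to its positive part, or to minus its
    negative part, the quotient of [J s] and [mass] is a mean of its values at
    the two parts with varying weights; one of these two values is below
    [b]. *)
Lemma joined_part s b u : sublevel s b u ->
  (exists2 w, low_sphere (s + b) w & joined Omega p (sublevel s b) u w) \/
  (exists2 w, low_sphere b w & joined Omega p (sublevel s b) u (- w)).
Proof.
move=> [[Wu u1] Ju].
have Wp := pos_W0 OmegaP p1 Wu; have Wn := neg_W0 Wu.
have Lu := W0_Lp OmegaP p1 Wu.
have Lp := W0_Lp OmegaP p1 Wp; have Ln := W0_Lp OmegaP p1 Wn.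
have S : mass (pos u) + mass (neg u) = 1.
  have := mass_comb ler01 ler01 Wu; rewrite comb_id powR1 !mul1r => <-.
  exact: u1.
have mp0 := mass_ge0 Omega p (pos u); have mn0 := mass_ge0 Omega p (neg u).
have dp0 := dir_ge0 Omega p (pos u); have dn0 := dir_ge0 Omega p (neg u).
pose X := dir (pos u) - (s + b) * mass (pos u).
pose Y := dir (neg u) - b * mass (neg u).
have XY : X + Y < 0.
  have := J_comb s ler01 ler01 Wu; rewrite comb_id powR1 !mul1r => JuE.
  move: Ju; rewrite JuE -subr_lt0 -[X in _ - X < 0]mulr1 -[X in _ - _ * X]S.
  have := quotient_mass s b 1 1 (dir (pos u)) (dir (neg u)) (mass (pos u)) (mass (neg u)).
  by rewrite !mul1r => ->.
have powt t : 0 <= t <= 1 -> 0 <= 1 - t /\ 0 <= (1 - t) `^ p <= 1.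
  move=> /andP[t0 t1]; have t10 : 0 <= 1 - t by rewrite subr_ge0.
  split => //; rewrite powR_ge0/=.
  by have := powR_mono p1 t10 (_ : 1 - t <= 1); rewrite powR1 gerBl => /(_ t0).
have mean (x y k : R) : x < 0 -> x + y < 0 -> 0 <= k <= 1 -> x + k * y < 0.
  move=> x0 xy0 /andP[k0 k1].
  rewrite (_ : x + k * y = (1 - k) * x + k * (x + y)); last by ring.
  by apply: conv_lt => //; rewrite k0.
have [X0|X0] := ltP X 0.
- left; have m0 : 0 < mass (pos u).
    rewrite lt_def mp0 andbT; apply/eqP => m0.
    by move: X0; rewrite /X m0 mulr0 subr0 ltNge dp0.
  exists (normalize (pos u)).
    split.
    + exact: (normalize_sphere OmegaP p1 Wp).
    + apply: aeW => x _.
      rewrite [(normalize _).1 x](_ : _ = (mass (pos u) `^ p^-1)^-1 * Num.max (u.1 x) 0)//.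
      by rewrite mulr_ge0 ?invr_ge0 ?powR_ge0// le_max lexx orbT.
    + by rewrite (normalize_dir OmegaP p1 Lp m0) ltr_pdivrMr// -subr_lt0.
  rewrite -{1}(normalize_id u1); apply: (joined_segment OmegaP p1 Lu Lp) => t t01.
  have [t10 k01] := powt _ t01.
  have -> : segment u (pos u) t = comb 1 (1 - t) u.
    exact: segment_pos.
  have m1 : 0 < 1 `^ p * mass (pos u) + (1 - t) `^ p * mass (neg u).
    by rewrite powR1 mul1r ltr_pwDl// mulr_ge0// powR_ge0.
  split; first by rewrite mass_comb.
  by apply: comb_sublevel => //; rewrite powR1 mul1r; exact: mean.
- right; have Y0 : Y < 0 by apply: le_lt_trans XY; rewrite lerDr.
  have m0 : 0 < mass (neg u).
    rewrite lt_def mn0 andbT; apply/eqP => m0.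
    by move: Y0; rewrite /Y m0 mulr0 subr0 ltNge dn0.
  exists (normalize (neg u)).
    split.
    + exact: (normalize_sphere OmegaP p1 Wn).
    + apply: aeW => x _.
      rewrite [(normalize _).1 x](_ : _ = (mass (neg u) `^ p^-1)^-1 * (neg u).1 x)//.
      by rewrite mulr_ge0 ?invr_ge0 ?powR_ge0// neg_ge0.
    + by rewrite (normalize_dir OmegaP p1 Ln m0) ltr_pdivrMr// -subr_lt0.
  rewrite -normalizeN -{1}(normalize_id u1).
  apply: (joined_segment OmegaP p1 Lu (Lp_pairN mO Ln)) => t t01.
  have [t10 k01] := powt _ t01.
  have -> : segment u (- neg u) t = comb (1 - t) 1 u.
    exact: segment_neg.
  have m1 : 0 < (1 - t) `^ p * mass (pos u) + 1 `^ p * mass (neg u).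
    by rewrite powR1 mul1r ltr_wpDl// mulr_ge0// powR_ge0.
  split; first by rewrite mass_comb.
  apply: comb_sublevel => //; rewrite powR1 mul1r addrC; apply: mean => //.
  by rewrite addrC.
Qed.

(** By the Poincare inequality the topology of [normX] controls [mass]. *)
Lemma J_path_continuous s A u v g : (0 < n)%N -> A `<=` sphere ->
  path_in Omega p A u v g -> {within `[0, 1], continuous (fun t => J s (g t))}.
Proof.
move=> n0 AS [_ _ gA gc].
have [C C0 HC] := poincare OmegaP p1 (Ordinal n0).
have gW t : t \in `[0, 1] -> W0 (g t) by move=> /gA/AS[].
have gL t : t \in `[0, 1] -> Lp_pair (g t) by move=> /gW; exact: W0_Lp.
suff key (t : R) : t \in `[0, 1] ->
    J s (g r) @[r --> within `[0, 1] (nbhs t)] --> J s (g t).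
  by apply/subspace_continuousP => t t01; exact: key.
move=> t01.
have IT : \forall r \near within `[0, 1]%classic (nbhs t), r \in `[0, 1].
  by rewrite near_withinE; exact: nearW.
pose M r := mass (pos (g r)) `^ p^-1.
have rootK X : 0 <= X -> (X `^ p^-1) `^ p = X.
  by move=> X0; rewrite -powRrM mulVf// powRr1.
have Lip (f : R -> R) k : 0 <= k -> (forall r r', r \in `[0, 1] -> r' \in `[0, 1] ->
    f r <= f r' + k * normX (g r - g r')) ->
    f r @[r --> within `[0, 1] (nbhs t)] --> f t.
  move=> k0 fk; apply/cvgrPdist_lt => e e0.
  have d0 : 0 < e / (k + 1) by rewrite divr_gt0// ltr_wpDl.
  have /cvgrPdist_lt/(_ _ d0) := gc _ t01.
  apply: filterS2 IT => r /= r01.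
  rewrite sub0r normrN ger0_norm ?normX_ge0// => H.
  apply: (@le_lt_trans _ _ (k * normX (g r - g t))).
    apply: norm_subr_le; last exact: fk.
    by rewrite -(normXN _ _ (g r - g t)) opprB; exact: fk.
  apply: (@le_lt_trans _ _ ((k + 1) * normX (g r - g t))).
    by rewrite ler_wpM2r ?normX_ge0// lerDl.
  by rewrite mulrC -ltr_pdivlMr// ltr_wpDl.
have cX : normX (g r) @[r --> within `[0, 1] (nbhs t)] --> normX (g t).
  apply: (Lip (fun r => normX (g r)) 1) => // r r' r01 r'01; rewrite mul1r.
  have := normXD OmegaP p1 (gL _ r'01) (Lp_pairB mO p1 (gL _ r01) (gL _ r'01)).
  by rewrite [g r' + _]addrC subrK.
have cM : M r @[r --> within `[0, 1] (nbhs t)] --> M t.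
  apply: (Lip M (C `^ p^-1)); first exact: powR_ge0.
  move=> r r' r01 r'01.
  have Lr := pos_Lp OmegaP p1 (gL _ r01); have Lr' := pos_Lp OmegaP p1 (gL _ r'01).
  have LB := Lp_pairB mO p1 Lr Lr'.
  have := mass_minkowski mO p1 Lr' LB.
  rewrite [pos (g r') + _]addrC subrK => /le_trans; apply; rewrite lerD2l.
  rewrite /normX -powRM ?dir_ge0//; apply: ge0_ler_powR.
  - by rewrite invr_ge0 ltW.
  - by rewrite nnegrE mass_ge0.
  - by rewrite nnegrE mulr_ge0// dir_ge0.
  have WB := W0B OmegaP p1 (gW _ r01) (gW _ r'01).
  apply: le_trans (HC _ WB).
  have [_ l1 _] := LB; have [_ l2 _] := W0_Lp OmegaP p1 WB.
  apply: (le_Rintegral mO l1 l2) => x _; apply: powR_mono => //.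
  exact: ler_dist_max0.
have E r : r \in `[0, 1] -> J s (g r) = normX (g r) `^ p - s * M r `^ p.
  move=> r01; rewrite (JE _ (gL _ r01)).
  have nE : normX (g r) `^ p = dir (g r) := rootK _ (dir_ge0 _ _ _).
  have mE : M r `^ p = mass (pos (g r)) := rootK _ (mass_ge0 _ _ _).
  exact: (congr2 (fun x y => x - s * y) (esym nE) (esym mE)).
have M0 r : 0 <= M r by exact: powR_ge0.
clearbody M; rewrite (E _ t01).
have H : normX (g r) `^ p - s * M r `^ p @[r --> within `[0, 1] (nbhs t)] -->
    normX (g t) `^ p - s * M t `^ p.
  have hX := powR_cvg p1 (fun r => normX_ge0 Omega p (g r)) (normX_ge0 Omega p (g t)) cX.
  have hM := powR_cvg p1 M0 (M0 t) cM.
  by apply: cvgB; [exact: hX|apply: cvgMl_tmp; exact: hM].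
apply: cvg_trans H; apply: near_eq_cvg; apply: filterS IT => r r01.
by rewrite /= (E _ r01).
Qed.

End sublevels.

(** * The minimax value and the sublevel sets *)

Section minimax.
Variables (R : realType) (n : nat) (Omega : set 'rV[R]_n) (p : R).
Hypotheses (OmegaP : bounded_domain Omega) (p1 : 1 < p) (n0 : (0 < n)%N).
Local Notation joined := (joined Omega p).
Local Notation sublevel := (sublevel Omega p).
Implicit Types (u w : sobolev_pair R n) (s b : R).

(** A path in the sublevel set bounds the infimum strictly because [J s] attains
    its maximum along it. *)
Lemma minimax_lt w s b : (minimax Omega p w s < b%:E)%E <->
  joined (sublevel s b) w (- w).
Proof.
split=> [/ereal_inf_lt[_ [g [g0 g1 gA gc] <-] H]|[g P]].
  exists g; split => // t t01; split; first exact: gA.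
  rewrite -lte_fin; apply: le_lt_trans H.
  by apply: ereal_sup_ubound; exists t.
have [g0 g1 gA gc] := P.
have AS : sublevel s b `<=` sphere Omega p by move=> v [].
have [c c01 Hc] := EVT_max ler01 (@J_path_continuous _ _ _ _ OmegaP p1 s _ _ _ _ n0 AS P).
apply: (@le_lt_trans _ _ (J Omega p s (g c))%:E); last first.
  by rewrite lte_fin; case: (gA c c01).
apply: (@le_trans _ _ (ereal_sup [set (J Omega p s (g t))%:E | t in `[0, 1]])).
  apply: ereal_inf_lbound; exists g => //; split => // t t01.
  by apply: AS; exact: gA.
by apply: ub_ereal_sup => _ [t t01 <-]; rewrite lee_fin; exact: Hc.
Qed.

(** Reverse the path and change its sign. *)
Lemma joined_flip w s b : joined (sublevel s b) w (- w) ->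
  joined (sublevel (- s) (s + b)) w (- w).
Proof.
move=> H; apply: (joined_sym); rewrite -{2}(opprK w); apply: joined_opp H.
move=> v [Sv Jv]; split; first exact: (sphere_opp OmegaP p1 Sv).
by rewrite (J_opp OmegaP p1 s Sv) addrC ltrD2l.
Qed.

(** For [s < 0] the point [(s + b, b)] lies above the diagonal, where the curve
    is the reflected branch; [w |-> - w] exchanges the two branches. *)
Lemma above_curveP w s b : above_curve Omega p w (s + b) b <->
  joined (sublevel s b) w (- w).
Proof.
rewrite /above_curve addrK; have [s0|s0] := leP 0 s.
  by rewrite min_r ?lerDr// ger0_norm// minimax_lt.
rewrite min_l; last by rewrite gerDr ltW.
rewrite ltr0_norm// minimax_lt; split; last exact: joined_flip.
by move=> /joined_flip; rewrite opprK addKr.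
Qed.

End minimax.

Theorem mainTheorem3 (R : realType) (n : nat) (Omega : set 'rV[R]_n)
    (p lam1 : R) (phi1 : sobolev_pair R n) (s b : R)
    (n_gt0 : (0 < n)%N)
    (OmegaP : bounded_domain Omega)
    (p_gt1 : 1 < p)
    (lam1P : first_eigenvalue Omega p lam1)
    (phi1_eigen : eigenfunction Omega p lam1 phi1)
    (phi1_gt0 : {ae lebesgue_rV R n, forall x, Omega x -> 0 < phi1.1 x})
    (phi1_norm : \int[lebesgue_rV R n]_(x in Omega) (phi1.1 x `^ p) = 1)
    (b_gt : Num.max (lam1 - s) lam1 < b) :
  path_connected Omega p (sublevel Omega p s b) <->
  above_curve Omega p phi1 (s + b) b.
Proof.
have [Wphi _ _] := phi1_eigen.
have Lphi := W0_Lp OmegaP p_gt1 Wphi; have [mphi iphi _] := Lphi.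
have mO := domain_measurable OmegaP.
have phi1_mass : mass Omega p phi1 = 1.
  rewrite -phi1_norm; apply: ae_eq_Rintegral => //.
  - exact: L1_measurable iphi.
  - apply: (measurableT_comp (measurable_powR p)).
    by case: mphi.
  by apply: filterS phi1_gt0 => x Hx Ox; rewrite ger0_norm// ltW// Hx.
have [b1 b2] : lam1 < s + b /\ lam1 < b.
  by move: b_gt; rewrite gt_max => /andP[]; rewrite ltrBlDl.
have dphi := dir_phi p_gt1 phi1_eigen phi1_mass.
have low B : lam1 < B -> low_sphere Omega p B phi1.
  move=> h; split; [by split| |by rewrite dphi].
  by apply: filterS phi1_gt0 => x Hx Ox; exact: ltW (Hx Ox).
rewrite (above_curveP OmegaP p_gt1 n_gt0); split=> [H|H].
  apply: H; first exact: (low_sphere_sublevel OmegaP p_gt1 (low _ b1)).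
  exact: (opp_low_sphere_sublevel OmegaP p_gt1 s (low _ b2)).
suff key u : sublevel Omega p s b u -> joined Omega p (sublevel Omega p s b) u phi1.
  by move=> u v /key Hu /key Hv; exact: (joined_trans Hu (joined_sym Hv)).
move=> /(joined_part OmegaP p_gt1)[[w lw]|[w lw]] uw; apply: (joined_trans uw).
  apply: (joined_sub (low_sphere_sublevel OmegaP p_gt1 (b := b))).
  exact: (joined_phi OmegaP p_gt1 phi1_eigen phi1_gt0 phi1_mass b1 lw).
have J1 := joined_phi OmegaP p_gt1 phi1_eigen phi1_gt0 phi1_mass b2 lw.
have J2 := joined_opp (opp_low_sphere_sublevel OmegaP p_gt1 s (b := b)) J1.
exact: (joined_trans J2 (joined_sym H)).
Qed.
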